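(* Let $\Gamma$ be a countable discrete group and suppose $\Lambda\leq\Gamma$ is a co-amenable subgroup. Then every tracial state $\tau$ on $C^*(\Gamma)$ that extends the canonical trace $\tau_0^\Lambda$ on $C^*(\Lambda)$ is supported on $\mathrm{Rad}(\Gamma)$, i.e. $\tau(g)=0$ for every $g\in\Gamma\setminus\mathrm{Rad}(\Gamma)$. In particular, if $\Gamma$ has trivial amenable radical, then the pair $(\Gamma,\Lambda)$ is tracial rigid.
   Context: $C^*(\Gamma)$ is the full group $C^*$-algebra, with canonical inclusions $\Gamma\subset C^*(\Gamma)$ and $C^*(\Lambda)\subseteq C^*(\Gamma)$. The canonical trace $\tau_0^\Gamma$ is the tracial state on $C^*(\Gamma)$ with $\tau_0^\Gamma(g)=0$ for $g\neq e$, $\tau_0^\Gamma(e)=1$; likewise $\tau_0^\Lambda$ on $C^*(\Lambda)$. A trace means a tracial state. The pair $(\Gamma,\Lambda)$ is tracial rigid if $\tau_0^\Gamma$ is the unique tracial extension of $\tau_0^\Lambda$ to $C^*(\Gamma)$. $\mathrm{Rad}(\Gamma)$, the amenable radical, is the maximal normal amenable subgroup of $\Gamma$. $\Lambda\leq\Gamma$ is co-amenable if every continuous affine action of $\Gamma$ on a non-empty compact convex set with a $\Lambda$-fixed point has a $\Gamma$-fixed point. *)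

(* Defs.v *)
(* MathComp-Analysis; complex numbers are R[i] for an arbitrary R : realType.
   [`|x|] for x in R[i] or in a normed module over R[i] is a non-negative real
   of type R[i]. *)
From HB Require Import structures.
From mathcomp Require Import all_boot all_order all_algebra.
From mathcomp Require Import complex.
From mathcomp Require Import all_classical all_reals all_analysis.
Set Implicit Arguments.
Unset Strict Implicit.
Unset Printing Implicit Defensive.
Import Order.TTheory GRing.Theory Num.Theory numFieldNormedType.Exports.
Local Open Scope classical_set_scope.
Local Open Scope complex_scope.
Local Open Scope ring_scope.

(* The inner product is linear in its first variable. *)
HB.mixin Record isHilbert (R : realType) H
    of CompleteNormedModule (R[i] : numClosedFieldType) H := {
  inner : H -> H -> R[i] ;
  inner_linear : forall a x y z,
    inner (a *: x + y) z = a * inner x z + inner y z ;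
  inner_conj : forall x y, inner y x = (inner x y)^* ;
  inner_norm : forall x, inner x x = `|x| ^+ 2
}.

#[short(type="hilbertType")]
HB.structure Definition Hilbert (R : realType) :=
  {H of isHilbert R H & CompleteNormedModule (R[i] : numClosedFieldType) H}.

(* Unital C*-algebras; [GRing.Algebra] forces 1 != 0. The norm is a field of
   the mixin, as Hierarchy Builder cannot join [GRing.Algebra] with
   [CompleteNormedModule]. *)
HB.mixin Record isCStarAlg (R : realType) A
    of GRing.Algebra (R[i] : numClosedFieldType) A := {
  cnorm : A -> R ;
  cnorm_eq0 : forall a, cnorm a = 0 -> a = 0 ;
  cnormD_le : forall a b, cnorm (a + b) <= cnorm a + cnorm b ;
  cnormZ : forall (c : R[i]) a, (cnorm (c *: a))%:C = `|c| * (cnorm a)%:C ;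
  cnormM_le : forall a b : A, cnorm (a * b) <= cnorm a * cnorm b ;
  cnorm_complete : forall x : nat -> A,
    (forall e : R, 0 < e -> exists N, forall m n, (N <= m)%N -> (N <= n)%N ->
       cnorm (x m - x n) < e) ->
    exists a, (fun n => cnorm (x n - a)) @ \oo --> (0 : R) ;
  star : A -> A ;
  starK : involutive star ;
  starD : {morph star : a b / a + b} ;
  starZ : forall (c : R[i]) a, star (c *: a) = c^* *: star a ;
  starM : forall a b, star (a * b) = star b * star a ;
  cnorm_star_mul : forall a, cnorm (star a * a) = cnorm a ^+ 2
}.

#[short(type="cstarAlgType")]
HB.structure Definition CStarAlg (R : realType) :=
  {A of isCStarAlg R A & GRing.Algebra (R[i] : numClosedFieldType) A}.

Section FullGroupCStarAlgebra.
Variables (R : realType) (G : groupType).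

Definition unitary_rep (H : hilbertType R) (pi : G -> {linear H -> H}) : Prop :=
  [/\ pi 1%g =1 id,
      forall g h, pi (g * h)%g =1 pi g \o pi h &
      forall g x y, inner (pi g x) (pi g y) = inner x y].

(* A pair (c, s) presents the element \sum_(g <- s) c g g of C[G]; its
   universal norm is the supremum of the operator norms of its images under
   all unitary representations. *)
Definition universal_norm (c : G -> R[i]) (s : seq G) : R :=
  sup [set r : R | exists (H : hilbertType R) (pi : G -> {linear H -> H}) (x : H),
    [/\ unitary_rep pi, `|x| <= 1 &
        r%:C = `| \sum_(g <- s) c g *: pi g x |]].

(* (A, u) is the completion of C[G] for the universal norm; this determines A
   up to a unique *-isomorphism commuting with the maps u. *)
Definition full_group_cstar (A : cstarAlgType R) (u : G -> A) : Prop :=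
  [/\ u 1%g = 1,
      forall g h, u (g * h)%g = u g * u h,
      forall g, star (u g) = u (g^-1)%g,
      forall a (e : R), 0 < e -> exists (c : G -> R[i]) (s : seq G),
        cnorm (a - \sum_(g <- s) c g *: u g) < e &
      forall (c : G -> R[i]) (s : seq G),
        cnorm (\sum_(g <- s) c g *: u g) = universal_norm c s].

End FullGroupCStarAlgebra.

Section Traces.
Variable R : realType.

Definition tracial_state (A : cstarAlgType R) (tau : {scalar A}) : Prop :=
  [/\ forall a, 0 <= tau (star a * a),
      forall a, `|tau a| <= (cnorm a)%:C,
      tau 1 = 1 &
      forall a b, tau (a * b) = tau (b * a)].

Definition canonical_trace (G : groupType) (A : cstarAlgType R) (u : G -> A)
    (tau : {scalar A}) : Prop :=
  tracial_state tau /\ forall g, tau (u g) = (g == 1%g)%:R.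

Definition canonical_inclusion (G : groupType) (S : {pred G})
    (L : subGroupType S) (A B : cstarAlgType R) (u : G -> A) (v : L -> B)
    (j : {lrmorphism B -> A}) : Prop :=
  [/\ forall b, j (star b) = star (j b),
      forall b, cnorm (j b) = cnorm b &
      forall l, j (v l) = u (val l)].

Definition extends (A B : cstarAlgType R) (j : {lrmorphism B -> A})
    (tau : {scalar A}) (tau0 : {scalar B}) : Prop :=
  forall b, tau (j b) = tau0 b.

Definition tracial_rigid (G : groupType) (S : {pred G})
    (L : subGroupType S) (A B : cstarAlgType R) (u : G -> A) (v : L -> B)
    (j : {lrmorphism B -> A}) : Prop :=
  exists (tauG : {scalar A}) (tauL : {scalar B}),
    [/\ canonical_trace u tauG, canonical_trace v tauL, extends j tauG tauL &
        forall tau : {scalar A}, tracial_state tau -> extends j tau tauL ->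
          tau =1 tauG].

End Traces.

Section Amenability.
Variables (R : realType) (G : groupType).

Definition normal_subgroup (N : set G) : Prop :=
  [/\ N 1%g,
      forall x y, N x -> N y -> N (x * y^-1)%g &
      forall g x, N x -> N (g * x * g^-1)%g].

(* N carries a left-invariant finitely additive probability measure, defined
   on all subsets of N. *)
Definition amenable_subgroup (N : set G) : Prop :=
  exists m : set G -> R,
    [/\ forall A, A `<=` N -> 0 <= m A,
        m N = 1,
        forall A B, A `<=` N -> B `<=` N -> A `&` B = set0 ->
          m (A `|` B) = m A + m B &
        forall g A, N g -> A `<=` N -> m [set (g * x)%g | x in A] = m A].

Definition amenable_radical (N : set G) : Prop :=
  [/\ normal_subgroup N, amenable_subgroup N &
      forall M, normal_subgroup M -> amenable_subgroup M -> M `<=` N].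

(* An action on K is given by maps of the ambient space, constrained on K. *)
Definition continuous_affine_action (E : tvsType R) (K : set E)
    (act : G -> E -> E) : Prop :=
  [/\ forall g x, K x -> K (act g x),
      forall x, K x -> act 1%g x = x,
      forall g h x, K x -> act (g * h)%g x = act g (act h x),
      forall g, {within K, continuous (act g)} &
      forall g x y (t : R), K x -> K y -> 0 <= t <= 1 ->
        act g (t *: x + (1 - t) *: y) = t *: act g x + (1 - t) *: act g y].

(* [tvsType] is locally convex, but not necessarily Hausdorff. *)
Definition coamenable (L : set G) : Prop :=
  forall (E : tvsType R) (K : set E) (act : G -> E -> E),
    hausdorff_space E -> compact K -> convex_set K -> K !=set0 ->
    continuous_affine_action K act ->
    (exists2 x, K x & forall l, L l -> act l x = x) ->
    exists2 x, K x & forall g, act g x = x.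

End Amenability.

(* Main.v *)
(* The function t(g) = |τ(g)|² is a positive definite class function on Γ whose
   restriction to Λ is δ_e, and it has the same support as τ.

   Since t is a class function, the moments a_k of a self-adjoint operator in
   the commutant of Λ on ℓ²(Γ) satisfy a_k² <= a_0 a_2k and stay bounded, so the
   cyclic vector of t defines a state on that commutant.  A sublinear (Hahn-Banach)
   argument then gives a Λ-equivariant unital positive map from ℓ^∞(Γ) to the
   operators on the space of t, and co-amenability, applied to the compact
   convex set of all unital positive maps, gives a Γ-equivariant one, T.  The
   means f ↦ <T(f) ξ, ξ> so obtained form a compact left ideal for convolution.
   In a minimal left ideal Q inside it every point is the convolution of such a
   mean with any other point of Q.  Maximizing a strictly convex function on Q
   forces a variance to vanish, and by Cauchy-Schwarz every g with t(g) ≠ 0 then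
   fixes Q.  The elements fixing Q form a normal subgroup which is amenable, as
   the points of Q are means invariant under it.

   For rigidity, the canonical trace exists because the left regular
   representation on ℓ²(Γ) extends to C*(Γ). *)
Require Import Defs.
From HB Require Import structures.
From mathcomp Require Import all_boot all_order all_algebra.
From mathcomp Require Import complex.
From mathcomp Require Import all_classical all_reals all_analysis.
From mathcomp Require finmap.
From mathcomp Require Import ring lra.
Set Implicit Arguments.
Unset Strict Implicit.
Unset Printing Implicit Defensive.
Import Order.TTheory GRing.Theory Num.Theory numFieldNormedType.Exports.
Local Open Scope classical_set_scope.
Local Open Scope complex_scope.
Local Open Scope ring_scope.

(** * Positive semidefinite kernels *)

Section Forms.
Variable R : realFieldType.

(** Passing to |τ|² makes the kernels, the positive maps and the compact convex set real, which is
    the setting of co-amenability; positive definiteness survives by the Schur product theorem.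
    Neither the space of t nor operators on it are constructed: a vector is a finite list of
    weighted group elements and an operator is its table of matrix coefficients, so each instance of
    positivity involves finitely many coordinates and is a closed condition. The delicate point is
    the positivity of the functional on the commutant. A matrix invariant under Λ acts on vectors
    labelled by pairs (r, x). For one r they span an isometric copy of ℓ²(Γ), but the copies for
    different r need not be orthogonal, so a contraction of ℓ²(Γ) is not visibly a contraction of
    their sum. It only has bounded powers on a sum η of finitely many vectors; for a positive
    symmetric Q this already forces <Qη, η> <= <η, η>. The class function property enters once more
    when the means are shown to form a left ideal: right translation of the coefficients of T then
    preserves T(1). *)

Definition form (I : Type) (K : I -> I -> R) (w w' : seq (R * I)) : R :=
  \sum_(p <- w) \sum_(q <- w') p.1 * q.1 * K p.2 q.2.

(** No symmetry is required: the real quadratic form sees only the symmetric part of [K], so a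
    kernel and its transpose are psd together. *)
Definition psd (I : Type) (K : I -> I -> R) : Prop :=
  forall w, 0 <= form K w w.

Definition scale (I : Type) (a : R) (w : seq (R * I)) : seq (R * I) :=
  [seq (a * p.1, p.2) | p <- w].

Section FormTheory.
Variables (I : Type) (K : I -> I -> R).
Implicit Types w : seq (R * I).

Lemma form_catl w1 w2 w : form K (w1 ++ w2) w = form K w1 w + form K w2 w.
Proof. by rewrite /form big_cat. Qed.

Lemma form_catr w w1 w2 : form K w (w1 ++ w2) = form K w w1 + form K w w2.
Proof.
by rewrite /form -big_split; apply: eq_bigr => p _; rewrite big_cat.
Qed.

Lemma form_scalel a w w' : form K (scale a w) w' = a * form K w w'.
Proof.
rewrite /form big_map big_distrr; apply: eq_bigr => p _.
by rewrite big_distrr; apply: eq_bigr => q _ /=; ring.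
Qed.

Lemma form_scaler a w w' : form K w (scale a w') = a * form K w w'.
Proof.
rewrite /form big_distrr; apply: eq_bigr => p _.
by rewrite big_map big_distrr; apply: eq_bigr => q _ /=; ring.
Qed.

Lemma formC w w' : (forall x y, K x y = K y x) -> form K w w' = form K w' w.
Proof.
move=> Ksym; rewrite /form exchange_big; apply: eq_bigr => p _.
by apply: eq_bigr => q _; rewrite Ksym; ring.
Qed.

Lemma form_map (J : Type) (f f' : J -> I) (w w' : seq (R * J)) :
  form K [seq (p.1, f p.2) | p <- w] [seq (p.1, f' p.2) | p <- w'] =
  form (fun x y => K (f x) (f' y)) w w'.
Proof.
by rewrite /form big_map; apply: eq_bigr => p _; rewrite big_map.
Qed.

Lemma psd_map (J : Type) (f : J -> I) : psd K -> psd (fun x y => K (f x) (f y)).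
Proof. by move=> Kpsd w; rewrite -form_map. Qed.

Lemma form_CauchySchwarz w w' : (forall x y, K x y = K y x) -> psd K ->
  form K w w' ^+ 2 <= form K w w * form K w' w'.
Proof.
move=> Ksym Kpsd.
set A := form K w w; set B := form K w w'; set C := form K w' w'.
have quad x y : 0 <= x ^+ 2 * A + 2 * (x * y) * B + y ^+ 2 * C.
  have := Kpsd (scale x w ++ scale y w').
  rewrite form_catl !form_catr !form_scalel !form_scaler -/A -/B -/C.
  by rewrite (formC w' w Ksym) -/B; congr (_ <= _); ring.
have A0 : 0 <= A := Kpsd w.
have : 0 <= C := Kpsd w'.
rewrite le_eqVlt => /predU1P[C0|C0].
  by have := quad B (- (A + 1)); rewrite -C0; nra.
have h : 0 <= C * (A * C - B ^+ 2) by have := quad C (- B); nra.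
by move: h; rewrite pmulr_rge0// subr_ge0.
Qed.

End FormTheory.

Lemma eq_form (I : Type) (K K' : I -> I -> R) w w' :
  (forall x y, K x y = K' x y) -> form K w w' = form K' w w'.
Proof.
by move=> h; rewrite /form; apply: eq_bigr => p _; apply: eq_bigr => q _; rewrite h.
Qed.

Lemma eq_psd (I : Type) (K K' : I -> I -> R) :
  (forall x y, K x y = K' x y) -> psd K -> psd K'.
Proof. by move=> h hK w; rewrite -(eq_form _ _ h). Qed.

Lemma form_kernelD (I : Type) (K K' : I -> I -> R) w w' :
  form (fun x y => K x y + K' x y) w w' = form K w w' + form K' w w'.
Proof.
rewrite /form -big_split; apply: eq_bigr => p _.
by rewrite -big_split; apply: eq_bigr => q _ /=; ring.
Qed.

Lemma form_kernelZ (I : Type) a (K : I -> I -> R) w w' :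
  form (fun x y => a * K x y) w w' = a * form K w w'.
Proof.
rewrite /form big_distrr; apply: eq_bigr => p _.
by rewrite big_distrr; apply: eq_bigr => q _ /=; ring.
Qed.

Lemma psdD (I : Type) (K K' : I -> I -> R) :
  psd K -> psd K' -> psd (fun x y => K x y + K' x y).
Proof. by move=> h h' w; rewrite form_kernelD addr_ge0. Qed.

Lemma psdZ (I : Type) a (K : I -> I -> R) :
  0 <= a -> psd K -> psd (fun x y => a * K x y).
Proof. by move=> a0 h w; rewrite form_kernelZ mulr_ge0. Qed.

(** Grouping the entries of [w] by the value of [a] removes all cross terms, and the form splits
    into one form per value. *)
Lemma psd_blocks (I : Type) (J : eqType) (a : I -> J) (K : I -> I -> R) :
  (forall w c, all (fun p => a p.2 == c) w -> 0 <= form K w w) ->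
  psd (fun x y => (a x == a y)%:R * K x y).
Proof.
move=> Kblock w.
pose X := undup [seq a p.2 | p <- w].
suff -> : form (fun x y => (a x == a y)%:R * K x y) w w =
    \sum_(c <- X) form K [seq p <- w | a p.2 == c] [seq p <- w | a p.2 == c].
  by apply: sumr_ge0 => c _; apply: Kblock (filter_all _ _).
transitivity (\sum_(p <- w) \sum_(c <- X | a p.2 == c)
   \sum_(q <- w | a q.2 == c) p.1 * q.1 * K p.2 q.2); last first.
  rewrite (exchange_big_dep predT)//=; apply: eq_bigr => c _.
  by rewrite /form big_filter; apply: eq_bigr => p _; rewrite big_filter.
have aX : all (fun p => a p.2 \in X) w.
  have : all (mem X) [seq a p.2 | p <- w].
    by apply/allP => x; rewrite /= mem_undup.
  by rewrite all_map.
have wE (F : R * I -> R) : \sum_(p <- w) F p = \sum_(p <- w | a p.2 \in X) F p.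
  by rewrite -[RHS]big_filter; move/all_filterP: aX => ->.
rewrite /form wE [RHS]wE; apply: eq_bigr => p pX.
transitivity (\sum_(c <- X | c == a p.2)
   \sum_(q <- w | a q.2 == c) p.1 * q.1 * K p.2 q.2); last first.
  by apply: eq_bigl => c; rewrite eq_sym.
rewrite -[RHS]big_filter -[seq.filter _ X]/(seq.filter (pred1 (a p.2)) X).
rewrite (filter_pred1_uniq _ pX) ?undup_uniq// big_seq1.
rewrite [RHS]big_mkcond; apply: eq_bigr => q _ /=; rewrite eq_sym.
by case: (_ == _); rewrite ?mul1r ?mul0r ?mulr0.
Qed.

Lemma psd_block (I : Type) (J : eqType) (a : I -> J) (K : I -> I -> R) :
  psd K -> psd (fun x y => (a x == a y)%:R * K x y).
Proof. by move=> Kpsd; apply: psd_blocks. Qed.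

Lemma psd_diag (I : eqType) (phi : I -> R) : (forall x, 0 <= phi x) ->
  psd (fun x y => (x == y)%:R * phi x).
Proof.
move=> phi0; apply: (@psd_blocks I I id) => w c /allP wc.
suff -> : form (fun x _ => phi x) w w = phi c * (\sum_(p <- w) p.1) ^+ 2.
  by rewrite mulr_ge0 ?sqr_ge0.
rewrite /form expr2 mulr_suml mulr_sumr big_seq [RHS]big_seq.
apply: eq_bigr => p pw; rewrite !mulr_sumr; apply: eq_bigr => q _.
by rewrite (eqP (wc _ pw)); ring.
Qed.

Lemma form_flatten (I J J' : Type) (K : I -> I -> R) (s : seq J) (s' : seq J')
    (f : J -> seq (R * I)) (f' : J' -> seq (R * I)) :
  form K (flatten (map f s)) (flatten (map f' s')) =
  \sum_(x <- s) \sum_(y <- s') form K (f x) (f' y).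
Proof.
elim: s => [|x s IHs] /=; first by rewrite /form !big_nil.
rewrite form_catl big_cons IHs; congr (_ + _).
elim: s' {IHs} => [|y s' IHs'] /=; last by rewrite form_catr big_cons IHs'.
by rewrite big_nil; apply: big1 => p _; exact: big_nil.
Qed.

(** Expand the square and bound each cross term by [2 <a, b> <= <a, a> + <b, b>]. *)
Lemma form_flatten_le (I J : Type) (K : I -> I -> R) (s : seq J)
    (f : J -> seq (R * I)) :
  (forall x y, K x y = K y x) -> psd K ->
  form K (flatten (map f s)) (flatten (map f s)) <=
  (size s)%:R * \sum_(x <- s) form K (f x) (f x).
Proof.
move=> Ksym Kpsd.
have two (a b : seq (R * I)) : 2 * form K a b <= form K a a + form K b b.
  have := Kpsd (a ++ scale (-1) b).
  rewrite form_catl !form_catr !form_scalel !form_scaler (formC b a Ksym); lra.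
rewrite form_flatten; set Sg := \sum_(x <- s) form K (f x) (f x).
have : \sum_(x <- s) \sum_(y <- s) (2 * form K (f x) (f y)) <=
   \sum_(x <- s) \sum_(y <- s) (form K (f x) (f x) + form K (f y) (f y)).
  by apply: ler_sum => x _; apply: ler_sum => y _.
have -> : \sum_(x <- s) \sum_(y <- s) (form K (f x) (f x) + form K (f y) (f y)) =
   2 * ((size s)%:R * Sg).
  rewrite (eq_bigr (fun x => (size s)%:R * form K (f x) (f x) + Sg)); last first.
    move=> x _; rewrite big_split /= -/Sg; congr (_ + _).
    by rewrite big_const_seq count_predT iter_addr addr0 mulr_natl.
  rewrite big_split /= -big_distrr /= -/Sg.
  by rewrite big_const_seq count_predT iter_addr addr0 -[_ *+ _]mulr_natl; ring.
have -> : \sum_(x <- s) \sum_(y <- s) (2 * form K (f x) (f y)) =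
   2 * \sum_(x <- s) \sum_(y <- s) form K (f x) (f y).
  by rewrite big_distrr; apply: eq_bigr => x _; rewrite -big_distrr.
by lra.
Qed.

End Forms.

(** If [a 1 > a 0], each doubling of the index at least squares the ratio to [a 0], so [a (2 ^ n)]
    is unbounded. Bernoulli's lower bound [1 + 2 ^ n * b] on that ratio is enough. *)
Lemma moment_le (R : realType) (a : nat -> R) (C : R) :
  0 <= a 0%N -> (forall k, a k ^+ 2 <= a 0%N * a (k + k)%N) ->
  (forall k, a (k + k)%N <= C) -> a 1%N <= a 0%N.
Proof.
move=> a0 alog aC; rewrite leNgt; apply/negP => a01.
have {}a0 : 0 < a 0%N.
  rewrite lt_def a0 andbT; apply/eqP => a00; move: a01 (alog 1%N).
  by rewrite a00 mul0r => ? ?; nra.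
pose b := a 1%N / a 0%N - 1.
have b0 : 0 < b by rewrite subr_gt0 ltr_pdivlMr// mul1r.
have grow n : a 0%N * (1 + (2 ^ n)%:R * b) <= a (2 ^ n)%N.
  elim: n => [|n IHn].
    by rewrite expn0 mul1r /b addrC subrK mulrC divfK ?gt_eqF.
  rewrite expnS mul2n -addnn -(ler_pM2l a0); apply: le_trans (alog _).
  have nb0 : 0 <= (2 ^ n)%:R * b by rewrite mulr_ge0 ?ler0n ?ltW.
  have : (a 0%N * (1 + (2 ^ n)%:R * b)) ^+ 2 <= a (2 ^ n)%N ^+ 2.
    by rewrite lerXn2r// nnegrE ?(le_trans _ IHn)// mulr_ge0 ?ltW//; lra.
  apply: le_trans; rewrite exprMn expr2 -!mulrA !(ler_pM2l a0).
  by rewrite natrD; nra.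
have [n Cn] : exists n : nat, C < a 0%N * (1 + n.*2%:R * b).
  exists (Num.trunc (C / (a 0%N * b))).+1.
  have ab0 : 0 < a 0%N * b by rewrite mulr_gt0.
  have : C / (a 0%N * b) < (Num.trunc (C / (a 0%N * b))).+1%:R.
    by rewrite truncnS_gt.
  rewrite ltr_pdivrMr// -addnn natrD; set m := (_%:R) => Cm.
  have m0 : 0 <= m by rewrite ler0n.
  nra.
have := grow n.+1; rewrite expnS mul2n -addnn => /le_trans /(_ (aC _)).
rewrite leNgt => /negP; apply; apply: lt_le_trans Cn _.
rewrite ler_pM2l// lerD2l ler_pM2r// ler_nat -addnn leq_add// ltnW// ltn_expl//.
Qed.

(** * Kernels invariant under a subgroup and positivity of their trace *)

Section OrbitKernels.
Variables (R : realType) (G : groupType) (L : {pred G}).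
Hypothesis L1 : 1%g \in L.
Hypothesis LM : forall x y, x \in L -> y \in L -> (x * y)%g \in L.
Hypothesis LV : forall x, x \in L -> (x^-1)%g \in L.

Lemma memL_V x : ((x^-1)%g \in L) = (x \in L).
Proof. by apply/idP/idP => /LV //; rewrite invgK. Qed.

Lemma memL_Ml x y : x \in L -> ((x * y)%g \in L) = (y \in L).
Proof.
move=> xL; apply/idP/idP => [xyL|]; last exact: LM.
by rewrite -(mulKg x y); apply: LM => //; exact: LV.
Qed.

Lemma memL_Mr x y : y \in L -> ((x * y)%g \in L) = (x \in L).
Proof. by move=> yL; rewrite -memL_V invgM memL_Ml ?memL_V. Qed.

(* The matrix of the operator sum_(l in L) f(l) |l^-1 a><l^-1 b|. *)
Definition orbk (f : G -> R) (a b x y : G) : R :=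
  (((a / x)%g \in L) && ((a / x)%g == (b / y)%g))%:R * f (a / x)%g.

(** A finite combination of matrices invariant under left translation by [L], each carried by one
    pair of cosets. *)
Definition kern (cs : seq (R * (G * G))) (x y : G) : R :=
  \sum_(c <- cs) c.1 * orbk (fun=> 1) c.2.1 c.2.2 x y.

Lemma orbkC f a b x y : orbk f a b x y = orbk f b a y x.
Proof.
rewrite /orbk [in RHS]eq_sym andbC [in RHS]andbC.
by have [->|] := eqVneq (a / x)%g (b / y)%g; rewrite ?mul0r.
Qed.

(** Polarization: the weights [B + f] and [B - f] on [L] are nonnegative. Evaluating the first at
    [u + v], the second at [u - v], and adding leaves [2 B (<u, u> + <v, v>) + 4 f(u, v)], four
    times the claim. *)
Lemma orbk_dominated (f : G -> R) (B : R) a b : (forall x, `|f x| <= B) ->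
  psd (fun x y => B / 2 * orbk (fun=> 1) a a x y
                  + B / 2 * orbk (fun=> 1) b b x y + orbk f a b x y).
Proof.
move=> fB w.
pose u := [seq (p.1, a / p.2)%g | p <- w].
pose v := [seq (p.1, b / p.2)%g | p <- w].
pose phi (e : R) (l : G) := (l \in L)%:R * (B + e * f l).
pose D e (x y : G) := (x == y)%:R * phi e x.
have Dsym e x y : D e x y = D e y x.
  by rewrite /D eq_sym; case: eqVneq => [->|_]; rewrite ?mul0r.
have Dpsd e : (e == 1) || (e == -1) -> psd (D e).
  move=> e1; apply: psd_diag => x; rewrite mulr_ge0 ?ler0n//.
  by have := fB x; rewrite ler_norml => /andP[]; case/orP: e1 => /eqP ->; lra.
have := Dpsd 1 _ (u ++ v); have := Dpsd (-1) _ (u ++ scale (-1) v).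
rewrite !eqxx orbT => /(_ isT) h2 /(_ isT) h1; move: h1 h2.
rewrite !form_catl !form_catr !form_scalel !form_scaler.
rewrite !(formC v u (Dsym _)).
rewrite !form_kernelD !form_kernelZ.
have DE (e : R) (s t : G) : form (D e) [seq (p.1, s / p.2)%g | p <- w]
    [seq (p.1, t / p.2)%g | p <- w] =
    B * form (orbk (fun=> 1) s t) w w + e * form (orbk f s t) w w.
  rewrite (form_map _ (fun x => s / x)%g (fun x => t / x)%g) -!form_kernelZ -form_kernelD.
  apply: eq_form => x y.
  rewrite /D /phi /orbk mulr1.
  case: (_ == _); case: (_ \in L) => /=; ring.
rewrite !DE; lra.
Qed.

Definition swap_pairs (cs : seq (R * (G * G))) : seq (R * (G * G)) :=
  [seq (c.1, (c.2.2, c.2.1)) | c <- cs].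

(* The action on R^(G) of the operator with matrix [kern cs]. *)
Definition step (cs : seq (R * (G * G))) (w : seq (R * G)) : seq (R * G) :=
  [seq (c.1 * p.1, (p.2 / c.2.2 * c.2.1)%g)
     | p <- w, c <- [seq c <- cs | (p.2 / c.2.2)%g \in L]].

Lemma big_step cs w (F : R * G -> R) :
  \sum_(q <- step cs w) F q = \sum_(p <- w) \sum_(c <- cs)
    ((p.2 / c.2.2)%g \in L)%:R * F (c.1 * p.1, (p.2 / c.2.2 * c.2.1)%g).
Proof.
rewrite big_allpairs_dep; apply: eq_bigr => p _; rewrite big_filter big_mkcond.
by apply: eq_bigr => c _; case: ifP; rewrite ?mul1r ?mul0r.
Qed.

Lemma form_step cs w w' :
  form (fun x y => (x == y)%:R) w' (step cs w) = form (kern cs) w' w.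
Proof.
rewrite /form; apply: eq_bigr => q _; rewrite big_step.
apply: eq_bigr => p _; rewrite /kern mulr_sumr; apply: eq_bigr => c _ /=.
rewrite /orbk mulr1.
have -> : ((q.2 == p.2 / c.2.2 * c.2.1)%g)
    = ((c.2.1 / q.2)%g == (c.2.2 / p.2)%g).
  apply/eqP/eqP => [->|h]; first by rewrite !invgM invgK mulgA mulgV mul1g.
  by rewrite -[(p.2 / _)%g]invgK invgF -h invgM invgK -mulgA mulVg mulg1.
case: eqVneq => [->|_]; last by rewrite andbF !mulr0.
by rewrite andbT -memL_V invgF /=; ring.
Qed.

Lemma kern_swap cs x y : kern (swap_pairs cs) x y = kern cs y x.
Proof.
by rewrite /kern big_map; apply: eq_bigr => c _ /=; rewrite orbkC.
Qed.

Lemma kern_sym cs x y : perm_eq (swap_pairs cs) cs -> kern cs x y = kern cs y x.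
Proof. by move=> cssym; rewrite -kern_swap /kern (perm_big _ cssym). Qed.

(** For the operator Q of [cs] and [v = Q w], Cauchy-Schwarz for the form of Q gives [|v|^4 = <v, Q
    w>^2 <= <v, Q v> <w, Q w> <= |v|^2 |w|^2]. *)
Lemma step_contraction cs w : perm_eq (swap_pairs cs) cs -> psd (kern cs) ->
  psd (fun x y => (x == y)%:R - kern cs x y) ->
  form (fun x y => (x == y)%:R) (step cs w) (step cs w) <=
  form (fun x y => (x == y)%:R) w w.
Proof.
move=> cssym kpsd kle; set N := form _.
have ksym x y : kern cs x y = kern cs y x by exact: kern_sym.
have Nk v : form (kern cs) v v <= N v v.
  have kE : form (fun x y => (x == y)%:R - kern cs x y) v v =
      N v v - form (kern cs) v v.
    rewrite -mulN1r -form_kernelZ -form_kernelD.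
    by apply: eq_form => x y; rewrite mulN1r.
  by have := kle v; rewrite kE subr_ge0.
set v := step cs w.
have := form_CauchySchwarz v w ksym kpsd.
rewrite -form_step -/v => h.
have k0 := kpsd v; have k0' := kpsd w.
have := Nk v; have := Nk w; rewrite -/N in h *.
move: k0 k0' h; move: (form (kern cs) v v) (form (kern cs) w w) => A B.
move: (N v v) (N w w) => X Y A0 B0 h BY AX.
have : X ^+ 2 <= X * Y by apply: le_trans h _; apply: ler_pM.
have [->|X0] : X = 0 \/ 0 < X.
- by have : 0 <= X by [exact: le_trans AX]; rewrite le_eqVlt => /predU1P[]; auto.
- by move=> _; exact: le_trans BY.
- by rewrite expr2 ler_pM2l.
Qed.

Variable t : G -> R.
Hypothesis t1 : t 1%g = 1.
Hypothesis tV : forall x, t (x^-1)%g = t x.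
Hypothesis tC : forall x y, t (x * y)%g = t (y * x)%g.
Hypothesis tL : forall x, x \in L -> t x = (x == 1%g)%:R.
Hypothesis tpsd : psd (fun x y => t (x^-1 * y)%g).

(* gram (r, x) (r', x') is the inner product of the vectors
   (x^-1 r) xi ⊗ δ_(L x) and (x'^-1 r') xi ⊗ δ_(L x'), where xi is the cyclic
   vector of t.  For fixed r they are orthonormal, as t is a class function
   that vanishes on L minus the identity. *)
Definition gram (p q : G * G) : R :=
  ((p.2 / q.2)%g \in L)%:R * t (p.1^-1 * (p.2 / q.2) * q.1)%g.

Lemma gramC p q : gram p q = gram q p.
Proof.
rewrite /gram -memL_V invgF -[in LHS]tV; congr (_ * t _).
by rewrite !invgM !invgK !mulgA.
Qed.

Definition coset_rep (x : G) : G := xget 1%g [set y | (x / y)%g \in L].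

Lemma coset_repP x : (x / coset_rep x)%g \in L.
Proof.
have : exists y, [set y | (x / y)%g \in L] y by exists x; rewrite /= mulgV.
by move/(xgetPex 1%g).
Qed.

Lemma coset_rep_eq x y : (x / y)%g \in L -> coset_rep x = coset_rep y.
Proof.
move=> xy; rewrite /coset_rep; congr xget; apply/seteqP.
have E z : ((x / z)%g \in L) = ((y / z)%g \in L).
  by rewrite -[(x / z)%g](divgKA y) memL_Ml.
by split => z /=; rewrite E.
Qed.

Lemma coset_repE x y : (coset_rep x == coset_rep y) = ((x / y)%g \in L).
Proof.
apply/eqP/idP => [h|]; last exact: coset_rep_eq.
have := coset_repP y; rewrite -h -memL_V invgF => hy.
by rewrite -(divgKA (coset_rep x)) memL_Mr// coset_repP.
Qed.

Lemma gram_psd : psd gram.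
Proof.
have := psd_block (fun p : G * G => coset_rep p.2)
  (psd_map (fun p : G * G => (p.2^-1 * p.1)%g) tpsd).
apply: eq_psd => p q; rewrite coset_repE /gram; congr (_ * t _).
by rewrite invgM invgK !mulgA.
Qed.

Lemma gram_diag r x y : gram (r, x) (r, y) = (x == y)%:R.
Proof.
rewrite /gram /= tC mulgA mulgV mul1g.
case: (boolP (_ \in L)) => [h|h]; first by rewrite mul1r tL// divg_eq1.
by rewrite mul0r; case: eqVneq h => // ->; rewrite mulgV L1.
Qed.

(** The operator changes only the second label, and its adjoint swaps the two ends of every pair.
    Whenever [gram] is nonzero, the membership conditions on the two sides are equivalent. *)
Lemma gram_step cs r r' w w' :
  form (fun x y => gram (r, x) (r', y)) (step cs w) w' =
  form (fun x y => gram (r, x) (r', y)) w (step (swap_pairs cs) w').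
Proof.
rewrite /form big_step; apply: eq_bigr => p _.
rewrite [RHS]big_step [RHS]exchange_big big_map; apply: eq_bigr => c _ /=.
rewrite mulr_sumr; apply: eq_bigr => q _ /=.
rewrite /gram /=.
have -> : (p.2 / (q.2 / c.2.1 * c.2.2))%g = (p.2 / c.2.2 * c.2.1 / q.2)%g.
  by rewrite !invgM invgK !mulgA.
set X := (_ / q.2)%g.
have XE : X = ((p.2 / c.2.2) * (q.2 / c.2.1)^-1)%g by rewrite invgF mulgA.
have [A|A] := boolP ((p.2 / c.2.2)%g \in L).
  by rewrite XE memL_Ml// memL_V /=; case: (_ \in L) => /=; ring.
have [B|B] := boolP ((q.2 / c.2.1)%g \in L); last by rewrite !mul0r.
by rewrite XE memL_Mr ?memL_V// (negPf A) !(mul0r, mulr0).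
Qed.

Definition orbit_vec cs k r := iter k (step cs) [:: (1, r)].

(** The label [(r, r)] stands for xi ⊗ δ_(L r), so this is the k-th power of the operator of [cs]
    applied to the sum of these vectors over [D]. *)
Definition gram_vec cs (D : seq G) k :=
  flatten [seq [seq (p.1, (r, p.2)) | p <- orbit_vec cs k r] | r <- D].

Lemma form_gram_vec cs D k m :
  form gram (gram_vec cs D k) (gram_vec cs D m) =
  \sum_(r <- D) \sum_(r' <- D)
    form (fun x y => gram (r, x) (r', y)) (orbit_vec cs k r) (orbit_vec cs m r').
Proof.
rewrite /gram_vec form_flatten; apply: eq_bigr => r _; apply: eq_bigr => r' _.
by rewrite (form_map _ (fun x => (r, x)) (fun x => (r', x))).
Qed.

Lemma form_gram_vecS cs D k m : perm_eq (swap_pairs cs) cs ->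
  form gram (gram_vec cs D k.+1) (gram_vec cs D m) =
  form gram (gram_vec cs D k) (gram_vec cs D m.+1).
Proof.
move=> cssym; rewrite !form_gram_vec; apply: eq_bigr => r _.
apply: eq_bigr => r' _; rewrite /= gram_step /form; apply: eq_bigr => p _.
rewrite !big_step; apply: eq_bigr => q _.
by rewrite (perm_big _ cssym).
Qed.

Lemma form_gram_vecD cs D k m : perm_eq (swap_pairs cs) cs ->
  form gram (gram_vec cs D 0) (gram_vec cs D (k + m)) =
  form gram (gram_vec cs D k) (gram_vec cs D m).
Proof.
move=> cssym; elim: k m => [//|k IHk] m.
by rewrite form_gram_vecS// -IHk addSnnS.
Qed.

Lemma orbit_vec_le cs k r : perm_eq (swap_pairs cs) cs -> psd (kern cs) ->
  psd (fun x y => (x == y)%:R - kern cs x y) ->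
  form (fun x y => (x == y)%:R) (orbit_vec cs k r) (orbit_vec cs k r) <= 1.
Proof.
move=> cssym kpsd kle; elim: k => [|k IHk].
  by rewrite /form !big_seq1 /= eqxx !mulr1.
by apply: le_trans IHk; apply: step_contraction.
Qed.

Lemma gram_vec_le cs D k : perm_eq (swap_pairs cs) cs -> psd (kern cs) ->
  psd (fun x y => (x == y)%:R - kern cs x y) ->
  form gram (gram_vec cs D k) (gram_vec cs D k) <= (size D)%:R * (size D)%:R.
Proof.
move=> cssym kpsd kle; apply: le_trans (form_flatten_le _ _ gramC gram_psd) _.
rewrite ler_wpM2l ?ler0n//.
have -> : (size D)%:R = \sum_(r <- D) 1 :> R.
  by rewrite big_const_seq count_predT iter_addr addr0.
apply: ler_sum => r _.
rewrite (form_map _ (fun x => (r, x)) (fun x => (r, x))).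
by rewrite (eq_form _ _ (gram_diag r)) orbit_vec_le.
Qed.

Lemma gram_vec1_le cs D : perm_eq (swap_pairs cs) cs -> psd (kern cs) ->
  psd (fun x y => (x == y)%:R - kern cs x y) ->
  form gram (gram_vec cs D 0) (gram_vec cs D 1) <=
  form gram (gram_vec cs D 0) (gram_vec cs D 0).
Proof.
move=> cssym kpsd kle.
apply: (@moment_le _ (fun k => form gram (gram_vec cs D 0) (gram_vec cs D k))
  ((size D)%:R * (size D)%:R)).
- exact: gram_psd.
- by move=> k; rewrite form_gram_vecD//; exact: form_CauchySchwarz gramC gram_psd.
- by move=> k; rewrite form_gram_vecD//; exact: gram_vec_le.
Qed.

Lemma form_gram_vec0 cs D : uniq D -> {in D, forall r, coset_rep r = r} ->
  form gram (gram_vec cs D 0) (gram_vec cs D 0) = (size D)%:R.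
Proof.
move=> uD Drep; rewrite form_gram_vec.
rewrite -sum1_size natr_sum [LHS]big_seq [RHS]big_seq.
apply: eq_bigr => r rD.
rewrite (bigD1_seq r)//= big1_seq.
  by rewrite /form !big_seq1 /gram /= mulgV mulg1 mulVg L1 t1 addr0 !mul1r.
move=> r' /andP[r'r r'D]; rewrite /form !big_seq1 /gram /=.
by rewrite -coset_repE !Drep// eq_sym (negPf r'r) mul0r mulr0.
Qed.

(** Each entry of [cs] is seen by exactly one pair of representatives, those of the cosets of its
    two ends. The elements of [L] carrying representatives to ends cancel in [gram], leaving the
    value of [t] at the ends themselves. *)
Lemma form_gram_vec1 cs D : uniq D -> {in D, forall r, coset_rep r = r} ->
  {in cs, forall c, coset_rep c.2.1 \in D /\ coset_rep c.2.2 \in D} ->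
  form gram (gram_vec cs D 0) (gram_vec cs D 1) =
  \sum_(c <- cs) c.1 * t (c.2.1^-1 * c.2.2)%g.
Proof.
move=> uD Drep csD; rewrite form_gram_vec.
have onlyrep a : coset_rep a \in D ->
    \sum_(r <- D) ((r / a)%g \in L)%:R = 1 :> R.
  move=> aD; rewrite (bigD1_seq (coset_rep a))//= big1_seq.
    by rewrite addr0 -memL_V invgF coset_repP.
  move=> r /andP[ra rD]; rewrite -coset_repE (Drep _ rD) (negPf ra)//.
transitivity (\sum_(r <- D) \sum_(r' <- D) \sum_(c <- cs)
    (c.1 * t (c.2.1^-1 * c.2.2)%g) *
    (((r / c.2.1)%g \in L)%:R * ((r' / c.2.2)%g \in L)%:R)).
  apply: eq_bigr => r _; apply: eq_bigr => r' _.
  rewrite /form big_seq1 big_step big_seq1; apply: eq_bigr => c _ /=.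
  rewrite /gram /=.
  have [h|] := boolP ((r' / c.2.2)%g \in L); last by rewrite !mulr0 mul0r.
  have -> : (r / (r' / c.2.2 * c.2.1) = (r / c.2.1) * (r' / c.2.2)^-1)%g.
    by rewrite invgM !mulgA.
  rewrite memL_Mr ?memL_V//.
  have -> : (r^-1 * (r / c.2.1 * (r' / c.2.2)^-1) * r' = c.2.1^-1 * c.2.2)%g.
    by rewrite invgF !mulgA mulVg mul1g mulgVK.
  by ring.
under eq_bigr do rewrite exchange_big.
rewrite exchange_big /= [LHS]big_seq [RHS]big_seq; apply: eq_bigr => c ccs.
transitivity (c.1 * t (c.2.1^-1 * c.2.2)%g *
  ((\sum_(r <- D) ((r / c.2.1)%g \in L)%:R) *
   (\sum_(r <- D) ((r / c.2.2)%g \in L)%:R))).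
  rewrite mulr_suml mulr_sumr; apply: eq_bigr => r _.
  by rewrite -!mulr_sumr.
by have [aD bD] := csD _ ccs; rewrite !onlyrep// !mulr1.
Qed.

Lemma psd_tr (I : Type) (K : I -> I -> R) : psd K -> psd (fun x y => K y x).
Proof.
move=> Kpsd w; have := Kpsd w; rewrite /form exchange_big /=.
congr (_ <= _); apply: eq_bigr => p _; apply: eq_bigr => q _.
by rewrite (mulrC q.1).
Qed.

Lemma orbk1E a b x y : orbk (fun=> 1) a b x y =
  (((a / x)%g \in L) && ((a / x)%g == (b / y)%g))%:R.
Proof. by rewrite /orbk mulr1. Qed.

Lemma coset_repK x : coset_rep (coset_rep x) = coset_rep x.
Proof. by apply: coset_rep_eq; rewrite -memL_V invgF coset_repP. Qed.

(** As [D] has one representative per coset, this is the orthogonal projection onto the cosets met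
    by [D]. It serves as the unit for kernels living on these cosets. *)
Lemma kern_diag (D : seq G) x y : uniq D -> {in D, forall r, coset_rep r = r} ->
  kern [seq (1, (r, r)) | r <- D] x y =
  (x == y)%:R * (coset_rep x \in D)%:R.
Proof.
move=> uD Drep; rewrite /kern big_map.
transitivity (\sum_(r <- D) (x == y)%:R * (r == coset_rep x)%:R : R).
  rewrite big_seq [RHS]big_seq; apply: eq_bigr => r rD /=.
  rewrite orbk1E mul1r (can_eq (mulKg r)) (inj_eq invg_inj) andbC.
  by rewrite -coset_repE (Drep _ rD) -mulnb natrM.
rewrite -mulr_sumr; congr (_ * _).
have [xD|xD] := boolP (_ \in D).
  rewrite (bigD1_seq (coset_rep x))//= eqxx big1 ?addr0// => r rx.
  by rewrite (negPf rx).
rewrite big1_seq// => r /andP[_ rD]; case: eqVneq => // rx.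
by rewrite rx in rD; rewrite rD in xD.
Qed.

(** [orbk_dominated] for the constant function [- c.1] bounds each term by two halves of diagonal
    kernels, both below the projection. *)
Lemma kern_dominated cs (D : seq G) : uniq D -> {in D, forall r, coset_rep r = r} ->
  {in cs, forall c, coset_rep c.2.1 \in D /\ coset_rep c.2.2 \in D} ->
  psd (fun x y => (\sum_(c <- cs) `|c.1|) * kern [seq (1, (r, r)) | r <- D] x y
                  - kern cs x y).
Proof.
move=> uD Drep; pose ID := kern [seq (1, (r, r)) | r <- D].
have IDE x y : ID x y = (x == y)%:R * (coset_rep x \in D)%:R by exact: kern_diag.
have ID_ge a : coset_rep a \in D ->
    psd (fun x y => ID x y - orbk (fun=> 1) a a x y).
  move=> aD.
  have h x : 0 <= (coset_rep x \in D)%:R - ((a / x)%g \in L)%:R :> R.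
    case: (boolP (_ \in L)) => [|_]; last by rewrite subr0 ler0n.
    by rewrite -coset_repE => /eqP <-; rewrite aD subrr.
  apply: eq_psd (psd_diag h) => x y.
  rewrite IDE orbk1E mulrBr (can_eq (mulKg a)) (inj_eq invg_inj) andbC.
  by rewrite -mulnb natrM.
elim: cs => [|c cs IHcs] csD.
  move=> w; rewrite /form big1// => p _; rewrite big1// => q _.
  by rewrite /kern !big_nil mul0r subr0 mulr0.
have [aD bD] := csD c (mem_head _ _).
have {IHcs} IH := IHcs (fun c' h => csD c' (@mem_behead _ (c :: cs) c' h)).
have c2 : 0 <= `|c.1| / 2 by rewrite divr_ge0.
have dom := @orbk_dominated (fun=> - c.1) `|c.1| c.2.1 c.2.2
  (fun=> eq_ind_r (fun z => z <= _) (lexx _) (normrN _)).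
have := psdD (psdD IH dom)
  (psdD (psdZ c2 (ID_ge _ aD)) (psdZ c2 (ID_ge _ bD))).
have kcons x y : kern (c :: cs) x y =
    c.1 * orbk (fun=> 1) c.2.1 c.2.2 x y + kern cs x y by rewrite /kern big_cons.
apply: eq_psd => x y; rewrite kcons big_cons -/(ID x y).
have -> : orbk (fun=> - c.1) c.2.1 c.2.2 x y =
    - (c.1 * orbk (fun=> 1) c.2.1 c.2.2 x y).
  by rewrite /orbk mulr1 mulrN mulrC.
by rewrite /=; field.
Qed.

(** For [K = kern cs >= 0] the matrix [Q = idp - e (K + K^T)] lies between 0 and 1 once [e] is
    small. Its moments at the sum of the vectors xi ⊗ δ_(L r), [r] in [D], begin with [|D|] and
    [|D| - 2 e s], so [moment_le] yields [0 <= s]. *)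
Lemma orbit_trace_ge0 cs : psd (kern cs) ->
  0 <= \sum_(c <- cs) c.1 * t (c.2.1^-1 * c.2.2)%g.
Proof.
move=> Tpsd; pose s := \sum_(c <- cs) c.1 * t (c.2.1^-1 * c.2.2)%g.
pose D := undup ([seq coset_rep c.2.1 | c <- cs] ++ [seq coset_rep c.2.2 | c <- cs]).
have uD : uniq D by exact: undup_uniq.
have Drep : {in D, forall r, coset_rep r = r}.
  move=> r; rewrite mem_undup mem_cat.
  by case/orP => /mapP[c _ ->]; exact: coset_repK.
have csD : {in cs, forall c, coset_rep c.2.1 \in D /\ coset_rep c.2.2 \in D}.
  move=> c ccs; rewrite !mem_undup !mem_cat.
  by split; apply/orP; [left|right]; apply/mapP; exists c.
pose idp : seq (R * (G * G)) := [seq (1, (r, r)) | r <- D].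
pose S := \sum_(c <- cs) `|c.1|.
have S0 : 0 <= S by apply: sumr_ge0.
(* Since [2 e (1 + S) = 1], [Q] is [e] times the sum of [idp + (S idp - K)] and its transpose, hence
   psd; the summand 1 covers the case [S = 0]. *)
pose e := (2 * (1 + S))^-1.
have e0 : 0 <= e by rewrite invr_ge0 mulr_ge0//; lra.
have eS : e * (1 + S) * 2 = 1 by rewrite /e; field; lra.
pose Q := idp ++ [seq (- e * c.1, c.2) | c <- cs ++ swap_pairs cs].
have Qsym : perm_eq (swap_pairs Q) Q.
  rewrite /swap_pairs /Q !map_cat -!map_comp -/swap_pairs; apply: perm_cat => //.
  rewrite perm_catC; apply: perm_cat => //.
  by rewrite (eq_map (_ : _ =1 (fun c => (- e * c.1, c.2))))// => -[? []].
have QD : {in Q, forall c, coset_rep c.2.1 \in D /\ coset_rep c.2.2 \in D}.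
  move=> c; rewrite mem_cat => /orP[/mapP[r rD ->]/=|/mapP[c' + ->]/=].
    by rewrite !Drep.
  by rewrite mem_cat => /orP[/csD//|/mapP[c'' /csD[? ?] ->]].
have QE x y : kern Q x y = kern idp x y - e * (kern cs x y + kern cs y x).
  rewrite -(kern_swap cs x y) /kern /Q map_cat !big_cat /= mulrDr opprD !big_map.
  congr (_ + (_ + _)); rewrite mulr_sumr -sumrN; apply: eq_bigr => c _ /=; ring.
have idE x y : kern idp x y = (x == y)%:R * (coset_rep x \in D)%:R.
  exact: kern_diag.
have idC x y : kern idp x y = kern idp y x.
  by rewrite !idE eq_sym; case: eqVneq => [->|]; rewrite ?mul0r.
have idpsd : psd (kern idp).
  apply: eq_psd (psd_diag (phi := fun x => (coset_rep x \in D)%:R) _) => [x y|x].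
    by rewrite idE.
  exact: ler0n.
have Qpsd : psd (kern Q).
  have dom := psdD idpsd (kern_dominated uD Drep csD).
  apply: eq_psd (psdZ e0 (psdD dom (psd_tr dom))) => x y.
  rewrite QE -/S -/idp -(idC x y); move: eS; set u := kern idp x y => eS.
  rewrite -[in RHS](mul1r u) -[in RHS]eS; ring.
have Qle : psd (fun x y => (x == y)%:R - kern Q x y).
  have h x : 0 <= 1 - (coset_rep x \in D)%:R :> R.
    by rewrite subr_ge0; case: (_ \in _).
  apply: eq_psd (psdD (psd_diag h) (psdZ e0 (psdD Tpsd (psd_tr Tpsd)))) => x y.
  by rewrite QE idE mulrBr mulr1 opprB addrA addrAC.
have := gram_vec1_le D Qsym Qpsd Qle.
rewrite form_gram_vec0// form_gram_vec1// /Q big_cat big_map big_map big_cat big_map.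
rewrite /= (eq_bigr (fun=> 1)); last by move=> r _; rewrite mulVg t1 mulr1.
rewrite big_const_seq count_predT iter_addr addr0.
have -> : \sum_(i <- cs) - e * i.1 * t (i.2.1^-1 * i.2.2)%g = - e * s.
  by rewrite mulr_sumr; apply: eq_bigr => c _; rewrite mulrA.
have -> : \sum_(i <- cs) - e * i.1 * t (i.2.2^-1 * i.2.1)%g = - e * s.
  rewrite mulr_sumr; apply: eq_bigr => c _; rewrite mulrA -[in LHS]tV.
  by rewrite invgM invgK.
rewrite -/s => h; have {h} : 0 <= e * s by lra.
by rewrite pmulr_rge0// lt_def e0 andbT; apply/eqP => e00; move: eS; rewrite e00; lra.
Qed.

End OrbitKernels.

(** * Minimal sublinear functions *)

Section HahnBanach.
Variables (R : realType) (V : lmodType R).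

Definition sublinear (p : V -> R) : Prop :=
  (forall x y, p (x + y) <= p x + p y) /\
  (forall a x, 0 <= a -> p (a *: x) <= a * p x).

Lemma sublinear0 p : sublinear p -> p 0 = 0.
Proof.
move=> [pD pZ]; apply/eqP; rewrite eq_le.
have := pZ 0 0 (lexx _); rewrite scale0r mul0r => -> /=.
by have := pD 0 0; rewrite addr0; lra.
Qed.

Lemma sublinear_opp p x : sublinear p -> - p (- x) <= p x.
Proof.
move=> ps; have [pD _] := ps; have := pD x (- x).
by rewrite subrr sublinear0//; lra.
Qed.

Lemma sublinearZ p a x : sublinear p -> 0 < a -> a * p x <= p (a *: x).
Proof.
move=> [_ pZ] a0; have ai : 0 <= a^-1 by rewrite invr_ge0 ltW.
have := pZ _ (a *: x) ai.
by rewrite scalerA mulVf ?gt_eqF// scale1r -ler_pdivrMl ?invr_gt0// invrK.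
Qed.

(** One criterion for the three infima that occur: over a chain of sublinear functions, over the
    shifts of a minimal one, and over the orbit kernels above a given kernel. *)
Lemma sublinear_inf (P : V -> set R) :
  (forall x, P x !=set0) -> (forall x, has_lbound (P x)) ->
  (forall x y a b, P x a -> P y b -> exists2 c, P (x + y) c & c <= a + b) ->
  (forall l x a, 0 < l -> P x a -> exists2 c, P (l *: x) c & c <= l * a) ->
  (exists2 c, P 0 c & c <= 0) ->
  sublinear (fun x => inf (P x)).
Proof.
move=> P0 lb PD PZ [c0 Pc0 c00].
have infle x a : P x a -> inf (P x) <= a by move=> Pa; exact: ge_inf.
split=> [x y|l x]; last first.
  rewrite le_eqVlt => /predU1P[<-|l0].
    by rewrite scale0r mul0r; apply: le_trans c00; exact: infle.
  rewrite -ler_pdivrMl//; apply: lb_le_inf => // a Pa.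
  have [c Pc] := PZ l x a l0 Pa; rewrite ler_pdivrMl//; apply: le_trans.
  exact: infle.
rewrite -lerBlDr; apply: lb_le_inf => // a Pa.
rewrite lerBlDl -lerBlDr; apply: lb_le_inf => // b Pb.
have [c Pc h] := PD x y a b Pa Pb.
by rewrite lerBlDl; apply: le_trans (infle _ _ Pc) _.
Qed.

(* Any minimal sublinear function below p is linear. *)
Lemma sublinear_minorant (p : V -> R) : sublinear p ->
  exists s : V -> R, (forall a x y, s (a *: x + y) = a * s x + s y) /\
    forall x, s x <= p x.
Proof.
move=> psub; pose T := {q : V -> R | sublinear q /\ forall x, q x <= p x}.
(* The order is reversed, so that a maximal element in Zorn's lemma is a minimal sublinear
   function. *)
pose le (q1 q2 : T) : bool := `[< forall x, sval q2 x <= sval q1 x >].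
have [||| A Atot |q qmin] := @Zorn T le.
- by move=> q; apply/asboolP.
- move=> q1 q2 q3 /asboolP h /asboolP h'; apply/asboolP => x.
  by apply: le_trans (h x).
- move=> [q1 h1] [q2 h2] /asboolP h /asboolP h'; apply: eq_exist => /=.
  by apply/funext => x; apply/eqP; rewrite eq_le h h'.
- have [A0|/set0P/negP/negPn/eqP A0] := pselect (A !=set0); last first.
    by exists (exist _ p (conj psub (fun=> lexx _))) => s; rewrite A0.
  have lb x : has_lbound [set sval q x | q in A].
    exists (- p (- x)) => _ [q Aq <-]; case: (svalP q) => qs qp.
    by apply: le_trans (sublinear_opp x qs); rewrite lerN2.
  have infs : sublinear (fun x => inf [set sval q x | q in A]).
    apply: (@sublinear_inf (fun x => [set sval q x | q in A])) => //.
    + by move=> x; have [q Aq] := A0; exists (sval q x), q.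
    + move=> x y _ _ [q1 Aq1 <-] [q2 Aq2 <-].
      case: (svalP q1) (svalP q2) => -[q1D _] _ [[q2D _] _].
      case: (Atot _ _ Aq1 Aq2) => /asboolP h.
        exists (sval q2 (x + y)); first by exists q2.
        by apply: le_trans (q2D _ _) _; rewrite lerD2r.
      exists (sval q1 (x + y)); first by exists q1.
      by apply: le_trans (q1D _ _) _; rewrite lerD2l.
    + move=> l x _ l0 [q Aq <-]; exists (sval q (l *: x)); first by exists q.
      by case: (svalP q) => -[_ qZ] _; apply/qZ/ltW.
    + have [q Aq] := A0; exists 0; last exact: lexx.
      by exists q => //; case: (svalP q) => /sublinear0.
  have infp x : inf [set sval q x | q in A] <= p x.
    have [q Aq] := A0; case: (svalP q) => _ /(_ x); apply: le_trans.
    by apply: ge_inf => //; exists q.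
  pose infT : T := exist (fun q => sublinear q /\ forall x, q x <= p x)
    (fun x => inf [set sval q x | q in A]) (conj infs infp).
  exists infT => q Aq; apply/asboolP => x /=.
  by apply: ge_inf => //; exists q.
case: q qmin => q [qs qp] /= qmin; have [qD qZ] := qs.
have qN x : q (- x) = - q x.
  apply/eqP; rewrite eq_le; apply/andP; split; last first.
    by rewrite lerNl sublinear_opp.
  (* The infimum over [t >= 0] of [q (y + t x) - t q x] is sublinear and below [q], hence equal to
     [q] by minimality; the choice [t = 1] bounds its value at [- x] by [- q x]. *)
  pose A := [set t : R | 0 <= t].
  pose qx t y := q (y + t *: x) - t * q x.
  have lb y : has_lbound [set qx t y | t in A].
    exists (- q (- y)) => _ [t t0 <-]; rewrite /qx.
    have : t * q x <= q (t *: x).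
      move: t0; rewrite /A /= le_eqVlt => /predU1P[<-|t0].
        by rewrite mul0r scale0r sublinear0.
      exact: sublinearZ.
    have := qD (y + t *: x) (- y); rewrite addrC addKr; lra.
  have qxs : sublinear (fun y => inf [set qx t y | t in A]).
    apply: (@sublinear_inf (fun y => [set qx t y | t in A])) => //.
    + by move=> y; exists (qx 0 y), 0 => //; exact: lexx.
    + move=> y y' _ _ [t t0 <-] [t' t0' <-]; exists (qx (t + t') (y + y')).
        by exists (t + t') => //; rewrite /A /= addr_ge0.
      have := qD (y + t *: x) (y' + t' *: x); rewrite /qx addrACA -scalerDl; lra.
    + move=> l y _ l0 [t t0 <-]; exists (qx (l * t) (l *: y)).
        by exists (l * t) => //; rewrite /A /= mulr_ge0// ltW.
      have := qZ _ (y + t *: x) (ltW l0).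
      by rewrite /qx scalerDr scalerA; lra.
    + exists (qx 0 0); first by exists 0 => //; exact: lexx.
      by rewrite /qx scale0r mul0r addr0 subr0 sublinear0.
  have qxq y : inf [set qx t y | t in A] <= q y.
    apply: ge_inf => //; exists 0; first exact: lexx.
    by rewrite /qx scale0r mul0r addr0 subr0.
  have qxp y := le_trans (qxq y) (qp y).
  pose qxT : T := exist (fun q => sublinear q /\ forall x, q x <= p x)
    (fun y => inf [set qx t y | t in A]) (conj qxs qxp).
  have := qmin qxT; move=> /(_ (asboolT qxq)) /(congr1 sval) /=
    /(congr1 (fun f => f (- x))) <-.
  apply: ge_inf => //; exists 1; first exact: ler01.
  by rewrite /qx scale1r addNr sublinear0// mul1r sub0r.
have qDE x y : q (x + y) = q x + q y.
  apply/eqP; rewrite eq_le qD /=.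
  by have := qD (x + y) (- y); rewrite addrK qN; lra.
have qZE a x : 0 < a -> q (a *: x) = a * q x.
  move=> a0; apply/eqP; rewrite eq_le; apply/andP; split.
    exact/qZ/ltW.
  exact: sublinearZ.
exists q; split => // a x y; rewrite qDE; congr (_ + _).
have [a0|a0|->] := ltgtP a 0.
- by rewrite -[a]opprK scaleNr qN qZE ?oppr_gt0// !mulNr.
- exact: qZE.
- by rewrite scale0r mul0r sublinear0.
Qed.

End HahnBanach.

(** * The product topology as a locally convex space *)

(** A name of its own lets the function space carry the product topology as a locally convex space;
    [R^o] is the field as a module over itself. *)
Definition pointwise (R : realType) (J : choiceType) := J -> R^o.

Section Pointwise.
Variables (R : realType) (J : choiceType).
Local Notation E := (pointwise R J).

HB.instance Definition _ := GRing.Lmodule.copy E (J -> R^o).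
HB.instance Definition _ := Topological.copy E (prod_topology (fun _ : J => R^o)).

(** A basic open set is a finite intersection of coordinate preimages, so it is controlled by
    finitely many coordinates and the smallest of their radii. *)
Lemma pointwise_nbhsP (f : E) (U : set E) : nbhs f U <->
  exists (s : seq J) (e : R), 0 < e /\
    forall h : E, (forall i, i \in s -> `|h i - f i| < e) -> U h.
Proof. split=> [[P [[Q QfinP <-] [V QV Vf]] PU]|[s [e [e0 sU]]]]; last first.
  have FF : Filter (nbhs f) := nbhs_filter f.
  have key (t : seq J) : nbhs f [set h : E | forall i, i \in t -> `|h i - f i| < e].
    elim: t => [|i t IHt].
      apply: (@filterS _ _ FF _ _ _ (@filterT _ _ FF)) => h _ i.
      by rewrite in_nil.
    have hi : nbhs f [set h : E | `|h i - f i| < e].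
      have := @proj_continuous J (fun=> R^o) i f.
      move/cvgrPdist_lt => /(_ _ e0).
      apply: (@filterS _ _ FF) => h /=.
      by rewrite distrC.
    apply: (@filterS2 _ _ FF _ _ _ _ hi IHt) => h hi' ht k.
    rewrite in_cons => /predU1P[->//|].
    exact: ht.
  exact: (@filterS _ _ FF _ _ sU (key s)).
have [F FQ VE] := QfinP _ QV.
have cylF : forall M, M \in finmap.enum_fset F -> exists i (O : set R^o),
    open O /\ M = (fun h : E => h i) @^-1` O.
  move=> M /FQ /set_mem [i _ [W oW <-]]; exists i, W; split => //.
have fF : forall M, M \in finmap.enum_fset F -> M f.
  by move=> M MF; move: Vf; rewrite -VE; apply.
have UF (h : E) : (forall M, M \in finmap.enum_fset F -> M h) -> U h.
  move=> Fh; apply: PU; exists V => //.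
  have Vh : V h by rewrite -VE => M; exact: Fh.
  exact: Vh.
suff [s [e [e0 he]]] : exists (s : seq J) (e : R), 0 < e /\
    forall h : E, (forall i, i \in s -> `|h i - f i| < e) ->
      forall M, M \in finmap.enum_fset F -> M h.
  by exists s, e; split=> // h /he; exact: UF.
elim: (finmap.enum_fset F) cylF fF {UF} => [|M Ms IHMs] cylF fF.
  by exists [::], 1; split.
have [||s [e [e0 he]]] := IHMs.
- by move=> N NMs; apply: cylF; rewrite in_cons NMs orbT.
- by move=> N NMs; apply: fF; rewrite in_cons NMs orbT.
have [i [W [oW ME]]] := cylF M (mem_head _ _).
have /nbhs_ballP[d /= d0 dW] : nbhs (f i : R^o) W.
  apply: open_nbhs_nbhs; split => //.
  by have := fF M (mem_head _ _); rewrite ME.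
exists (i :: s), (Num.min e d); split; first by rewrite lt_min e0.
move=> h hs N; rewrite in_cons => /predU1P[->|NMs].
  rewrite ME; apply: dW; rewrite -ball_normE /ball_ /= distrC.
  by have := hs i (mem_head _ _); rewrite lt_min => /andP[].
apply: he NMs => k ks; have := hs k; rewrite in_cons ks orbT => /(_ isT).
by rewrite lt_min => /andP[].
Qed.

Lemma pointwise_coord_continuous (i : J) : continuous (fun f : E => f i : R).
Proof. exact: (@proj_continuous J (fun=> R^o) i). Qed.

Lemma pointwise_hausdorff : hausdorff_space E.
Proof. by apply: hausdorff_product => i; exact: Rhausdorff. Qed.

Lemma pointwise_compact (A : J -> set R) :
  (forall i, compact (A i)) -> compact [set f : E | forall i, A i (f i)].
Proof. exact: (@tychonoff J (fun=> R^o)). Qed.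

Lemma pointwise_continuousP (T : topologicalType) (F : T -> E) :
  (forall i, continuous (fun x => F x i : R)) -> continuous F.
Proof.
move=> Fc x U /pointwise_nbhsP[s [e [e0 sU]]].
have FF : Filter (nbhs x) := nbhs_filter x.
have key (t : seq J) : nbhs x [set y | forall i, i \in t -> `|F y i - F x i| < e].
  elim: t => [|i t IHt].
    apply: (@filterS _ _ FF _ _ _ (@filterT _ _ FF)) => h _ i.
    by rewrite in_nil.
  have hi : nbhs x [set y | `|F y i - F x i| < e].
    have := Fc i x; move/cvgrPdist_lt => /(_ _ e0).
    apply: (@filterS _ _ FF) => h /=.
    by rewrite distrC.
  apply: (@filterS2 _ _ FF _ _ _ _ hi IHt) => h hi' ht k.
  rewrite in_cons => /predU1P[->//|].
  exact: ht.
by apply: (@filterS _ _ FF _ _ _ (key s)) => y ys; exact: sU.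
Qed.

Lemma pointwise_coord_comp (T : topologicalType) (F : T -> E) (x : T) (i : J) :
  {for x, continuous F} -> {for x, continuous (fun y => F y i : R)}.
Proof.
move=> Fc; apply: (@continuous_comp _ _ _ F (fun f : E => f i : R)) => //.
exact: pointwise_coord_continuous.
Qed.

Lemma pointwise_add_continuous : continuous (fun x : E * E => x.1 + x.2).
Proof.
have c1 : continuous (fun x : E * E => x.1) by move=> y; exact: cvg_fst.
have c2 : continuous (fun x : E * E => x.2) by move=> y; exact: cvg_snd.
apply: pointwise_continuousP => i x.
apply: (@continuousD _ R^o _ (fun x : E * E => x.1 i) (fun x : E * E => x.2 i)).
  exact: pointwise_coord_comp (c1 x).
exact: pointwise_coord_comp (c2 x).
Qed.

Lemma pointwise_scale_continuous : continuous (fun z : R^o * E => z.1 *: z.2).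
Proof.
have c1 : continuous (fun x : R^o * E => x.1) by move=> y; exact: cvg_fst.
have c2 : continuous (fun x : R^o * E => x.2) by move=> y; exact: cvg_snd.
apply: pointwise_continuousP => i x.
apply: (@continuousM R _ (fun x : R^o * E => x.1) (fun x : R^o * E => x.2 i)).
  exact: c1.
exact: pointwise_coord_comp (c2 x).
Qed.

Lemma pointwise_locally_convex :
  exists2 B : set_system E, (forall b, b \in B -> convex_set b) & basis B.
Proof.
exists [set b | open b /\ forall (x y : E) (l : R), b x -> b y -> 0 < l -> l < 1 ->
    b (l *: x + (1 - l) *: y)].
  move=> b; rewrite inE => -[_ bc]; apply/convex_setW => x y.
  rewrite !inE => bx by_ l l0 l1; rewrite inE.
  exact: bc.
split=> [b [] //|x U /pointwise_nbhsP[s [e [e0 sU]]]].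
pose b : set E := [set h | forall i, i \in s -> `|h i - x i| < e].
exists b; last exact: sU.
split; last by move=> i _; rewrite subrr normr0.
split; last first.
  move=> h h' l bh bh' l0 l1 i si.
  rewrite (_ : (l *: h + (1 - l) *: h') i - x i =
    l * (h i - x i) + (1 - l) * (h' i - x i)); last first.
    have -> : (l *: h + (1 - l) *: h') i = l * h i + (1 - l) * h' i by [].
    by ring.
  have l1' : 0 < 1 - l by rewrite subr_gt0.
  apply: le_lt_trans (ler_normD _ _) _.
  rewrite !normrM (gtr0_norm l0) (gtr0_norm l1').
  have := bh i si; have := bh' i si; nra.
rewrite openE => h bh; rewrite /interior.
have FF : Filter (nbhs h) := nbhs_filter h.
suff key (t : seq J) : {subset t <= s} ->
    nbhs h [set h' : E | forall i, i \in t -> `|h' i - x i| < e] by exact: key.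
elim: t => [|i t IHt] ts.
  apply: (@filterS _ _ FF _ _ _ (@filterT _ _ FF)) => h' _ i.
  by rewrite in_nil.
have hi : nbhs h [set h' : E | `|h' i - x i| < e].
  have hc := @pointwise_coord_continuous i h [set z : R | `|z - x i| < e].
  apply: hc.
  have : open_nbhs (h i : R^o) (ball (x i : R^o) e).
    split; first exact: ball_open.
    by rewrite -ball_normE /ball_ /= distrC; apply/bh/ts/mem_head.
  move/open_nbhs_nbhs; apply: filterS => z.
  by rewrite -ball_normE /ball_ /= distrC.
have {}IHt := IHt (fun k kt => ts k (@mem_behead _ (i :: t) k kt)).
apply: (@filterS2 _ _ FF _ _ _ _ hi IHt) => h' hi' ht k.
by rewrite in_cons => /predU1P[->//|]; exact: ht.
Qed.

HB.instance Definition _ := PreTopologicalLmod_isTvs.Build R E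
  pointwise_add_continuous pointwise_scale_continuous pointwise_locally_convex.
HB.instance Definition _ := PreTopologicalNmodule_isTopologicalNmodule.Build E
  pointwise_add_continuous.
HB.instance Definition _ := TopologicalNmodule_isTopologicalLmodule.Build R E
  pointwise_scale_continuous.
HB.instance Definition _ := Uniform_isTvs.Build R E pointwise_locally_convex.

End Pointwise.

(** * Extension of the orbit trace and the map equivariant under the subgroup *)

Section DominatedKernels.
Variables (R : realType) (G : groupType) (L : {pred G}).

(** The upper bound provides an orbit kernel above [F], and the lower bound keeps the orbit traces
    of all such kernels bounded below. Their infimum, the sublinear majorant used for the extension,
    is therefore finite. *)
Definition dominated : {pred (G -> G -> R^o)} := fun F =>
  `[< exists cs, psd (fun x y => kern L cs x y + F x y) /\
                 psd (fun x y => kern L cs x y - F x y) >].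

Lemma kern_cat cs cs' x y :
  kern L (cs ++ cs') x y = kern L cs x y + kern L cs' x y :> R.
Proof. by rewrite /kern big_cat. Qed.

Lemma kern_scale a cs x y : kern L (scale a cs) x y = a * kern L cs x y :> R.
Proof.
by rewrite /kern big_map mulr_sumr; apply: eq_bigr => c _ /=; rewrite -mulrA.
Qed.

Lemma dominated_submod_closed : submod_closed dominated.
Proof.
split=> [|a F F' /asboolP[cs [csD csB]] /asboolP[cs' [csD' csB']]].
  apply/asboolP; exists [::].
  have h0 x y : (0 : G -> G -> R^o) x y = 0 by [].
  by split=> w; rewrite /form big1// => p _; rewrite big1// => q _;
    rewrite /kern big_nil h0 ?addr0 ?subr0 mulr0.
apply/asboolP; exists (scale `|a| cs ++ cs').
have aE x y : (a *: F + F') x y = a * F x y + F' x y by [].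
have [a0|a0] := ger0P a; split.
- apply: eq_psd (psdD (psdZ a0 csD) csD') => x y.
  by rewrite kern_cat kern_scale aE; ring.
- apply: eq_psd (psdD (psdZ a0 csB) csB') => x y.
  by rewrite kern_cat kern_scale aE; ring.
- have Na0 : 0 <= - a by rewrite oppr_ge0 ltW.
  apply: eq_psd (psdD (psdZ Na0 csB) csD') => x y.
  by rewrite kern_cat kern_scale aE; ring.
- have Na0 : 0 <= - a by rewrite oppr_ge0 ltW.
  apply: eq_psd (psdD (psdZ Na0 csD) csB') => x y.
  by rewrite kern_cat kern_scale aE; ring.
Qed.

HB.instance Definition _ := GRing.isSubmodClosed.Build R (G -> G -> R^o) dominated
  dominated_submod_closed.

Definition dominated_kernel := {F : G -> G -> R^o | F \in dominated}.

HB.instance Definition _ := SubType.on dominated_kernel.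
HB.instance Definition _ := Choice.on dominated_kernel.
HB.instance Definition _ :=
  [SubChoice_isSubLmodule of dominated_kernel by <:].

End DominatedKernels.

Section OrbitState.
Variables (R : realType) (G : groupType) (L : {pred G}) (t : G -> R).
Hypothesis L1 : 1%g \in L.
Hypothesis LM : forall x y, x \in L -> y \in L -> (x * y)%g \in L.
Hypothesis LV : forall x, x \in L -> (x^-1)%g \in L.
Hypothesis t1 : t 1%g = 1.
Hypothesis tV : forall x, t (x^-1)%g = t x.
Hypothesis tC : forall x y, t (x * y)%g = t (y * x)%g.
Hypothesis tL : forall x, x \in L -> t x = (x == 1%g)%:R.
Hypothesis tpsd : psd (fun x y => t (x^-1 * y)%g).

Definition orbit_trace (cs : seq (R * (G * G))) : R :=
  \sum_(c <- cs) c.1 * t (c.2.1^-1 * c.2.2)%g.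

Lemma orbit_trace_cat cs cs' :
  orbit_trace (cs ++ cs') = orbit_trace cs + orbit_trace cs'.
Proof. by rewrite /orbit_trace big_cat. Qed.

Lemma orbit_trace_scale a cs : orbit_trace (scale a cs) = a * orbit_trace cs.
Proof.
by rewrite /orbit_trace big_map mulr_sumr; apply: eq_bigr => c _ /=; rewrite -mulrA.
Qed.

Local Notation W := (dominated_kernel R L).

(** The majorant of [F] is the infimum of the orbit traces of orbit kernels above [F]. A linear
    functional below it is nonnegative on psd [F], because 0 lies above [- F]. It agrees with the
    orbit trace because an orbit kernel and its negative each lie above themselves. *)
Lemma orbit_trace_extends : exists s : W -> R,
  [/\ forall a F F', s (a *: F + F') = a * s F + s F',
      forall F, psd (val F) -> 0 <= s F &
      forall F cs, (forall x y, val F x y = kern L cs x y) ->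
        s F = orbit_trace cs].
Proof.
pose P (F : W) := [set orbit_trace cs | cs in
  [set cs | psd (fun x y => kern L cs x y - val F x y)]].
have trge := orbit_trace_ge0 L1 LM LV t1 tV tC tL tpsd.
have lb (F : W) : has_lbound (P F).
  have /asboolP[cs [csF _]] := valP F; exists (- orbit_trace cs).
  move=> _ [cs' cs'F <-]; rewrite -subr_ge0 opprK -orbit_trace_cat.
  apply: trge; apply: eq_psd (psdD cs'F csF) => x y.
  by rewrite kern_cat; ring.
have Psub : sublinear (fun F => inf (P F)).
  apply: sublinear_inf => //.
  - move=> F; have /asboolP[cs [_ csF]] := valP F.
    by exists (orbit_trace cs), cs.
  - move=> F F' _ _ [cs csF <-] [cs' csF' <-].
    exists (orbit_trace (cs ++ cs')); last by rewrite orbit_trace_cat.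
    exists (cs ++ cs') => //; apply: eq_psd (psdD csF csF') => x y.
    have -> : val (F + F') x y = val F x y + val F' x y by rewrite raddfD.
    by rewrite kern_cat; ring.
  - move=> l F _ l0 [cs csF <-].
    exists (orbit_trace (scale l cs)); last by rewrite orbit_trace_scale.
    exists (scale l cs) => //; apply: eq_psd (psdZ (ltW l0) csF) => x y.
    have -> : val (l *: F) x y = l * val F x y by rewrite linearZ.
    by rewrite kern_scale; ring.
  - exists (orbit_trace [::]); last by rewrite /orbit_trace big_nil.
    exists [::] => // w; rewrite /form big1// => p _; rewrite big1// => q _.
    have -> : val (0 : W) p.2 q.2 = 0 by rewrite raddf0.
    by rewrite /kern big_nil subr0 mulr0.
have [s [slin sP]] := sublinear_minorant Psub.
have s0 : s 0 = 0.
  by have := slin (-1) 0 0; rewrite scaler0 addr0; lra.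
have sN F : s (- F) = - s F.
  by have := slin (-1) F 0; rewrite scaleN1r !addr0 s0; lra.
have sle F cs : psd (fun x y => kern L cs x y - val F x y) -> s F <= orbit_trace cs.
  by move=> h; apply: le_trans (sP _) _; apply: ge_inf => //; exists cs.
have valN (F : W) x y : val (- F) x y = - val F x y by rewrite raddfN.
exists s; split => //.
- move=> F Fpsd; rewrite -oppr_le0 -sN.
  have <- : orbit_trace [::] = 0 by rewrite /orbit_trace big_nil.
  apply: sle; apply: eq_psd Fpsd => x y.
  by rewrite /kern big_nil valN; ring.
- move=> F cs Fcs; apply/eqP; rewrite eq_le; apply/andP; split.
    apply: sle => w; rewrite /form big1// => p _; rewrite big1// => q _.
    by rewrite Fcs subrr mulr0.
  rewrite -lerN2 -sN -mulN1r -orbit_trace_scale; apply: sle => w.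
  rewrite /form big1// => p _; rewrite big1// => q _.
  by rewrite kern_scale valN Fcs mulN1r subrr mulr0.
Qed.

Definition is_bounded (I : Type) (f : I -> R) := exists B : R, forall x, `|f x| <= B.

Lemma orbk_in_dominated (f : G -> R) a b : is_bounded f ->
  (orbk L f a b : G -> G -> R^o) \in @dominated R G L.
Proof.
move=> [B fB]; apply/asboolP; exists [:: (B / 2, (a, a)); (B / 2, (b, b))].
have kE x y : kern L [:: (B / 2, (a, a)); (B / 2, (b, b))] x y =
    B / 2 * orbk L (fun=> 1) a a x y + B / 2 * orbk L (fun=> 1) b b x y.
  by rewrite /kern big_cons big_seq1.
split; first by apply: eq_psd (orbk_dominated L a b fB) => x y; rewrite kE.
have fB' x : `|- f x| <= B by rewrite normrN.
apply: eq_psd (orbk_dominated L a b fB') => x y; rewrite kE.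
by rewrite /orbk mulrN.
Qed.

Definition cell : choiceType := {classic (G -> R) * G * G}.

(* T (f, g, h) is the matrix coefficient at (g, h) of the image of f under a
   unital positive map from l^oo(G) to the operators on the space of t. *)
Definition positive_maps : set (pointwise R cell) := [set T |
  [/\ forall f, ~ is_bounded f -> forall g h, T (f, g, h) = 0,
      forall f B, (forall x, `|f x| <= B) -> forall g h, `|T (f, g, h)| <= B,
      forall a f f', is_bounded f -> is_bounded f' -> forall g h,
        T ((fun x => a * f x + f' x), g, h) = a * T (f, g, h) + T (f', g, h),
      forall f, is_bounded f -> (forall x, 0 <= f x) ->
        psd (fun g h => T (f, g, h)) &
      (forall f g h, T (f, g, h) = T (f, h, g)) /\
      (forall g h, T ((fun=> 1), g, h) = t (g^-1 * h)%g)]].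

(** The action sending T to π(g) T(g^-1 · f) π(g)^-1, read on matrix coefficients; its fixed points
    are the equivariant maps. *)
Definition translate (g : G) (T : pointwise R cell) : pointwise R cell :=
  fun i => T ((fun x => i.1.1 (g * x)%g), (g^-1 * i.1.2)%g, (g^-1 * i.2)%g).

(** The kernel is the sum over [l] in [L] of [f l] times the rank one projection kernel of the
    [w]-combination of the basis vectors at [l^-1 a]. *)
Lemma form_orbk_psd (f : G -> R) (w : seq (R * G)) : (forall x, 0 <= f x) ->
  psd (fun x y => \sum_(p <- w) \sum_(q <- w) p.1 * q.1 * orbk L f p.2 q.2 x y).
Proof.
move=> f0 v.
pose u := [seq (r.1 * p.1, (p.2 / r.2)%g) | r <- v, p <- w].
have phi0 x : 0 <= (x \in L)%:R * f x by rewrite mulr_ge0 ?ler0n.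
have := psd_diag phi0 u; congr (_ <= _).
rewrite /form /u big_allpairs_dep; apply: eq_bigr => r _ /=.
under eq_bigr do rewrite big_allpairs_dep.
rewrite exchange_big; apply: eq_bigr => r' _ /=; rewrite mulr_sumr.
apply: eq_bigr => p _; rewrite mulr_sumr; apply: eq_bigr => q _ /=.
rewrite /orbk; case: eqVneq => _; case: (_ \in L) => /=; ring.
Qed.

Lemma orbk_translate (f : G -> R) l a b x y : l \in L ->
  orbk L (fun z => f (l * z)%g) (l^-1 * a) (l^-1 * b) x y = orbk L f a b x y.
Proof.
move=> lL; rewrite /orbk /= -!mulgA (memL_Ml LM LV) ?LV// mulVKg.
by rewrite (inj_eq (mulgI _)).
Qed.

(** [T (f, a, b)] is the extended functional at [orbk f a b], so only the values of [f] on [L]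
    enter. Reindexing the sum over [L] gives equivariance, and [f = 1] gives an orbit kernel, where
    the functional is known. *)
Lemma equivariant_map_subgroup : exists2 T, positive_maps T &
  forall l, l \in L -> translate l T = T.
Proof.
have [s [slin spos sval]] := orbit_trace_extends.
(* For bounded [f] the kernel is dominated and the default 0 is not taken. *)
pose k f a b : W := insubd 0 (orbk L f a b : G -> G -> R^o).
have kE f a b : is_bounded f -> forall x y, val (k f a b) x y = orbk L f a b x y.
  by move=> fb x y; rewrite /k insubdK//; exact: orbk_in_dominated.
have sD F F' : s (F + F') = s F + s F' by have := slin 1 F F'; rewrite scale1r mul1r.
have s0 : s 0 = 0 by have := sD 0 0; rewrite addr0; lra.
have sZ a F : s (a *: F) = a * s F by have := slin a F 0; rewrite !addr0 s0 addr0.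
have b1 : is_bounded (fun _ : G => 1 : R) by exists 1 => x; rewrite normr1.
have s1 a b : s (k (fun=> 1) a b) = t (a^-1 * b)%g.
  rewrite (sval _ [:: (1, (a, b))]) => [|x y].
    by rewrite /orbit_trace big_seq1 mul1r.
  by rewrite kE// /kern big_seq1 mul1r.
have valD (F F' : W) x y : val (F + F') x y = val F x y + val F' x y.
  by rewrite raddfD.
have valZ a (F : W) x y : val (a *: F) x y = a * val F x y by rewrite linearZ.
pose T : pointwise R cell := fun i =>
  if `[< is_bounded i.1.1 >] then s (k i.1.1 i.1.2 i.2) else 0.
have TE f a b : is_bounded f -> T (f, a, b) = s (k f a b).
  by move=> fb; rewrite /T/=; case: asboolP.
have TN f a b : ~ is_bounded f -> T (f, a, b) = 0.
  by move=> fb; rewrite /T/=; case: asboolP.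
have kZ a f f' g h : is_bounded f -> is_bounded f' ->
    k (fun x => a * f x + f' x) g h = a *: k f g h + k f' g h.
  move=> fb fb'; have fb'' : is_bounded (fun x => a * f x + f' x).
    have [B fB] := fb; have [B' fB'] := fb'; exists (`|a| * B + B') => x.
    apply: le_trans (ler_normD _ _) _; rewrite normrM.
    by apply: lerD => //; apply: ler_wpM2l.
  apply: val_inj; apply/funext => x; apply/funext => y.
  by rewrite valD valZ !kE// /orbk; ring.
exists T; last first.
  move=> l lL; apply/funext => -[[f g] h]; rewrite /translate /T /=.
  have -> : `[< is_bounded (fun x => f (l * x)%g) >] = `[< is_bounded f >].
    apply/asbool_equiv_eq; split=> -[B fB]; exists B => x //.
    by rewrite -[x](mulVKg l).
  case: asboolP => // fb; congr s; apply: val_inj.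
  apply/funext => x; apply/funext => y; rewrite !kE ?orbk_translate//.
  by have [B fB] := fb; exists B => z.
split.
- by move=> f fb g h; rewrite TN.
- move=> f B fB g h; have fb : is_bounded f by exists B.
  have fB' x : `|- f x| <= B by rewrite normrN.
  have Nfb : is_bounded (fun x => - f x) by exists B.
  rewrite TE//.
  (* The functional is 1 on [k 1 g g] and on [k 1 h h], so domination by [B / 2] times each costs
     exactly [B]. *)
  have half (e : W) : (psd (fun x y => B / 2 * orbk L (fun=> 1) g g x y +
      B / 2 * orbk L (fun=> 1) h h x y + val e x y)) -> - B <= s e.
    move=> epsd.
    have := spos (B / 2 *: k (fun=> 1) g g + (B / 2 *: k (fun=> 1) h h + e)).
    rewrite !sD !sZ !s1 !mulVg t1 => /(_ _) hh.
    suff : 0 <= B / 2 * 1 + (B / 2 * 1 + s e) by lra.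
    apply: hh; apply: eq_psd epsd => x y.
    by rewrite !valD !valZ !kE// addrA.
  rewrite ler_norml; apply/andP; split.
    apply: half; apply: eq_psd (orbk_dominated L g h fB) => x y.
    by rewrite kE.
  rewrite -lerN2 -[- s _]mulN1r -sZ; apply: half.
  apply: eq_psd (orbk_dominated L g h fB') => x y.
  by rewrite valZ kE// /orbk; ring.
- move=> a f f' fb fb' g h; rewrite !TE ?kZ ?sD ?sZ//.
  have [B fB] := fb; have [B' fB'] := fb'; exists (`|a| * B + B') => x.
  apply: le_trans (ler_normD _ _) _; rewrite normrM.
  by apply: lerD => //; apply: ler_wpM2l.
- move=> f fb f0 w.
  pose Z : W := \sum_(p <- w) \sum_(q <- w) (p.1 * q.1) *: k f p.2 q.2.
  have -> : form (fun g h => T (f, g, h)) w w = s Z.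
    rewrite /Z (big_morph s sD s0); apply: eq_bigr => p _.
    rewrite (big_morph s sD s0); apply: eq_bigr => q _.
    by rewrite TE// sZ.
  apply: spos; apply: eq_psd (form_orbk_psd w f0) => x y.
  have v0 : val (0 : W) x y = 0 by rewrite raddf0.
  rewrite /Z (big_morph (fun F : W => val F x y) (fun F F' => valD F F' x y) v0).
  apply: eq_bigr => p _.
  rewrite (big_morph (fun F : W => val F x y) (fun F F' => valD F F' x y) v0).
  by apply: eq_bigr => q _; rewrite valZ kE.
split; last by move=> g h; rewrite TE ?s1.
move=> f g h; have [fb|fb] := pselect (is_bounded f); last by rewrite !TN.
(* The difference of a kernel and its transpose has zero quadratic form, so the functional is
   nonnegative on it; both orders together give equality. *)
have le g' h' : s (k f g' h') <= s (k f h' g').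
  rewrite -subr_ge0 -mulN1r -sZ -sD; apply: spos => w.
  have -> : form (val (k f h' g' + -1 *: k f g' h')) w w =
      form (orbk L f h' g') w w + -1 * form (orbk L f g' h') w w.
    rewrite -form_kernelZ -form_kernelD; apply: eq_form => x y.
    by rewrite valD valZ !kE.
  suff -> : form (orbk L f h' g') w w = form (orbk L f g' h') w w.
    by rewrite mulN1r subrr.
  rewrite /form exchange_big; apply: eq_bigr => p _; apply: eq_bigr => q _ /=.
  by rewrite orbkC (mulrC p.1).
by rewrite !TE//; apply/eqP; rewrite eq_le !le.
Qed.

End OrbitState.

(** * Means and equivariant positive maps *)

Section ClosedSets.
Variables (R : realType) (X : topologicalType).

Lemma closed_forall (I : Type) (P : I -> X -> Prop) :
  (forall i, closed [set x | P i x]) -> closed [set x | forall i, P i x].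
Proof.
move=> Pc; rewrite (_ : mkset _ = \bigcap_(i in setT) [set x | P i x]).
  by apply: closed_bigI => i _; exact: Pc.
by apply/seteqP; split=> x /= h i; [move=> _|]; exact: h.
Qed.

Lemma closed_imply (P : Prop) (Q : X -> Prop) :
  (P -> closed [set x | Q x]) -> closed [set x | P -> Q x].
Proof.
move=> Qc; have [HP|nP] := pselect P.
  rewrite (_ : mkset _ = [set x | Q x]); first exact: Qc.
  by apply/seteqP; split=> x /= h; [exact: h|move=> _].
rewrite (_ : mkset _ = setT); first exact: closedT.
by apply/seteqP; split=> x //= _ /nP.
Qed.

Lemma closed_nneg (F : X -> R) : continuous F -> closed [set x | 0 <= F x].
Proof.
by move=> Fc; apply: (@closed_comp _ _ F [set y | 0 <= y]) => //; exact: closed_ge.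
Qed.

Lemma closed_zero (F : X -> R) : continuous F -> closed [set x | F x = 0].
Proof.
by move=> Fc; apply: (@closed_comp _ _ F [set y | y = 0]) => //; exact: closed_eq.
Qed.

Lemma continuous_sum_seq (I : Type) (s : seq I) (F : I -> X -> R) :
  (forall i, continuous (F i)) -> continuous (fun x => \sum_(i <- s) F i x).
Proof.
move=> Fc; elim: s => [|i s IHs].
  rewrite (_ : (fun x => _) = fun=> 0); first exact: cst_continuous.
  by apply/funext => x; rewrite big_nil.
rewrite (_ : (fun x => _) = fun x => F i x + \sum_(j <- s) F j x).
  by move=> x; apply: (@continuousD R R^o X); [exact: Fc|exact: IHs].
by apply/funext => x; rewrite big_cons.
Qed.

Lemma continuous_scaled (a : R) (F : X -> R) :
  continuous F -> continuous (fun x => a * F x).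
Proof.
by move=> Fc x; apply: (@continuousM R X (fun=> a) F); [exact: cst_continuous|exact: Fc].
Qed.

Lemma continuous_add (F F' : X -> R) :
  continuous F -> continuous F' -> continuous (fun x => F x + F' x).
Proof. by move=> Fc Fc' x; apply: (@continuousD R R^o X); [exact: Fc|exact: Fc']. Qed.

Lemma continuous_sub (F F' : X -> R) :
  continuous F -> continuous F' -> continuous (fun x => F x - F' x).
Proof. by move=> Fc Fc' x; apply: (@continuousB R R^o X); [exact: Fc|exact: Fc']. Qed.

Lemma closed_eq_fun (F F' : X -> R) :
  continuous F -> continuous F' -> closed [set x | F x = F' x].
Proof.
move=> Fc Fc'; rewrite (_ : mkset _ = [set x | F x - F' x = 0]).
  exact/closed_zero/continuous_sub.
by apply/seteqP; split=> x /= => [->|/subr0_eq//]; rewrite subrr.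
Qed.

Lemma closed_le_fun (F F' : X -> R) :
  continuous F -> continuous F' -> closed [set x | F x <= F' x].
Proof.
move=> Fc Fc'; rewrite (_ : mkset _ = [set x | 0 <= F' x - F x]).
  exact/closed_nneg/continuous_sub.
by apply/seteqP; split=> x /=; rewrite subr_ge0.
Qed.

End ClosedSets.

Section Means.
Variables (R : realType).

(* A mean vanishes on unbounded functions, by convention. *)
Definition mean (I : Type) (m : (I -> R) -> R) : Prop :=
  [/\ forall f, ~ is_bounded f -> m f = 0,
      forall a f f', is_bounded f -> is_bounded f' ->
        m (fun x => a * f x + f' x) = a * m f + m f',
      forall f, is_bounded f -> (forall x, 0 <= f x) -> 0 <= m f &
      m (fun=> 1) = 1].

Section MeanTheory.
Variables (I : Type) (m : (I -> R) -> R).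
Hypothesis mM : mean m.

Lemma is_bounded_lin a (f f' : I -> R) : is_bounded f -> is_bounded f' ->
  is_bounded (fun x => a * f x + f' x).
Proof.
move=> [B fB] [B' fB']; exists (`|a| * B + B') => x.
apply: le_trans (ler_normD _ _) _; rewrite normrM.
by apply: lerD => //; apply: ler_wpM2l.
Qed.

Lemma is_bounded_cst (c : R) : is_bounded (fun _ : I => c).
Proof. by exists `|c|. Qed.

Lemma mean0 : m (fun=> 0) = 0.
Proof.
have [_ mlin _ _] := mM; have b := is_bounded_cst 0.
by have := mlin 1 _ _ b b; rewrite mul1r addr0; lra.
Qed.

Lemma meanZ a f : m (fun x => a * f x) = a * m f.
Proof.
have [mN mlin _ _] := mM; have [fb|fb] := pselect (is_bounded f).
  have := mlin a _ _ fb (is_bounded_cst 0); rewrite mean0 addr0 => <-.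
  by congr m; apply/funext => x; rewrite addr0.
rewrite (mN _ fb) mulr0; have [->|a0] := eqVneq a 0.
  by rewrite -[RHS]mean0; congr m; apply/funext => x; rewrite mul0r.
apply: mN => -[B afB]; apply: fb; exists (`|a|^-1 * B) => x.
by rewrite ler_pdivlMl ?normr_gt0// -normrM.
Qed.

Lemma meanD f f' : is_bounded f -> is_bounded f' ->
  m (fun x => f x + f' x) = m f + m f'.
Proof.
have [_ mlin _ _] := mM => fb fb'; have := mlin 1 _ _ fb fb'.
by rewrite mul1r => <-; congr m; apply/funext => x; rewrite mul1r.
Qed.

Lemma mean_cst c : m (fun=> c) = c.
Proof.
have [_ _ _ m1] := mM; have := meanZ c (fun=> 1); rewrite m1 mulr1 => {2}<-.
by congr m; apply/funext => x; rewrite mulr1.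
Qed.

Lemma mean_le f f' : is_bounded f -> is_bounded f' ->
  (forall x, f x <= f' x) -> m f <= m f'.
Proof.
have [_ mlin mpos _] := mM => fb fb' ff'.
rewrite -subr_ge0 addrC -mulN1r -mlin//; apply: mpos => [|x].
  exact: is_bounded_lin.
by rewrite mulN1r addrC subr_ge0.
Qed.

Lemma mean_bound f B : (forall x, `|f x| <= B) -> `|m f| <= B.
Proof.
move=> fB; have fb : is_bounded f by exists B.
rewrite ler_norml -{2}(mean_cst B) -(mean_cst (- B)).
by apply/andP; split; apply: mean_le => //; try exact: is_bounded_cst;
  move=> x; have := fB x; rewrite ler_norml => /andP[].
Qed.

Lemma mean_sum (J : Type) (s : seq J) (F : J -> I -> R) :
  (forall j, is_bounded (F j)) ->
  is_bounded (fun x => \sum_(j <- s) F j x) /\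
  m (fun x => \sum_(j <- s) F j x) = \sum_(j <- s) m (F j).
Proof.
move=> Fb; elim: s => [|j s [sb IHs]].
  rewrite (_ : (fun x => _) = fun=> 0).
    by rewrite big_nil mean0; split => //; exact: is_bounded_cst.
  by apply/funext => x; rewrite big_nil.
rewrite (_ : (fun x => _) = fun x => F j x + \sum_(k <- s) F k x); last first.
  by apply/funext => x; rewrite big_cons.
rewrite meanD// big_cons IHs; split => //.
have := is_bounded_lin 1 (Fb j) sb; congr is_bounded.
by apply/funext => x; rewrite mul1r.
Qed.

End MeanTheory.

End Means.

Section PositiveMaps.
Variables (R : realType) (G : groupType) (t : G -> R).
Local Notation E := (pointwise R (cell R G)).

(** Every defining condition is linear or an inequality between linear expressions, hence survives
    averaging. Means on two points give convexity, and means on the group give stability under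
    convolution. *)
Lemma positive_maps_mean (I : Type) (m : (I -> R) -> R) (T : I -> E) :
  mean m -> (forall i, positive_maps t (T i)) ->
  positive_maps t (fun j => m (fun i => T i j)).
Proof.
move=> mM TK.
have Tb f g h : is_bounded (fun i => T i (f, g, h)).
  have [[B fB]|fb] := pselect (is_bounded f).
    by exists B => i; have [_ TB _ _ _] := TK i; exact: TB.
  exists 0 => i; have [TN _ _ _ _] := TK i.
  by rewrite TN// normr0.
split.
- move=> f fb g h; rewrite -[RHS](mean0 mM); congr m; apply/funext => i.
  by have [TN _ _ _ _] := TK i; exact: TN.
- move=> f B fB g h; apply: mean_bound => // i.
  by have [_ TB _ _ _] := TK i; exact: TB.
- move=> a f f' fb fb' g h; have [_ mlin _ _] := mM.
  rewrite -mlin//; congr m; apply/funext => i.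
  by have [_ _ Tl _ _] := TK i; exact: Tl.
- move=> f fb f0 w; have [_ _ mpos _] := mM.
  have F1b p : is_bounded (fun i => \sum_(q <- w) p.1 * q.1 * T i (f, p.2, q.2)).
    have Fb (q : R * G) : is_bounded (fun i => p.1 * q.1 * T i (f, p.2, q.2)).
      have := is_bounded_lin (p.1 * q.1) (Tb f p.2 q.2) (is_bounded_cst I 0).
      by congr is_bounded; apply/funext => i; rewrite addr0.
    by have [] := mean_sum mM w Fb.
  have [Fb msum] := mean_sum mM w F1b.
  suff -> : form (fun g h => m (fun i => T i (f, g, h))) w w =
      m (fun i => \sum_(p <- w) \sum_(q <- w) p.1 * q.1 * T i (f, p.2, q.2)).
    apply: mpos => // i; have [_ _ _ Tp _] := TK i; exact: Tp.
  rewrite msum; apply: eq_bigr => p _.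
  have Fb' (q : R * G) : is_bounded (fun i => p.1 * q.1 * T i (f, p.2, q.2)).
    have := is_bounded_lin (p.1 * q.1) (Tb f p.2 q.2) (is_bounded_cst I 0).
    by congr is_bounded; apply/funext => i; rewrite addr0.
  have [_ ->] := mean_sum mM w Fb'.
  by apply: eq_bigr => q _; rewrite meanZ.
split=> [f g h|g h].
  by congr m; apply/funext => i; have [_ _ _ _ []] := TK i.
rewrite -[RHS](mean_cst mM); congr m; apply/funext => i.
by have [_ _ _ _ []] := TK i.
Qed.

Lemma mean_bool (l : R) : 0 <= l <= 1 ->
  mean (fun f : bool -> R => l * f true + (1 - l) * f false).
Proof.
move=> /andP[l0 l1]; split.
- move=> f []; exists (`|f true| + `|f false|) => -[].
    by rewrite lerDl.
  by rewrite lerDr.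
- by move=> a f f' _ _; ring.
- by move=> f _ f0; rewrite addr_ge0// mulr_ge0// subr_ge0.
- by ring.
Qed.

Lemma positive_maps_convex : convex_set (positive_maps t).
Proof.
apply/convex_setW => T T'; rewrite !inE => TK T'K l l0 l1; rewrite inE.
have l01 : 0 <= l%:num <= 1 by rewrite !ltW.
have TTK b : positive_maps t (if b then T else T') by case: b.
exact: (positive_maps_mean (mean_bool l01) TTK).
Qed.

Lemma positive_maps_closed : closed (positive_maps t).
Proof.
have cT (i : cell R G) : continuous (fun T : E => T i : R).
  exact: pointwise_coord_continuous.
rewrite (_ : positive_maps t =
  [set T : E | forall f, ~ is_bounded f -> forall g h, T (f, g, h) = 0] `&`
  ([set T : E | forall f B, (forall x, `|f x| <= B) ->
      forall g h, `|T (f, g, h)| <= B] `&`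
  ([set T : E | forall a f f', is_bounded f -> is_bounded f' -> forall g h,
        T ((fun x => a * f x + f' x), g, h) = a * T (f, g, h) + T (f', g, h)] `&`
  ([set T : E | forall f, is_bounded f -> (forall x, 0 <= f x) ->
        psd (fun g h => T (f, g, h))] `&`
  ([set T : E | forall f g h, T (f, g, h) = T (f, h, g)] `&`
  [set T : E | forall g h, T ((fun=> 1), g, h) = t (g^-1 * h)%g]))))); last first.
  apply/seteqP; split=> [T [h1 h2 h3 h4 [h5 h6]]|T [h1 [h2 [h3 [h4 [h5 h6]]]]]].
    by do !split.
  by split.
apply: closedI; [|apply: closedI; [|apply: closedI; [|apply: closedI; [|apply: closedI]]]].
- apply: closed_forall => f; apply: closed_imply => fb.
  by do 2!apply: closed_forall => ?; apply: closed_zero.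
- apply: closed_forall => f; apply: closed_forall => B; apply: closed_imply => fB.
  apply: closed_forall => g; apply: closed_forall => h.
  rewrite (_ : mkset _ = [set T : E | - B <= T (f, g, h)] `&`
      [set T : E | T (f, g, h) <= B]); last first.
    apply/seteqP; split=> T /=; first by rewrite ler_norml => /andP[].
    by move=> [h1 h2]; rewrite ler_norml h1.
  by apply: closedI; apply: closed_le_fun => //; exact: cst_continuous.
- do 3!apply: closed_forall => ?; do 2!apply: closed_imply => ?.
  do 2!apply: closed_forall => ?; apply: closed_eq_fun => //.
  by apply: continuous_add => //; exact: continuous_scaled.
- apply: closed_forall => f; do 2!apply: closed_imply => ?.
  apply: closed_forall => w; apply: closed_nneg.
  apply: continuous_sum_seq => p; apply: continuous_sum_seq => q.
  exact: continuous_scaled.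
- by do 3!apply: closed_forall => ?; exact: closed_eq_fun.
- do 2!apply: closed_forall => ?; apply: closed_eq_fun => //.
  exact: cst_continuous.
Qed.

(** A closed subset of a product of segments: the radius is a chosen bound of [f], and 0 for
    unbounded [f], where the coordinate vanishes. *)
Lemma positive_maps_compact : compact (positive_maps t).
Proof.
pose B (f : G -> R) : R :=
  if pselect (is_bounded f) is left fb then projT1 (cid fb) else 0.
pose A (i : cell R G) : set R := `[- B i.1.1, B i.1.1]%classic.
apply: (@subclosed_compact _ _ [set T : E | forall i, A i (T i)]).
- exact: positive_maps_closed.
- by apply: pointwise_compact => i; exact: segment_compact.
move=> T [TN TB _ _ _] [[f g] h].
rewrite /A /= in_itv /= -ler_norml /B.
case: pselect => [fb|fb]; last by rewrite TN// normr0.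
by apply: TB; exact: (projT2 (cid fb)).
Qed.

Lemma translate_positive_maps g T : (forall x y, t (x * y)%g = t (y * x)%g) ->
  positive_maps t T -> positive_maps t (translate g T).
Proof.
move=> tC [TN TB Tl Tp [Ts T1]].
have tb f : is_bounded f <-> is_bounded (fun x => f (g * x)%g).
  split=> -[B fB]; exists B => x //.
  by rewrite -[x](mulVKg g).
split; rewrite /translate /=.
- by move=> f fb a b; apply: TN; rewrite -tb.
- by move=> f B fB a b; apply: TB.
- by move=> a f f' fb fb' x y; apply: Tl; rewrite -tb.
- move=> f fb f0.
  have : psd (fun a b => T (fun x => f (g * x)%g, a, b)) by apply: Tp; rewrite -?tb.
  exact: (psd_map (fun x => (g^-1 * x)%g)).
- by split=> [f a b|a b]; rewrite ?T1 1?Ts// invgM invgK -mulgA mulVKg.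
Qed.

Lemma coamenable_equivariant_map (L : {pred G}) :
  (forall x y, t (x * y)%g = t (y * x)%g) ->
  coamenable R [set g | g \in L] ->
  (exists2 T, positive_maps t T & forall l, l \in L -> translate l T = T) ->
  exists2 T, positive_maps t T & forall g, translate g T = T.
Proof.
move=> tC coam [T TK Tfix].
apply: (coam E (positive_maps t) (@translate R G)).
- exact: pointwise_hausdorff.
- exact: positive_maps_compact.
- exact: positive_maps_convex.
- by exists T.
- split.
  + by move=> g T' T'K; apply: translate_positive_maps.
  + move=> T' _; apply/funext => -[[f a] b]; rewrite /translate /= invg1 !mul1g.
    by congr (T' (_, _, _)); apply/funext => x; rewrite mul1g.
  + move=> g h T' _; apply/funext => -[[f a] b]; rewrite /translate /=.
    rewrite !invgM !mulgA; congr (T' (_, _, _)); apply/funext => x.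
    by rewrite mulgA.
  + move=> g; apply: continuous_subspaceT; apply: pointwise_continuousP => i.
    exact: pointwise_coord_continuous.
  + by [].
- by exists T => // l; exact: Tfix.
Qed.

End PositiveMaps.

(** * Minimal left ideals of means *)

Section Convolution.
Variables (R : realType) (G : groupType).
Local Notation E := (pointwise R {classic G -> R}).
Implicit Types m q : E.

Definition conv m q : E := fun f => m (fun x => q (fun y => f (x * y)%g)).

Lemma is_bounded_translate (f : G -> R) g :
  is_bounded (fun x => f (g * x)%g) <-> is_bounded f.
Proof.
split=> -[B fB]; exists B => x //.
by rewrite -[x](mulVKg g).
Qed.

Lemma is_bounded_mean_translate q (f : G -> R) : mean q ->
  is_bounded (fun x => q (fun y => f (x * y)%g)).
Proof.
move=> qM; have [[B fB]|fb] := pselect (is_bounded f).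
  by exists B => x; apply: mean_bound.
have [qN _ _ _] := qM; exists 0 => x; rewrite qN ?normr0//.
by rewrite is_bounded_translate.
Qed.

Lemma mean_conv m q : mean m -> mean q -> mean (conv m q).
Proof.
move=> mM qM; have [_ mlin mpos m1] := mM; have [qN qlin qpos q1] := qM.
split; rewrite /conv.
- move=> f fb; rewrite -[RHS](mean0 mM); congr m; apply/funext => x.
  by apply: qN; rewrite is_bounded_translate.
- move=> a f f' fb fb'.
  rewrite -(mlin a _ _ (is_bounded_mean_translate f qM)
    (is_bounded_mean_translate f' qM)).
  by congr m; apply/funext => x; apply: qlin; rewrite is_bounded_translate.
- move=> f fb f0; apply: mpos; first exact: (is_bounded_mean_translate f qM).
  by move=> x; apply: qpos; rewrite ?is_bounded_translate.
- by rewrite -[RHS]m1; congr m; apply/funext => x; rewrite q1.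
Qed.

Lemma convA m p q : conv m (conv p q) = conv (conv m p) q.
Proof.
apply/funext => f; rewrite /conv; congr m; apply/funext => x.
congr p; apply/funext => y; congr q; apply/funext => z.
by rewrite mulgA.
Qed.

Definition dirac_mean (g : G) : E := fun f =>
  if `[< is_bounded (f : G -> R) >] then f g else 0.

Lemma dirac_mean_mean g : mean (dirac_mean g).
Proof.
rewrite /dirac_mean; split.
- by move=> f fb; case: asboolP.
- move=> a f f' fb fb'; rewrite !asboolT//.
  exact: is_bounded_lin.
- by move=> f fb f0; rewrite asboolT.
- by rewrite asboolT//; exact: is_bounded_cst.
Qed.

Lemma conv_dirac g q f : mean q ->
  conv (dirac_mean g) q f = q (fun y => f (g * y)%g).
Proof.
move=> qM; rewrite /conv /dirac_mean asboolT//.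
exact: (is_bounded_mean_translate f qM).
Qed.

Definition left_ideal (Q : set E) : Prop :=
  [/\ Q !=set0, compact Q, forall q, Q q -> mean q &
      forall m q, mean m -> Q q -> Q (conv m q)].

Lemma left_ideal_translate Q q g : left_ideal Q -> Q q ->
  exists2 q', Q q' & forall f, q' f = q (fun y => f (g * y)%g).
Proof.
move=> [_ _ Qmean Qconv] Qq; exists (conv (dirac_mean g) q).
  by apply: Qconv => //; exact: dirac_mean_mean.
by move=> f; rewrite conv_dirac//; exact: Qmean.
Qed.

(** Zorn's lemma for reversed inclusion: the intersection of a nonempty chain is nonempty by
    compactness, and the other properties pass to intersections. *)
Lemma minimal_left_ideal Q0 : left_ideal Q0 -> exists2 Q, Q `<=` Q0 &
  left_ideal Q /\ forall Q', left_ideal Q' -> Q' `<=` Q -> Q' = Q.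
Proof.
move=> Q0I; pose T := {Q : set E | left_ideal Q /\ Q `<=` Q0}.
pose le (Q Q' : T) : bool := `[< sval Q' `<=` sval Q >].
have [||| A Atot |[Q [QI QQ0]] Qmin] := @Zorn T le.
- by move=> Q; apply/asboolP.
- move=> Q1 Q2 Q3 /asboolP h /asboolP h'; apply/asboolP.
  exact: subset_trans h' h.
- move=> [Q h] [Q' h'] /asboolP /= le1 /asboolP /= le2; apply: eq_exist => /=.
  exact/seteqP.
- have [[Q1 AQ1]|/set0P/negP/negPn/eqP A0] := pselect (A !=set0); last first.
    by exists (exist _ Q0 (conj Q0I (@subset_refl _ Q0))) => Q; rewrite A0.
  pose I := \bigcap_(Q in A) sval Q.
  have Qclosed (Q : T) : closed (sval Q).
    case: (svalP Q) => -[_ Qc _ _] _.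
    by apply: compact_closed => //; exact: pointwise_hausdorff.
  have [[_ Q1c Q1m _] Q1Q0] := svalP Q1.
  have I1 : I `<=` sval Q1 by move=> q; apply.
  have Ine : I !=set0.
    pose F := filter_from A (fun Q => sval Q).
    have FF : ProperFilter F.
      apply: filter_from_proper; last by move=> Q _; case: (svalP Q) => -[].
      apply: filter_from_filter; first by exists Q1.
      move=> Q Q' AQ AQ'; case: (Atot _ _ AQ AQ') => /asboolP h.
        by exists Q' => // q Q'q; split => //; exact: h.
      by exists Q => // q Qq; split => //; exact: h.
    have [|q [_ qF]] := Q1c F FF; first by exists Q1.
    exists q => Q AQ; apply: Qclosed => U Uq.
    by apply: qF Uq; exists Q.
  have II : left_ideal I.
    split => //.
    - apply: (subclosed_compact _ Q1c) => //.
      by apply: closed_bigI => Q _; exact: Qclosed.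
    - by move=> q Iq; exact/Q1m/I1.
    - move=> m q mM Iq Q AQ; case: (svalP Q) => -[_ _ _ Qconv] _.
      by apply: Qconv => //; exact: Iq.
  have IQ0 : I `<=` Q0 by exact: subset_trans I1 Q1Q0.
  pose IT : T := exist (fun Q => left_ideal Q /\ Q `<=` Q0) I (conj II IQ0).
  by exists IT => Q AQ; apply/asboolP => q; apply.
exists Q => //; split => // Q' Q'I Q'Q.
pose Q'T : T := exist (fun Q => left_ideal Q /\ Q `<=` Q0) Q'
  (conj Q'I (subset_trans Q'Q QQ0)).
by have /(congr1 sval)/esym := Qmin Q'T (asboolT Q'Q).
Qed.

Definition fixing_subgroup (Q : set E) : set G :=
  [set g | forall q f, Q q -> is_bounded (f : G -> R) ->
     q (fun x => f (g * x)%g) = q f].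

(** Normality holds because [Q] contains the translates of its points, which are convolutions with
    Dirac means: invariance of a translate under [g] is invariance of the point under a conjugate of
    [g]. *)
Lemma fixing_subgroup_normal Q : left_ideal Q ->
  normal_subgroup (fixing_subgroup Q).
Proof.
move=> QI.
have NV g : fixing_subgroup Q g -> fixing_subgroup Q g^-1%g.
  move=> Ng q f Qq fb.
  have fgb : is_bounded (fun x => f (g^-1 * x)%g) by rewrite is_bounded_translate.
  rewrite -(Ng _ _ Qq fgb); congr q; apply/funext => x.
  by rewrite mulKg.
have NM g h : fixing_subgroup Q g -> fixing_subgroup Q h -> fixing_subgroup Q (g * h)%g.
  move=> Ng Nh q f Qq fb.
  have fgb : is_bounded (fun x => f (g * x)%g) by rewrite is_bounded_translate.
  rewrite -(Ng _ _ Qq fb) -(Nh _ _ Qq fgb).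
  by congr q; apply/funext => x; rewrite mulgA.
split.
- by move=> q f _ _; congr q; apply/funext => x; rewrite mul1g.
- by move=> x y Nx Ny; apply: NM => //; exact: NV.
move=> h g Ng q f Qq fb.
have fhb : is_bounded (fun x => f (h * x)%g) by rewrite is_bounded_translate.
have [q' Qq' q'E] := left_ideal_translate h^-1%g QI Qq.
have := Ng q' (fun x => f (h * x)%g) Qq' fhb.
rewrite !q'E => e; rewrite (_ : f = fun x => f (h * (h^-1 * x))%g); last first.
  by apply/funext => x; rewrite mulVKg.
rewrite -e; congr q; apply/funext => x.
by rewrite !mulgA mulgV mul1g.
Qed.

(** A point of [Q] is a mean on all of [G]. Pushing it forward along [n], which splits off a
    representative of the coset [N x], gives a mean on [N]; it is invariant because [n] commutes
    with left multiplication by [N]. *)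
Lemma fixing_subgroup_amenable Q : left_ideal Q ->
  amenable_subgroup R (fixing_subgroup Q).
Proof.
move=> QI; have [[q Qq] _ Qmean _] := QI; have qM := Qmean _ Qq.
have [N1 NB NJ] := fixing_subgroup_normal QI.
set N := fixing_subgroup Q in N1 NB NJ *.
have NV x : N x -> N x^-1%g by move=> Nx; rewrite -[x^-1%g]mul1g; exact: NB.
have NM x y : N x -> N y -> N (x * y)%g.
  by move=> Nx Ny; rewrite -[y]invgK; apply: NB => //; exact: NV.
pose rep x := xget 1%g [set y | N (x / y)%g].
have repP x : N (x / rep x)%g.
  have : exists y, [set y | N (x / y)%g] y by exists x; rewrite /= mulgV.
  by move/(xgetPex 1%g).
have repM g x : N g -> rep (g * x)%g = rep x.
  move=> Ng; rewrite /rep; congr xget; apply/seteqP; split => y /= h.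
    by rewrite -[(x / y)%g](mulKg g); apply: NM; rewrite ?mulgA//; exact: NV.
  by rewrite -mulgA; exact: NM.
pose n x := (x / rep x)%g.
have nM g x : N g -> n (g * x)%g = (g * n x)%g.
  by move=> Ng; rewrite /n repM// mulgA.
pose ind (A : set G) (x : G) : R := (n x \in A)%:R.
have indb A : is_bounded (ind A).
  by exists 1 => x; rewrite /ind; case: (_ \in _); rewrite /= ?normr1 ?normr0 ?ler01.
have [_ qlin qpos q1] := qM.
exists (fun A => q (ind A)); split.
- by move=> A _; apply: qpos => // x; rewrite /ind ler0n.
- rewrite -[RHS]q1; congr q; apply/funext => x; rewrite /ind mem_set//.
  exact: repP.
- move=> A B _ _ AB0; rewrite -meanD//; congr q; apply/funext => x; rewrite /ind.
  have [xA|xA] := boolP (n x \in A); have [xB|xB] := boolP (n x \in B).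
  + have : (A `&` B) (n x) by split; exact/set_mem.
    by rewrite AB0.
  + by rewrite mem_set ?addr0//; left; exact/set_mem.
  + by rewrite mem_set ?add0r//; right; exact/set_mem.
  + rewrite memNset ?addr0// => -[/mem_set|/mem_set]; exact/negP.
- move=> g A Ng _; have Ngi := NV _ Ng; have := Ngi _ _ Qq (indb A) => <-.
  congr q; apply/funext => x; rewrite /ind nM//; congr (nat_of_bool _)%:R.
  apply/idP/idP => /set_mem h; apply/mem_set.
    by case: h => y Ay <-; rewrite mulKg.
  by exists (g^-1 * n x)%g => //; rewrite mulVKg.
Qed.

End Convolution.

(** * The variance argument on a minimal left ideal *)

Section Rigidity.
Variables (R : realType) (G : groupType) (t : G -> R).
Hypothesis t1 : t 1%g = 1.
Hypothesis tC : forall x y, t (x * y)%g = t (y * x)%g.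
Local Notation E := (pointwise R {classic G -> R}).
Local Notation F := (pointwise R (cell R G)).

Definition equivariant_maps : set F :=
  [set T | positive_maps t T /\ forall g, translate g T = T].

Definition coef_mean (T : F) : E := fun f => T ((f : G -> R), 1%g, 1%g).

Lemma coef_mean_mean T : positive_maps t T -> mean (coef_mean T).
Proof.
move=> [TN TB Tl Tp [Ts T1]]; split; rewrite /coef_mean.
- by move=> f fb; exact: TN.
- by move=> a f f' fb fb'; exact: Tl.
- move=> f fb f0; have := Tp f fb f0 [:: (1, 1%g)].
  by rewrite /form !big_seq1 /= !mul1r.
- by rewrite T1 mulVg.
Qed.

Lemma equivariant_mapsE T f g a b : equivariant_maps T ->
  T (f, a, b) = T ((fun x => f (g * x)%g), (g^-1 * a)%g, (g^-1 * b)%g).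
Proof. by move=> [_ /(_ g)/(congr1 (fun T' : F => T' (f, a, b)))]. Qed.

(** By equivariance the coefficient of the translated function at [(1, 1)] is [T (f, k, k)], so
    convolution averages the maps with coefficients [T (f, a k, b k)]. At [f = 1] these still equal
    [t (a^-1 b)], since [t] is a class function. *)
Lemma conv_coef_mean m T : mean m -> equivariant_maps T ->
  exists2 T', equivariant_maps T' & conv m (coef_mean T) = coef_mean T'.
Proof.
move=> mM TX; have [TK Teq] := TX.
pose T' : F := fun i => m (fun k : G => T (i.1.1, i.1.2 * k, i.2 * k)%g).
exists T'.
  split.
    apply: (positive_maps_mean (T := fun k i => T (i.1.1, i.1.2 * k, i.2 * k)%g) mM).
    move=> k; have [TN TB Tl Tp [Ts T1]] := TK; split => /=.
    - by move=> f fb a b; exact: TN.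
    - by move=> f B fB a b; exact: TB.
    - by move=> a f f' fb fb' x y; exact: Tl.
    - move=> f fb f0.
      exact: (psd_map (fun x => (x * k)%g) (Tp f fb f0)).
    - split=> [f a b|a b]; first exact: Ts.
      by rewrite T1 invgM -mulgA tC -!mulgA mulgV mulg1.
  move=> g; apply/funext => -[[f a] b]; rewrite /translate /T' /=.
  congr m; apply/funext => k.
  by rewrite (equivariant_mapsE f g _ _ TX) !mulgA.
apply/funext => f; rewrite /conv /coef_mean /T' /=; congr m; apply/funext => x.
by rewrite [RHS](equivariant_mapsE _ x _ _ TX) !mul1g mulVg.
Qed.

Lemma equivariant_maps_compact : compact equivariant_maps.
Proof.
apply: compact_closedI; first exact: positive_maps_compact.
apply: closed_forall => g.
rewrite (_ : mkset _ = [set T | forall i, translate g T i = T i]).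
  apply: closed_forall => i; apply: closed_eq_fun.
    exact: pointwise_coord_continuous.
  exact: pointwise_coord_continuous.
apply/seteqP; split=> T /= h; last exact/funext.
by move=> i; rewrite h.
Qed.

Lemma left_ideal_coef_mean : equivariant_maps !=set0 ->
  left_ideal (coef_mean @` equivariant_maps).
Proof.
move=> [T0 T0X]; split.
- by exists (coef_mean T0), T0.
- apply: continuous_compact; last exact: equivariant_maps_compact.
  apply: continuous_subspaceT; apply: pointwise_continuousP => f.
  exact: pointwise_coord_continuous.
- by move=> _ [T [TK _] <-]; exact: coef_mean_mean.
- move=> m _ mM [T TX <-]; have [T' T'X ->] := conv_coef_mean mM TX.
  by exists T'.
Qed.

Variable Q : set E.
Hypothesis QI : left_ideal Q.
Hypothesis Qmin : forall Q', left_ideal Q' -> Q' `<=` Q -> Q' = Q.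
Hypothesis X0 : equivariant_maps !=set0.

(* Minimality makes Q the orbit of each of its points under the means that
   extend t. *)
Lemma minimal_left_idealE q0 q : Q q0 -> Q q ->
  exists2 T, equivariant_maps T & q = conv (coef_mean T) q0.
Proof.
have [_ _ Qmean Qconv] := QI => Qq0.
pose Z := [set conv (coef_mean T) q0 | T in equivariant_maps].
suff -> : Q = Z by move=> [T TX <-]; exists T.
apply/esym/Qmin; last first.
  by move=> _ [T [TK _] <-]; apply: Qconv => //; exact: coef_mean_mean.
have [T0 T0X] := X0; split.
- by exists (conv (coef_mean T0) q0), T0.
- apply: (@continuous_compact _ _ (fun T : F => conv (coef_mean T) q0)).
    apply: continuous_subspaceT; apply: pointwise_continuousP => f.
    exact: pointwise_coord_continuous.
  exact: equivariant_maps_compact.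
- move=> _ [T [TK _] <-]; apply: mean_conv; [exact: coef_mean_mean|exact: Qmean].
- move=> m _ mM [T TX <-]; have [T' T'X TT'] := conv_coef_mean mM TX.
  by exists T'; rewrite // convA TT'.
Qed.

(** Write [f = |f| - (|f| - f)], a difference of nonnegative functions of mean 0. For such a
    function [u], Cauchy-Schwarz bounds [T (u, 1, h) ^ 2] by [T (u, 1, 1) * T (u, h, h) = 0]. *)
Lemma equivariant_maps_null T (f : G -> R) g h : equivariant_maps T ->
  is_bounded f -> coef_mean T (fun x => `|f x|) = 0 ->
  h = 1%g \/ g = 1%g -> T (f, g, h) = 0.
Proof.
move=> TX fb f0 gh1; have [TK _] := TX.
have [TN TB Tl Tp [Ts T1]] := TK; have mM := coef_mean_mean TK.
wlog g1 : g h {gh1} / g = 1%g.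
  by move=> wl; case: gh1 => [h1|g1]; [rewrite Ts|]; exact: wl.
have nullpos (u : G -> R) : is_bounded u -> (forall x, 0 <= u x) ->
    coef_mean T u = 0 -> T (u, 1%g, h) = 0.
  move=> ub u0 mu0.
  have Tsym a b : T (u, a, b) = T (u, b, a) by exact: Ts.
  have := form_CauchySchwarz [:: (1, 1%g)] [:: (1, h)] Tsym (Tp u ub u0).
  rewrite /form !big_seq1 /= !mul1r; rewrite /coef_mean in mu0; rewrite mu0 mul0r.
  by move=> sq; apply/eqP; rewrite -sqrf_eq0 eq_le sq sqr_ge0.
have [B fB] := fb.
have nfb : is_bounded (fun x => `|f x|) by exists B => x; rewrite normr_id.
have dfb : is_bounded (fun x => -1 * f x + `|f x|) by exact: is_bounded_lin.
have Td : T ((fun x => -1 * f x + `|f x|), 1%g, h) = 0.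
  apply: nullpos => // [x|]; first by rewrite mulN1r addrC subr_ge0 ler_norm.
  have [_ _ mpos _] := mM; apply/eqP; rewrite eq_le; apply/andP; split; last first.
    by apply: mpos => // x; rewrite mulN1r addrC subr_ge0 ler_norm.
  have -> : 0 = coef_mean T (fun x => 2 * `|f x|) by rewrite meanZ// f0 mulr0.
  apply: mean_le => // [|x].
    exists (2 * B) => x; rewrite normrM normr_id (ger0_norm (ler0n _ 2)).
    by rewrite ler_pM2l.
  by have := ler_norm (- f x); rewrite normrN; lra.
have := Td; rewrite g1 Tl// (nullpos _ nfb _ f0) => [|x]; last exact: normr_ge0.
by lra.
Qed.

(** Averaging [y <= y ^ 2 / e + e] at [y = |f x|] gives a mean of at most [e], for every [e > 0]. *)
Lemma mean_square_null (m : (G -> R) -> R) (f : G -> R) : mean m -> is_bounded f ->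
  m (fun x => f x ^+ 2) <= 0 -> m (fun x => `|f x|) = 0.
Proof.
move=> mM [B fB] sq0; have [_ mlin mpos _] := mM.
have nb : is_bounded (fun x => `|f x|) by exists B => x; rewrite normr_id.
have sb : is_bounded (fun x => f x ^+ 2).
  exists (B ^+ 2) => x; rewrite normrX lerXn2r ?nnegrE//.
  exact: le_trans (fB x).
apply/eqP; rewrite eq_le mpos// andbT; apply/ler_addgt0Pl => e e0; rewrite addr0.
have h : m (fun x => `|f x|) <= m (fun x => e^-1 * f x ^+ 2 + e).
  apply: mean_le => //; first exact/is_bounded_lin/is_bounded_cst.
  move=> x; rewrite -real_normK ?num_real// -(ler_pM2l e0) mulrDr mulrA.
  rewrite mulfV ?gt_eqF// mul1r; set y := `|f x|.
  have := sqr_ge0 (y - e); have := sqr_ge0 y; have := sqr_ge0 e; nra.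
apply: le_trans h _; rewrite mlin// ?mean_cst//; last exact: is_bounded_cst.
by rewrite gerDr mulr_ge0_le0// invr_ge0 ltW.
Qed.

(* psi is strictly convex, so at a maximum q1 = T * q0 the functions A and A(g .)
   have variance 0 under T; Cauchy-Schwarz then evaluates T (A, 1, g) in two
   ways, as q1(f) t(g) and as q1(f(g .)) t(g). *)
Lemma rigidity g : t g != 0 -> fixing_subgroup Q g.
Proof.
move=> tg q f Qq fb; have [_ Qc Qmean _] := QI.
have [B fB] := fb.
apply/eqP/negPn/negP => qfg.
pose fg x := f (g * x)%g.
have fgb : is_bounded fg by exists B => x; exact: fB.
pose d := (q f - q fg) ^+ 2.
have d0 : 0 < d by rewrite exprn_even_gt0//= subr_eq0 eq_sym; exact: qfg.
(* The quadratic term of [psi] gives strict convexity, yet [dl] is so small that a point of [Q] with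
   equal values at [f] and [fg] has [psi] at most [2 dl B^2 < d], while [psi q >= d]. *)
pose dl := d / (4 * (B ^+ 2 + 1)).
have B1 : 0 < B ^+ 2 + 1 by rewrite ltr_wpDl ?sqr_ge0.
have dl0 : 0 < dl by rewrite divr_gt0// mulr_gt0.
have dlB : 2 * dl * B ^+ 2 < d.
  have -> : 2 * dl * B ^+ 2 = d * (B ^+ 2 / (2 * (B ^+ 2 + 1))).
    by rewrite /dl; field; rewrite gt_eqF.
  rewrite -[ltRHS]mulr1 ltr_pM2l// ltr_pdivrMr ?mulr_gt0//; nra.
pose psi (q : E) := (q f - q fg) ^+ 2 + dl * (q f ^+ 2 + q fg ^+ 2).
have psic : continuous psi.
  have cf (k : G -> R) : continuous (fun q : E => q k : R).
    exact: pointwise_coord_continuous.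
  have sqc (k : E -> R) : continuous k -> continuous (fun q => k q ^+ 2).
    move=> kc; rewrite (_ : (fun q => _) = fun q => k q * k q).
      by move=> z; apply: (@continuousM R E k k); exact: kc.
    by apply/funext => z; rewrite expr2.
  apply: continuous_add; first by apply/sqc/continuous_sub.
  by apply: continuous_scaled; apply: continuous_add; exact: sqc.
have [|q1 /set_mem Qq1 q1max] := compact_EVT_max _ Qc (continuous_subspaceT psic).
  by exists q.
have [T TX q1E] := minimal_left_idealE Qq Qq1.
have [TK _] := TX; have mM := coef_mean_mean TK.
pose A x := q (fun y => f (x * y)%g).
have Ab : is_bounded A by exact: (is_bounded_mean_translate f (Qmean _ Qq)).
have AgE : (fun x => A (g * x)%g) = fun x => q (fun y => fg (x * y)%g).
  by apply/funext => x; congr q; apply/funext => y; rewrite /fg mulgA.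
have Agb : is_bounded (fun x => A (g * x)%g) by rewrite is_bounded_translate.
pose al := q1 f; pose al' := q1 fg.
have mA : coef_mean T A = al by rewrite /al q1E.
have mA' : coef_mean T (fun x => A (g * x)%g) = al' by rewrite /al' q1E AgE.
(* The translates of [q] lie in [Q], and [q1] is their average under [T]: [al] and [al'] are the
   means of the values [A x] and [A (g x)]. *)
have psiA x : (A x - A (g * x)%g) ^+ 2 + dl * (A x ^+ 2 + A (g * x)%g ^+ 2) <=
    (al - al') ^+ 2 + dl * (al ^+ 2 + al' ^+ 2).
  have [q' Qq' q'E] := left_ideal_translate x QI Qq.
  have := q1max q' (mem_set Qq'); rewrite /psi !q'E -/al -/al' -/(A x).
  have -> // : q (fun y => fg (x * y)%g) = A (g * x)%g.
  by rewrite /A; congr q; apply/funext => y; rewrite /fg mulgA.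
have Acb a (k : G -> R) : is_bounded k -> is_bounded (fun x => k x - a).
  move=> kb; have := is_bounded_lin 1 kb (is_bounded_cst G (- a)).
  by congr is_bounded; apply/funext => x; rewrite mul1r.
have mAc a (k : G -> R) : is_bounded k ->
    coef_mean T (fun x => k x - a) = coef_mean T k - a.
  by move=> kb; rewrite (meanD mM kb (is_bounded_cst G (- a))) mean_cst.
(* [(c1, c2)] is minus the gradient of [psi] in its two values at the maximum. The second order
   expansion of [psi] there bounds [dl] times the squared distance by [lin], whose mean is 0. *)
pose c1 := - 2 * (al - al') - 2 * dl * al.
pose c2 := 2 * (al - al') - 2 * dl * al'.
pose lin x := c1 * (A x - al) + c2 * (A (g * x)%g - al').
have b1 := Acb al _ Ab; have b2 := Acb al' _ Agb.
have b2' : is_bounded (fun x => c2 * (A (g * x)%g - al')).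
  have := is_bounded_lin c2 b2 (is_bounded_cst G 0).
  by congr is_bounded; apply/funext => x; rewrite addr0.
have linb : is_bounded lin by exact: is_bounded_lin.
have mlin0 : coef_mean T lin = 0.
  have [_ ml _ _] := mM; rewrite /lin ml// meanZ// !mAc// mA mA' !subrr; ring.
have sqb (k : G -> R) : is_bounded k -> is_bounded (fun x => k x ^+ 2).
  move=> [C kC]; exists (C ^+ 2) => x; rewrite normrX lerXn2r ?nnegrE//.
  exact: le_trans (kC x).
have sqle0 (k : G -> R) : is_bounded k -> (forall x, dl * k x ^+ 2 <= lin x) ->
    coef_mean T (fun x => `|k x|) = 0.
  move=> kb kle; apply: mean_square_null => //.
  rewrite -(pmulr_rle0 _ dl0) -meanZ// -mlin0; apply: mean_le => //.
  have := is_bounded_lin dl (sqb _ kb) (is_bounded_cst G 0).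
  by congr is_bounded; apply/funext => x; rewrite addr0.
have key x : dl * (A x - al) ^+ 2 + dl * (A (g * x)%g - al') ^+ 2 <= lin x.
  have := psiA x; rewrite /lin /c1 /c2; move: (A x) (A (g * x)%g) => a a'.
  have := sqr_ge0 ((a - al) - (a' - al')); nra.
have n1 : coef_mean T (fun x => `|A x - al|) = 0.
  apply: sqle0 => // x; apply: le_trans (key x).
  by rewrite lerDl mulr_ge0 ?sqr_ge0// ltW.
have n2 : coef_mean T (fun x => `|A (g * x)%g - al'|) = 0.
  apply: sqle0 => // x; apply: le_trans (key x).
  by rewrite lerDr mulr_ge0 ?sqr_ge0// ltW.
have [TN TB Tl Tp [Ts T1]] := TK.
have Tsplit (k : G -> R) a h h' : is_bounded k -> h' = 1%g \/ h = 1%g ->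
    coef_mean T (fun x => `|k x - a|) = 0 -> T (k, h, h') = a * t (h^-1 * h')%g.
  move=> kb hh k0; have := equivariant_maps_null TX (Acb a _ kb) k0 hh.
  have -> : (fun x => k x - a) = fun x => 1 * k x + (- a * (fun=> 1) x + (fun=> 0) x).
    by apply/funext => x /=; rewrite mul1r mulr1 addr0.
  have b0 := is_bounded_cst G (0 : R); have b1' := is_bounded_cst G (1 : R).
  rewrite Tl//; last exact: is_bounded_lin.
  rewrite Tl// T1 => e.
  have T0 : T ((fun=> 0), h, h') = 0.
    by apply/eqP; rewrite -normr_le0; apply: TB => x; rewrite normr0.
  by rewrite T0 in e; lra.
have e1 := Tsplit _ _ 1%g g Ab (or_intror erefl) n1.
have e2 := Tsplit _ _ g^-1%g 1%g Agb (or_introl erefl) n2.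
have aa' : al = al'.
  apply: (mulIf tg); move: e1 e2.
  rewrite (equivariant_mapsE _ g _ _ TX) mulg1 mulVg => ->.
  by rewrite invg1 mul1g invgK mulg1.
(* With [al = al'] the maximal value is [2 dl al^2 <= 2 dl B^2 < d], below the value at [q]. *)
have := q1max q (mem_set Qq); rewrite /psi -/al -/al' -aa' subrr -/d => h.
have alB : `|al| <= B by apply: mean_bound => //; exact: Qmean.
have alB2 : al ^+ 2 <= B ^+ 2.
  by rewrite -real_normK ?num_real// lerXn2r// nnegrE// (le_trans _ alB).
have : dl * (al ^+ 2 + al ^+ 2) <= 2 * dl * B ^+ 2 by nra.
have : 0 <= dl * (q f ^+ 2 + q fg ^+ 2).
  by rewrite mulr_ge0 ?addr_ge0 ?sqr_ge0// ltW.
by move: h; rewrite expr0n /=; lra.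
Qed.

End Rigidity.

Lemma support_in_radical (R : realType) (G : groupType) (t : G -> R)
    (Rad : set G) :
  t 1%g = 1 -> (forall x y, t (x * y)%g = t (y * x)%g) ->
  equivariant_maps t !=set0 -> amenable_radical R Rad ->
  forall g, t g != 0 -> Rad g.
Proof.
move=> t1 tC X0 [_ _ Radmax] g tg.
have [Q _ [QI Qmin]] := minimal_left_ideal (left_ideal_coef_mean t1 tC X0).
apply: (Radmax (fixing_subgroup Q)).
- exact: fixing_subgroup_normal.
- exact: fixing_subgroup_amenable.
- exact: (rigidity t1 tC QI Qmin X0 tg).
Qed.

(** * The square of a trace *)

(** Expanding one factor [M i j] by the spectral theorem turns the sum into a combination of
    conjugated values of the form of [M], weighted by the nonnegative eigenvalues. *)
Lemma schur_square_psd (C : numClosedFieldType) (n : nat) (M : 'M[C]_n) :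
  (forall i j, M j i = Num.conj (M i j)) ->
  (forall v : 'I_n -> C,
    0 <= \sum_i \sum_j Num.conj (v i) * v j * M i j) ->
  forall a : 'I_n -> C,
    0 <= \sum_i \sum_j Num.conj (a i) * a j * (M i j * Num.conj (M i j)).
Proof.
move=> Mherm Mpsd a.
have /hermitian_normalmx/orthomx_spectralP : M \is hermsymmx.
  apply/is_hermitianmxP; rewrite expr0 scale1r; apply/matrixP => i j.
  by rewrite !mxE Mherm.
set P := spectralmx M; set d := spectral_diag M => ME.
have Pu : P \is unitarymx by exact: spectral_unitarymx.
have MP : P *m M *m map_mx Num.conj (P^T) = diag_mx d.
  rewrite ME invmx_unitary// -/P -/d !mulmxA.
  move/unitarymxP: (Pu) => ->; rewrite mul1mx -mulmxA.
  by move/unitarymxP: (Pu) => ->; rewrite mulmx1.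
have Mij i j : M i j = \sum_k Num.conj (P k i) * d 0 k * P k j.
  rewrite [in LHS]ME invmx_unitary// mxE; apply: eq_bigr => k _.
  by rewrite mul_mx_diag !mxE.
have d0 k : 0 <= d 0 k.
  have := congr1 (fun X : 'M[C]_n => X k k) MP; rewrite [RHS]mxE eqxx mulr1n => <-.
  have := Mpsd (fun i => Num.conj (P k i)); congr (_ <= _).
  rewrite exchange_big !mxE; apply: eq_bigr => j _; rewrite !mxE mulr_suml.
  by apply: eq_bigr => i _; rewrite conjCK; ring.
have -> : \sum_i \sum_j Num.conj (a i) * a j * (M i j * Num.conj (M i j)) =
    \sum_k d 0 k * Num.conj (\sum_i \sum_j
      Num.conj (Num.conj (a i * P k i)) * Num.conj (a j * P k j) * M i j).
  under [RHS]eq_bigr do rewrite rmorph_sum mulr_sumr.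
  rewrite [RHS]exchange_big; apply: eq_bigr => i _.
  under [RHS]eq_bigr do rewrite rmorph_sum mulr_sumr.
  rewrite [RHS]exchange_big; apply: eq_bigr => j _.
  rewrite [X in X * Num.conj _]Mij mulr_suml mulr_sumr; apply: eq_bigr => k _.
  rewrite !rmorphM /= !conjCK; ring.
apply: sumr_ge0 => k _; rewrite mulr_ge0// conjC_ge0.
exact: Mpsd.
Qed.

Lemma conjCE (R : realType) (x y : R) : Num.conj (x +i* y) = x -i* y :> R[i].
Proof. by []. Qed.

Section TraceSquare.
Variables (R : realType) (A : cstarAlgType R) (tau : {scalar A}).
Hypothesis tauT : tracial_state tau.

Lemma star1 : star (1 : A) = 1.
Proof. by rewrite -[LHS]mulr1 -[X in _ * X]starK -starM mulr1 starK. Qed.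

Lemma star_sum (I : Type) (s : seq I) (F : I -> A) :
  star (\sum_(i <- s) F i) = \sum_(i <- s) star (F i).
Proof.
have star0 : star (0 : A) = 0.
  by apply: (@addrI _ (star 0)); rewrite -starD !addr0.
exact: (big_morph _ starD star0).
Qed.

(** Positivity at [a + c *: 1] makes [c * tau (star a) + conj c * tau a] real; [c = 1] gives the
    imaginary parts and [c = i] the real parts. *)
Lemma tau_hermitian a : tau (star a) = Num.conj (tau a).
Proof.
have [tpos _ tau1 _] := tauT.
have real_lin (c : R[i]) :
    c * tau (star a) + Num.conj c * tau a \is Num.real.
  have h := tpos (a + c *: 1); have h1 := tpos a; have h2 := tpos (c *: 1).
  have e : tau (star (a + c *: 1) * (a + c *: 1)) =
      tau (star a * a) + tau (star (c *: 1) * (c *: 1))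
      + (c * tau (star a) + Num.conj c * tau a).
    rewrite starD starZ star1 mulrDl !mulrDr !linearD /=.
    rewrite -!scalerAl -!scalerAr !mul1r !mulr1 !linearZ /=.
    by rewrite /GRing.scale /=; ring.
  have -> : c * tau (star a) + Num.conj c * tau a =
      tau (star (a + c *: 1) * (a + c *: 1))
      - (tau (star a * a) + tau (star (c *: 1) * (c *: 1))).
    by rewrite e [RHS]addrC addKr.
  by rewrite rpredB ?rpredD// ger0_real.
have h1 := real_lin 1; have h2 := real_lin (0 +i* 1).
move: h1 h2; case: (tau (star a)) => x y; case: (tau a) => z w.
rewrite rmorph1 !mul1r => /complex_realP[r [_ e1]].
move=> /complex_realP[r' [_ e2]]; rewrite conjCE; congr (_ +i* _); lra.
Qed.


Variables (G : groupType) (u : G -> A).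
Hypothesis u1 : u 1%g = 1.
Hypothesis uM : forall g h, u (g * h)%g = u g * u h.
Hypothesis uV : forall g, star (u g) = u (g^-1)%g.

Definition trace_square (g : G) : R :=
  complex.Re (tau (u g)) ^+ 2 + complex.Im (tau (u g)) ^+ 2.

Lemma trace_squareE g :
  (trace_square g)%:C = tau (u g) * Num.conj (tau (u g)).
Proof. by rewrite /trace_square add_Re2_Im2 normCK. Qed.

Lemma trace_square_eq0 g : (trace_square g == 0) = (tau (u g) == 0).
Proof.
rewrite -(inj_eq (@complexI R)) trace_squareE rmorph0.
by rewrite mulf_eq0 conjC_eq0 orbb.
Qed.

Lemma trace_square1 : trace_square 1%g = 1.
Proof.
have [_ _ tau1 _] := tauT; apply: complexI.
by rewrite trace_squareE u1 tau1 rmorph1 mul1r.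
Qed.

Lemma trace_squareV g : trace_square (g^-1)%g = trace_square g.
Proof.
by apply: complexI; rewrite !trace_squareE -uV tau_hermitian conjCK mulrC.
Qed.

Lemma trace_squareC g h : trace_square (g * h)%g = trace_square (h * g)%g.
Proof.
by have [_ _ _ tauC] := tauT; apply: complexI; rewrite !trace_squareE !uM tauC.
Qed.

(** The numbers [tau (u (x^-1 * y))] form the Gram matrix of the [u x] for the form
    [tau (star a * b)], and [trace_square] is the entrywise product of this matrix with its
    conjugate. *)
Lemma trace_square_psd : psd (fun x y => trace_square (x^-1 * y)%g).
Proof.
have [tpos _ _ _] := tauT => w.
pose x i := (tnth (in_tuple w) i).2.
pose M : 'M[R[i]]_(size w) := \matrix_(i, j) tau (u ((x i)^-1 * x j)%g).
have Mherm i j : M j i = Num.conj (M i j).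
  by rewrite !mxE -tau_hermitian uV invgM invgK.
have Mpsd (v : 'I_(size w) -> R[i]) :
    0 <= \sum_i \sum_j Num.conj (v i) * v j * M i j.
  have := tpos (\sum_i v i *: u (x i)); congr (_ <= _).
  rewrite star_sum mulr_suml linear_sum; apply: eq_bigr => i _.
  rewrite mulr_sumr linear_sum; apply: eq_bigr => j _.
  rewrite starZ -scalerAl -scalerAr scalerA linearZ /= mxE uV -uM.
  by [].
have := schur_square_psd Mherm Mpsd (fun i => (tnth (in_tuple w) i).1%:C).
rewrite -ler0c; congr (_ <= _).
rewrite /form (big_tnth _ _ w) rmorph_sum; apply: eq_bigr => i _ /=.
rewrite (big_tnth _ _ w) rmorph_sum; apply: eq_bigr => j _ /=.
rewrite !rmorphM /= trace_squareE !mxE; congr (_ * _ * _).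
by rewrite conjCE oppr0.
Qed.

End TraceSquare.

(** * The Hilbert space of square summable families *)

Section AbsoluteSums.
Variables (R : realType) (I : choiceType).
Implicit Types (h a b F : I -> R) (s : seq I).

Definition sum_bounded h (M : R) := forall s, uniq s -> \sum_(i <- s) h i <= M.

Definition psum h : R := sup [set \sum_(i <- s) h i | s in [set s | uniq s]].

Definition nsummable h := (forall i, 0 <= h i) /\ exists M, sum_bounded h M.

Lemma le_psum h s : nsummable h -> uniq s -> \sum_(i <- s) h i <= psum h.
Proof.
move=> [_ [M hM]] us; apply: ub_le_sup; last by exists s.
by exists M => _ [s' us' <-]; exact: hM.
Qed.

Lemma psum_le h M : sum_bounded h M -> psum h <= M.
Proof.
move=> hM; apply: ge_sup; first by exists 0, [::] => //; rewrite big_nil.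
by move=> _ [s us <-]; exact: hM.
Qed.

Lemma psum_ge0 h : nsummable h -> 0 <= psum h.
Proof.
by move=> hs; apply: le_trans (le_psum hs (isT : uniq [::])); rewrite big_nil.
Qed.

Lemma nsummable_le a b : (forall i, 0 <= a i) -> nsummable b ->
  (forall i, a i <= b i) -> nsummable a.
Proof.
move=> a0 [_ [M bM]] ab; split => //; exists M => s us.
by apply: le_trans (bM s us); apply: ler_sum => i _.
Qed.

Lemma nsummableD a b : nsummable a -> nsummable b -> nsummable (fun i => a i + b i).
Proof.
move=> [a0 [M aM]] [b0 [M' bM']]; split=> [i|]; first by rewrite addr_ge0.
by exists (M + M') => s us; rewrite big_split lerD// ?aM ?bM'.
Qed.

Lemma nsummableZ c a : 0 <= c -> nsummable a -> nsummable (fun i => c * a i).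
Proof.
move=> c0 [a0 [M aM]]; split=> [i|]; first by rewrite mulr_ge0.
by exists (c * M) => s us; rewrite -mulr_sumr ler_wpM2l// aM.
Qed.

Lemma le_sum_subseq h s s' : (forall i, 0 <= h i) -> uniq s -> uniq s' ->
  {subset s <= s'} -> \sum_(i <- s) h i <= \sum_(i <- s') h i.
Proof.
move=> h0 us us' ss'; rewrite [leRHS](bigID (mem s)) /=.
rewrite [X in X + _](_ : _ = \sum_(i <- s) h i); last first.
  rewrite -big_filter; apply: perm_big; apply: uniq_perm; rewrite ?filter_uniq//.
  by move=> i; rewrite mem_filter; have := ss' i; case: (i \in s) => //= ->.
by rewrite lerDl sumr_ge0.
Qed.

Lemma psumD a b : nsummable a -> nsummable b ->
  psum (fun i => a i + b i) = psum a + psum b.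
Proof.
move=> asum bsum; apply/eqP; rewrite eq_le; apply/andP; split.
  by apply: psum_le => s us; rewrite big_split lerD// le_psum.
have [a0 _] := asum; have [b0 _] := bsum.
rewrite -lerBrDr; apply: psum_le => s us; rewrite lerBrDr addrC -lerBrDr.
apply: psum_le => s' us'; rewrite lerBrDr addrC.
have uss : uniq (undup (s ++ s')) by exact: undup_uniq.
apply: le_trans (le_psum (nsummableD asum bsum) uss); rewrite big_split.
by apply: lerD; apply: le_sum_subseq => // i si;
  rewrite mem_undup mem_cat si ?orbT.
Qed.

Lemma psumZ c a : 0 <= c -> nsummable a -> psum (fun i => c * a i) = c * psum a.
Proof.
rewrite le_eqVlt => /predU1P[<- asum|c0 asum].
  rewrite mul0r; apply/eqP; rewrite eq_le psum_ge0 ?andbT; last exact: nsummableZ.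
  by apply: psum_le => s us; rewrite big1// => i _; rewrite mul0r.
have cas := nsummableZ (ltW c0) asum.
apply/eqP; rewrite eq_le; apply/andP; split.
  by apply: psum_le => s us; rewrite -mulr_sumr ler_pM2l// le_psum.
rewrite -ler_pdivlMl//; apply: psum_le => s us.
by rewrite ler_pdivlMl// mulr_sumr; exact: le_psum.
Qed.

Lemma psum_bij (f g : I -> I) h : cancel f g -> cancel g f ->
  psum (fun i => h (f i)) = psum h.
Proof.
move=> fK gK; congr sup; apply/seteqP; split => _ [s us <-] /=.
  exists (map f s); last by rewrite big_map.
  by rewrite /= map_inj_uniq//; exact: can_inj fK.
exists (map g s); first by rewrite /= map_inj_uniq//; exact: can_inj gK.
by rewrite big_map; apply: eq_bigr => i _; rewrite gK.
Qed.

Definition asummable F := nsummable (fun i => `|F i|).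

(** [F] is the difference of the nonnegative families [F + |F|] and [|F|]; by [tsumE] any other such
    summable decomposition gives the same value. *)
Definition tsum F : R := psum (fun i => F i + `|F i|) - psum (fun i => `|F i|).

Lemma asummable_pos F : asummable F -> nsummable (fun i => F i + `|F i|).
Proof.
move=> Fs; apply: nsummable_le (nsummableD Fs Fs) _ => i.
  by have := ler_norm (- F i); rewrite normrN; lra.
by rewrite lerD2r ler_norm.
Qed.

Lemma tsumE F a b : nsummable a -> nsummable b -> (forall i, F i = a i - b i) ->
  asummable F /\ tsum F = psum a - psum b.
Proof.
move=> asum bsum Fab; have [a0 _] := asum; have [b0 _] := bsum.
have Fs : asummable F.
  apply: nsummable_le (nsummableD asum bsum) _ => i //.
  by rewrite Fab; apply: le_trans (ler_normB _ _) _; rewrite !ger0_norm.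
split => //; have := psumD (asummable_pos Fs) bsum; have := psumD asum Fs.
rewrite /tsum (_ : (fun i => a i + `|F i|) = (fun i => F i + `|F i| + b i)).
  by move=> ->; lra.
by apply/funext => i; have := Fab i; lra.
Qed.

Lemma tsum_lin c F F' : asummable F -> asummable F' ->
  asummable (fun i => c * F i + F' i) /\
  tsum (fun i => c * F i + F' i) = c * tsum F + tsum F'.
Proof.
move=> Fs Fs'; have Fp := asummable_pos Fs; have Fp' := asummable_pos Fs'.
have [c0|c0] := ger0P c.
  have [||i|h ->] := @tsumE (fun i => c * F i + F' i)
    (fun i => c * (F i + `|F i|) + (F' i + `|F' i|)) (fun i => c * `|F i| + `|F' i|).
  - by apply: nsummableD => //; exact: nsummableZ.
  - by apply: nsummableD => //; exact: nsummableZ.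
  - ring.
  split=> //; rewrite (psumD (nsummableZ c0 Fp) Fp') (psumD (nsummableZ c0 Fs) Fs').
  by rewrite (psumZ c0 Fp) (psumZ c0 Fs) /tsum; ring.
have Nc0 : 0 <= - c by rewrite oppr_ge0 ltW.
have [||i|h ->] := @tsumE (fun i => c * F i + F' i)
    (fun i => - c * `|F i| + (F' i + `|F' i|)) (fun i => - c * (F i + `|F i|) + `|F' i|).
- by apply: nsummableD => //; exact: nsummableZ.
- by apply: nsummableD => //; exact: nsummableZ.
- ring.
split=> //; rewrite (psumD (nsummableZ Nc0 Fs) Fp') (psumD (nsummableZ Nc0 Fp) Fs').
by rewrite (psumZ Nc0 Fp) (psumZ Nc0 Fs) /tsum; ring.
Qed.

Lemma tsum_pos F : nsummable F -> tsum F = psum F.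
Proof.
move=> Fs; have n0 : nsummable (fun=> 0 : R).
  by split => //; exists 0 => s _; rewrite big1.
have [|_ ->] := @tsumE F F (fun=> 0) Fs n0; first by move=> i; rewrite subr0.
suff -> : psum (fun=> 0) = 0 by rewrite subr0.
apply/eqP; rewrite eq_le psum_ge0// andbT.
by apply: psum_le => s _; rewrite big1.
Qed.

Lemma tsum_bij (f g : I -> I) F : cancel f g -> cancel g f ->
  tsum (fun i => F (f i)) = tsum F.
Proof.
move=> fK gK; rewrite /tsum; congr (_ - _).
  exact: (psum_bij (fun i => F i + `|F i|) fK gK).
exact: (psum_bij (fun i => `|F i|) fK gK).
Qed.

End AbsoluteSums.

Section RealSquareSummable.
Variables (R : realType) (I : choiceType).
Implicit Types (x y : I -> R).

Definition sqsummable x := nsummable (fun i => x i ^+ 2).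

Definition dotp x y : R := tsum (fun i => x i * y i).

Lemma sqsummable_prod x y : sqsummable x -> sqsummable y ->
  asummable (fun i => x i * y i).
Proof.
move=> xs ys; apply: nsummable_le (nsummableD xs ys) _ => i //.
rewrite normrM -(real_normK (num_real (x i))) -(real_normK (num_real (y i))).
by have := sqr_ge0 (`|x i| - `|y i|); have := normr_ge0 (x i);
  have := normr_ge0 (y i); nra.
Qed.

Lemma dotpC x y : dotp x y = dotp y x.
Proof. by congr tsum; apply/funext => i; rewrite mulrC. Qed.

Lemma sqsummable_lin c x y : sqsummable x -> sqsummable y ->
  sqsummable (fun i => c * x i + y i).
Proof.
move=> xs ys; have cs := @nsummableZ _ _ (2 * c ^+ 2) _ _ xs.
have ys2 := @nsummableZ _ _ 2 _ (ler0n _ 2) ys.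
apply: nsummable_le (nsummableD (cs _) ys2) _ => [i||i].
- exact: sqr_ge0.
- by rewrite mulr_ge0 ?sqr_ge0.
- by have := sqr_ge0 (c * x i - y i); nra.
Qed.

Lemma dotp_lin c x y z : sqsummable x -> sqsummable y -> sqsummable z ->
  dotp (fun i => c * x i + y i) z = c * dotp x z + dotp y z.
Proof.
move=> xs ys zs.
have [_ <-] := tsum_lin c (sqsummable_prod xs zs) (sqsummable_prod ys zs).
by congr tsum; apply/funext => i; ring.
Qed.

Lemma dotp_psum x : sqsummable x -> dotp x x = psum (fun i => x i ^+ 2).
Proof.
by move=> xs; rewrite -tsum_pos.
Qed.

Lemma dotp_ge0 x : sqsummable x -> 0 <= dotp x x.
Proof. by move=> xs; rewrite dotp_psum// psum_ge0. Qed.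

Lemma sqsummable0 : sqsummable (fun=> 0).
Proof.
by split=> [i|]; [exact: sqr_ge0|exists 0 => s _; rewrite big1// => i _; rewrite expr0n].
Qed.

End RealSquareSummable.

Section L2.
Variables (R : realType) (I : choiceType).
Local Notation C := (R[i]).

Definition l2_pred : {pred (I -> C^o)} := fun f =>
  `[< sqsummable (fun i => complex.Re (f i)) /\ sqsummable (fun i => complex.Im (f i)) >].

Lemma l2_submod_closed : submod_closed l2_pred.
Proof.
split=> [|a f g /asboolP[f1 f2] /asboolP[g1 g2]].
  by apply/asboolP; split; exact: sqsummable0.
apply/asboolP; case: a => a b; split.
  have := sqsummable_lin a f1 (sqsummable_lin (- b) f2 g1); congr sqsummable.
  apply/funext => i; rewrite -[(_ + g) i]/(_ * f i + g i).
  by case: (f i) (g i) => ? ? [? ?] /=; ring.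
have := sqsummable_lin a f2 (sqsummable_lin b f1 g2); congr sqsummable.
apply/funext => i; rewrite -[(_ + g) i]/(_ * f i + g i).
by case: (f i) (g i) => ? ? [? ?] /=; ring.
Qed.

HB.instance Definition _ := GRing.isSubmodClosed.Build C (I -> C^o) l2_pred
  l2_submod_closed.

Definition l2 := {f : I -> C^o | f \in l2_pred}.

HB.instance Definition _ := SubType.on l2.
HB.instance Definition _ := Choice.on l2.
HB.instance Definition _ := [SubChoice_isSubLmodule of l2 by <:].

Implicit Types (x y z : l2).

Definition l2re x i := complex.Re (val x i).
Definition l2im x i := complex.Im (val x i).

Lemma l2re_summable x : sqsummable (l2re x).
Proof. by have /asboolP[] := valP x. Qed.

Lemma l2im_summable x : sqsummable (l2im x).
Proof. by have /asboolP[] := valP x. Qed.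

Local Hint Resolve l2re_summable l2im_summable : core.

Lemma val_lin (a : C) x y i : val (a *: x + y) i = a * val x i + val y i.
Proof. by rewrite linearP. Qed.

Lemma l2re_lin (a : C) x y : l2re (a *: x + y) =
  fun i => complex.Re a * l2re x i + (- complex.Im a * l2im x i + l2re y i).
Proof.
apply/funext => i; rewrite /l2re /l2im val_lin.
by case: a (val x i) (val y i) => ? ? [? ?] [? ?] /=; ring.
Qed.

Lemma l2im_lin (a : C) x y : l2im (a *: x + y) =
  fun i => complex.Re a * l2im x i + (complex.Im a * l2re x i + l2im y i).
Proof.
apply/funext => i; rewrite /l2re /l2im val_lin.
by case: a (val x i) (val y i) => ? ? [? ?] [? ?] /=; ring.
Qed.

Lemma conjM (a b : C) : Num.conj (a * b) = Num.conj a * Num.conj b.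
Proof. exact: rmorphM. Qed.

Definition l2inner x y : C :=
  (dotp (l2re x) (l2re y) + dotp (l2im x) (l2im y))
  +i* (dotp (l2im x) (l2re y) - dotp (l2re x) (l2im y)).

Lemma l2inner_linear (a : C) x y z :
  l2inner (a *: x + y) z = a * l2inner x z + l2inner y z.
Proof.
have s c c' (f g h k : I -> R) : sqsummable f -> sqsummable g -> sqsummable h ->
    sqsummable k -> dotp (fun i => c * f i + (c' * g i + h i)) k =
    c * dotp f k + (c' * dotp g k + dotp h k).
  by move=> *; rewrite !dotp_lin//; exact: sqsummable_lin.
rewrite /l2inner l2re_lin l2im_lin !s//.
by case: a => a b /=; congr (_ +i* _); ring.
Qed.

Lemma l2inner_conj x y : l2inner y x = Num.conj (l2inner x y).
Proof.
rewrite /l2inner -[RHS]/(_ -i* _) /=; congr (_ +i* _).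
  by rewrite dotpC (dotpC (l2im y)).
by rewrite (dotpC (l2im y)) (dotpC (l2re y)) [RHS]opprB.
Qed.

Definition l2sq x : R := dotp (l2re x) (l2re x) + dotp (l2im x) (l2im x).

Lemma l2inner_sq x : l2inner x x = (l2sq x)%:C.
Proof. by rewrite /l2inner dotpC subrr. Qed.

Lemma l2sq_ge0 x : 0 <= l2sq x.
Proof. by rewrite addr_ge0// dotp_ge0. Qed.

Lemma l2innerDr x y z : l2inner x (y + z) = l2inner x y + l2inner x z.
Proof.
rewrite l2inner_conj -[y]scale1r l2inner_linear mul1r scale1r.
by rewrite [RHS](congr2 +%R (l2inner_conj y x) (l2inner_conj z x)) rmorphD.
Qed.

Lemma l2innerZl (a : C) x z : l2inner (a *: x) z = a * l2inner x z.
Proof.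
have l0 : l2inner 0 z = 0.
  have := l2inner_linear 1 0 0 z; rewrite scaler0 addr0 mul1r.
  by move/(congr1 (fun t => t - l2inner 0 z)); rewrite subrr addrK.
by have := l2inner_linear a x 0 z; rewrite !addr0 l0 addr0.
Qed.

Lemma l2sqZ (a : C) x : (l2sq (a *: x))%:C = `|a| ^+ 2 * (l2sq x)%:C.
Proof.
rewrite -!l2inner_sq l2innerZl l2inner_conj l2innerZl conjM -l2inner_conj.
by rewrite normCK mulrA.
Qed.

Lemma l2sqD x y :
  l2sq (x + y) = l2sq x + 2 * complex.Re (l2inner x y) + l2sq y.
Proof.
apply: complexI; rewrite -l2inner_sq -{1}[x]scale1r l2inner_linear mul1r.
rewrite !l2innerDr !l2inner_sq [l2inner y x]l2inner_conj.
by case: (l2inner x y) => p r; apply/eqP; rewrite eq_complex /=; apply/andP; split;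
  apply/eqP; ring.
Qed.

Lemma l2_CauchySchwarz x y : complex.Re (l2inner x y) ^+ 2 <= l2sq x * l2sq y.
Proof.
have quad (a b : R) : 0 <= a ^+ 2 * l2sq x + 2 * (a * b) * complex.Re (l2inner x y)
    + b ^+ 2 * l2sq y.
  have := l2sq_ge0 (a%:C *: x + b%:C *: y); rewrite l2sqD.
  have sqE (c : R) z : l2sq (c%:C *: z) = c ^+ 2 * l2sq z.
    apply: complexI; rewrite l2sqZ rmorphM /=; congr (_ * _).
    by rewrite normc_def /= expr0n /= addr0 -rmorphXn /= sqr_sqrtr ?sqr_ge0.
  rewrite !sqE; congr (_ <= _ + _ + _).
  rewrite l2innerZl l2inner_conj l2innerZl conjM -l2inner_conj.
  by case: (l2inner x y) => p r /=; ring.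
have := l2sq_ge0 x; have := l2sq_ge0 y.
move: quad; move: (l2sq x) (l2sq y) (complex.Re _) => A D B quad D0 A0.
move: D0; rewrite le_eqVlt => /predU1P[D0|D0].
  by have := quad B (- (A + 1)); rewrite -D0; nra.
have h : 0 <= D * (A * D - B ^+ 2) by have := quad D (- B); nra.
by move: h; rewrite pmulr_rge0// subr_ge0.
Qed.

Definition l2norm x : C := (Num.sqrt (l2sq x))%:C.

Lemma l2normD x y : l2norm (x + y) <= l2norm x + l2norm y.
Proof.
rewrite /l2norm -rmorphD lecR -(@ler_pXn2r _ 2)// ?nnegrE ?addr_ge0 ?sqrtr_ge0//.
rewrite sqrrD !sqr_sqrtr ?l2sq_ge0// l2sqD lerD2r lerD2l mulr_natl lerMn2r /=.
rewrite -sqrtrM ?l2sq_ge0//; apply: le_trans (ler_norm _) _.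
by rewrite -sqrtr_sqr ler_wsqrtr// l2_CauchySchwarz.
Qed.

Lemma l2normZ (a : C) x : l2norm (a *: x) = `|a| * l2norm x.
Proof.
have a0 : 0 <= `|a| * l2norm x by rewrite mulr_ge0// /l2norm ler0c sqrtr_ge0.
have b0 : 0 <= l2norm (a *: x) by rewrite /l2norm ler0c sqrtr_ge0.
apply/eqP; rewrite -(@eqrXn2 _ 2)// exprMn /l2norm -!rmorphXn /= !sqr_sqrtr ?l2sq_ge0//.
by rewrite l2sqZ rmorphXn.
Qed.

Lemma l2sq_coord x i : l2re x i ^+ 2 + l2im x i ^+ 2 <= l2sq x.
Proof.
rewrite /l2sq !dotp_psum// lerD//.
  by have := le_psum (l2re_summable x) (isT : uniq [:: i]); rewrite big_seq1.
by have := le_psum (l2im_summable x) (isT : uniq [:: i]); rewrite big_seq1.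
Qed.

Lemma l2norm_eq0 x : l2norm x = 0 -> x = 0.
Proof.
move=> [/eqP]; rewrite sqrtr_eq0 => x0.
apply: val_inj; apply/funext => i; rewrite raddf0.
have := le_trans (l2sq_coord x i) x0; rewrite /l2re /l2im.
have := sqr_ge0 (complex.Re (val x i)); have := sqr_ge0 (complex.Im (val x i)).
case: (val x i) => p r /= h h' h''.
have /eqP : p ^+ 2 = 0 by lra.
have /eqP : r ^+ 2 = 0 by lra.
by rewrite !sqrf_eq0 => /eqP -> /eqP ->.
Qed.

HB.instance Definition _ :=
  Lmodule_isNormed.Build C l2 l2normD l2normZ l2norm_eq0.

Lemma l2_normE x : `|x| = (Num.sqrt (l2sq x))%:C.
Proof. by []. Qed.

Lemma pos_complexP (e : C) : 0 < e -> exists2 r : R, 0 < r & e = r%:C.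
Proof.
by case: e => a b; rewrite ltcE /= => /andP[/eqP -> a0]; exists a.
Qed.

Lemma l2_ballP x0 (e : R) (y : l2) : 0 < e ->
  ball x0 (e%:C : C) y <-> l2sq (x0 - y) < e ^+ 2.
Proof.
move=> e0; rewrite -ball_normE /ball_ /= l2_normE ltcR.
have ee : Num.sqrt (e ^+ 2) = e by rewrite sqrtr_sqr gtr0_norm.
by rewrite -{1}ee ltr_sqrt ?exprn_gt0.
Qed.

Lemma l2re_sub x y i : l2re (x - y) i = l2re x i - l2re y i.
Proof.
have := congr1 (fun f => f i) (l2re_lin (-1) y x); rewrite scaleN1r addrC => -> /=.
by rewrite oppr0; ring.
Qed.

Lemma l2im_sub x y i : l2im (x - y) i = l2im x i - l2im y i.
Proof.
have := congr1 (fun f => f i) (l2im_lin (-1) y x); rewrite scaleN1r addrC => -> /=.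
by rewrite oppr0; ring.
Qed.

Lemma l2sq_psum x : l2sq x = psum (fun i => l2re x i ^+ 2 + l2im x i ^+ 2).
Proof.
by rewrite /l2sq !dotp_psum// (psumD (l2re_summable x) (l2im_summable x)).
Qed.

(** Coordinates are 1-Lipschitz, hence converge. Bounds on finite partial sums pass to the limit, as
    in Fatou's lemma; this puts the limit family in [l2] and gives convergence in norm. *)
Lemma l2_complete (F : set_system l2) : ProperFilter F -> cauchy F -> cvg F.
Proof.
move=> FF Fc.
have near_cauchy (e : R) : 0 < e ->
    exists x0, F [set x | l2sq (x0 - x) < e ^+ 2].
  move=> e0; have e0' : 0 < e%:C by rewrite ltcE /= eqxx.
  have [x0 Fx0] := (cauchyP F).1 Fc _ e0'; exists x0.
  by apply: filterS Fx0 => x /l2_ballP; exact.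
have coord_cvg (f : l2 -> R) :
    (forall x y, (f x - f y) ^+ 2 <= l2sq (x - y)) ->
    exists a, f @ F --> (a : R).
  move=> fle; suff : cvg (f @ F) by move/cvg_ex => [a fa]; exists a.
  apply: cauchy_cvg; apply/cauchyP => e e0.
  have [x0 Fx0] := near_cauchy e e0; exists (f x0).
  suff h : F [set x | ball (f x0 : R) e (f x)] by exact: h.
  apply: filterS Fx0 => x /= xe.
  rewrite -ball_normE /ball_ /= -(ltr_pXn2r (n := 2)) ?nnegrE ?normr_ge0 ?ltW//.
  by rewrite real_normK ?num_real//; apply: le_lt_trans xe.
have recvg i : exists a, (fun x => l2re x i) @ F --> (a : R).
  apply: coord_cvg => x y; rewrite -l2re_sub.
  by apply: le_trans (l2sq_coord _ i); rewrite lerDl sqr_ge0.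
have imcvg i : exists a, (fun x => l2im x i) @ F --> (a : R).
  apply: coord_cvg => x y; rewrite -l2im_sub.
  by apply: le_trans (l2sq_coord _ i); rewrite lerDr sqr_ge0.
pose a i := projT1 (cid (recvg i)); pose b i := projT1 (cid (imcvg i)).
have acvg i : (fun x => l2re x i) @ F --> (a i : R) by exact: projT2 (cid (recvg i)).
have bcvg i : (fun x => l2im x i) @ F --> (b i : R) by exact: projT2 (cid (imcvg i)).
have limle x0 (e : R) : F [set x | l2sq (x0 - x) < e ^+ 2] -> forall s, uniq s ->
    \sum_(i <- s) ((l2re x0 i - a i) ^+ 2 + (l2im x0 i - b i) ^+ 2) <= e ^+ 2.
  move=> Fx0 s us.
  pose S x := \sum_(i <- s) ((l2re x0 i - l2re x i) ^+ 2 + (l2im x0 i - l2im x i) ^+ 2).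
  have Scvg : S @ F --> \sum_(i <- s) ((l2re x0 i - a i) ^+ 2 + (l2im x0 i - b i) ^+ 2).
    have sqcvg (f : l2 -> R) (c l : R) : f @ F --> l ->
        (fun x => (c - f x) ^+ 2) @ F --> (c - l) ^+ 2.
      move=> fl; have d : (fun x => c - f x) @ F --> c - l.
        by apply: cvgB => //; exact: cvg_cst.
      rewrite expr2 (_ : (fun x => _) = fun x => (c - f x) * (c - f x)).
        exact: cvgM.
      by apply/funext => x; rewrite expr2.
    rewrite /S; elim: (s) => [|i s' IHs].
      rewrite big_nil (_ : (fun x => _) = fun=> 0); first exact: cvg_cst.
      by apply/funext => x; rewrite big_nil.
    rewrite big_cons (_ : (fun x => _) = fun x =>
      ((l2re x0 i - l2re x i) ^+ 2 + (l2im x0 i - l2im x i) ^+ 2) +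
      \sum_(i <- s') ((l2re x0 i - l2re x i) ^+ 2 + (l2im x0 i - l2im x i) ^+ 2)).
      by apply: cvgD => //; apply: cvgD; exact: sqcvg.
    by apply/funext => x; rewrite big_cons.
  apply: (@closed_cvg _ _ F FF S [set z | z <= e ^+ 2] _ _ _ Scvg).
    exact: closed_le.
  apply: filterS Fx0 => x /= /ltW; apply: le_trans; rewrite /S l2sq_psum.
  have sm : nsummable (fun i => l2re (x0 - x) i ^+ 2 + l2im (x0 - x) i ^+ 2).
    exact: (nsummableD (l2re_summable _) (l2im_summable _)).
  have := le_psum sm us; congr (_ <= _); apply: eq_bigr => i _.
  by rewrite l2re_sub l2im_sub.
have [x0 Fx0] := near_cauchy 1 ltr01.
have diff_sq (f g : I -> R) : (forall i, f i ^+ 2 <= g i) ->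
    (forall s, uniq s -> \sum_(i <- s) g i <= 1 ^+ 2) -> sqsummable f.
  move=> fg gs; split=> [i|]; first exact: sqr_ge0.
  by exists (1 ^+ 2) => s us; apply: le_trans (gs s us); apply: ler_sum => i _.
have da : sqsummable (fun i => l2re x0 i - a i).
  by apply: diff_sq (limle _ _ Fx0) => i; rewrite lerDl sqr_ge0.
have db : sqsummable (fun i => l2im x0 i - b i).
  by apply: diff_sq (limle _ _ Fx0) => i; rewrite lerDr sqr_ge0.
have ys : (fun i => a i +i* b i : C^o) \in l2_pred.
  apply/asboolP; split => /=.
    have := sqsummable_lin (-1) da (l2re_summable x0); congr sqsummable.
    by apply/funext => i; ring.
  have := sqsummable_lin (-1) db (l2im_summable x0); congr sqsummable.
  by apply/funext => i; ring.
pose y : l2 := exist _ (fun i => a i +i* b i : C^o) ys.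
apply/cvg_ex; exists y; apply/fcvgrPdist_lt => _ /pos_complexP[e e0 ->].
have e20 : 0 < e / 2 by rewrite divr_gt0.
have [x1 Fx1] := near_cauchy _ e20.
have x1y : l2sq (x1 - y) <= (e / 2) ^+ 2.
  rewrite l2sq_psum; apply: psum_le => s us.
  have := limle _ _ Fx1 s us; congr (_ <= _); apply: eq_bigr => i _.
  by rewrite l2re_sub l2im_sub.
apply: filterS Fx1 => x /= x1x.
have -> : y - x = (x1 - x) - (x1 - y).
  by rewrite opprB [RHS]addrC addrA subrK.
apply: le_lt_trans (ler_normB _ _) _.
rewrite !l2_normE -rmorphD ltcR [ltRHS](splitr e).
have sqrt_e : Num.sqrt ((e / 2) ^+ 2) = e / 2 by rewrite sqrtr_sqr gtr0_norm.
apply: ltr_leD.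
  by rewrite -sqrt_e ltr_sqrt// exprn_gt0.
by rewrite -sqrt_e ler_wsqrtr.
Qed.

HB.instance Definition _ := Uniform_isComplete.Build l2 l2_complete.

Lemma l2inner_norm x : l2inner x x = `|x| ^+ 2.
Proof.
by rewrite l2inner_sq l2_normE -rmorphXn /= sqr_sqrtr// l2sq_ge0.
Qed.

HB.instance Definition _ := isHilbert.Build R l2 l2inner_linear l2inner_conj
  l2inner_norm.

End L2.

(** * The canonical trace *)

Section RegularRepresentation.
Variables (R : realType) (G : groupType).
Local Notation C := (R[i]).
Local Notation H := (l2 R G).

Lemma nsummable_shift (g : G) (h : G -> R) :
  nsummable h -> nsummable (fun x => h (g * x)%g).
Proof.
move=> [h0 [M hM]]; split => //; exists M => s us.
have := hM [seq (g * x)%g | x <- s]; rewrite big_map; apply.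
by rewrite map_inj_uniq//; exact: mulgI.
Qed.

Lemma regular_rep_subproof (g : G) (x : H) :
  (fun k => val x (g^-1 * k)%g : C^o) \in @l2_pred R G.
Proof.
apply/asboolP; split.
  exact: (nsummable_shift g^-1%g (l2re_summable x)).
exact: (nsummable_shift g^-1%g (l2im_summable x)).
Qed.

Definition regular_rep_fun (g : G) (x : H) : H :=
  exist _ (fun k => val x (g^-1 * k)%g : C^o) (regular_rep_subproof g x).

Lemma regular_rep_linear g : linear (regular_rep_fun g).
Proof.
move=> a x y; apply: val_inj; apply/funext => k.
by rewrite val_lin -[LHS]/(val (a *: x + y) _) val_lin.
Qed.

HB.instance Definition _ g :=
  GRing.isLinear.Build C H H _ (regular_rep_fun g) (regular_rep_linear g).

Definition regular_rep (g : G) : {linear H -> H} := regular_rep_fun g.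

Lemma regular_rep_unitary : unitary_rep (H := H) regular_rep.
Proof.
split=> [x|g h x|g x y].
- by apply: val_inj; apply/funext => k /=; rewrite invg1 mul1g.
- by apply: val_inj; apply/funext => k /=; rewrite invgM mulgA.
- have K : cancel (fun k => g^-1 * k)%g (fun k => g * k)%g by move=> k; rewrite mulVKg.
  have K' : cancel (fun k => g * k)%g (fun k => g^-1 * k)%g by move=> k; rewrite mulKg.
  have dE a b : dotp (fun k => a (g^-1 * k)%g) (fun k => b (g^-1 * k)%g) = dotp a b :> R.
    exact: (tsum_bij (fun i => a i * b i) K K').
  rewrite -[LHS]/(l2inner _ _) -[RHS]/(l2inner _ _) /l2inner.
  by congr (_ +i* _); [congr (_ + _)|congr (_ - _)]; exact: dE.
Qed.

End RegularRepresentation.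

Section CoefficientBound.
Variables (R : realType) (G : groupType).
Local Notation C := (R[i]).
Local Notation H := (l2 R G).

(** Repeated group elements are allowed, so that adding and scaling combinations are list
    operations; [lcomb_collect] returns to coefficients indexed by distinct elements. *)
Definition lcomb (V : lmodType C) (f : G -> V) (w : seq (C * G)) : V :=
  \sum_(p <- w) p.1 *: f p.2.

Lemma lcomb_collect w : exists (c : G -> C) (s : seq G), uniq s /\
  forall (V : lmodType C) (f : G -> V), lcomb f w = \sum_(g <- s) c g *: f g.
Proof.
exists (fun g => \sum_(p <- w | p.2 == g) p.1), (undup [seq p.2 | p <- w]).
split=> [|V f]; first exact: undup_uniq.
under eq_bigr do rewrite scaler_suml.
rewrite (exchange_big_dep predT)//= /lcomb big_seq [RHS]big_seq.
apply: eq_bigr => p pw.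
rewrite (eq_bigl (pred1 p.2)) => [|g]; last by rewrite /= eq_sym.
rewrite -[RHS]big_filter filter_pred1_uniq ?undup_uniq ?big_seq1//.
by rewrite mem_undup map_f.
Qed.

Definition coef1 (w : seq (C * G)) : C := \sum_(p <- w) p.1 * (p.2 == 1%g)%:R.

Lemma delta_l2_subproof :
  (fun k => (k == 1%g)%:R : C^o) \in @l2_pred R G.
Proof.
apply/asboolP; split.
  split=> [k|]; first exact: sqr_ge0.
  exists 1 => s us; rewrite (eq_bigr (fun k => (k == 1%g)%:R)); last first.
    by move=> k _; case: eqVneq => _ /=; rewrite ?expr1n ?expr0n.
  have [s1|s1] := boolP (1%g \in s).
    rewrite (bigD1_seq 1%g)//= eqxx big1 ?addr0// => k k1.
    by rewrite (negPf k1).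
  rewrite big1_seq ?ler01// => k /andP[_ ks]; case: eqVneq => // k1.
  by rewrite -k1 ks in s1.
split=> [k|]; first exact: sqr_ge0.
exists 0 => s us; rewrite big1// => k _.
by case: eqVneq => _ /=; rewrite expr0n.
Qed.

Definition delta_l2 : H := exist _ (fun k => (k == 1%g)%:R : C^o) delta_l2_subproof.

Lemma delta_l2_norm : `|delta_l2| <= 1.
Proof.
rewrite l2_normE -[leRHS](rmorph1 (real_complex R)) lecR -[leRHS]sqrtr1 ler_wsqrtr//.
rewrite l2sq_psum; apply: psum_le => s us.
rewrite (eq_bigr (fun k => (k == 1%g)%:R)); last first.
  by move=> k _; rewrite /l2re /l2im /=; case: eqVneq => _ /=;
    rewrite expr0n/= addr0 ?expr1n ?expr0n.
have [s1|s1] := boolP (1%g \in s).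
  rewrite (bigD1_seq 1%g)//= eqxx big1 ?addr0// => k k1.
  by rewrite (negPf k1).
rewrite big1_seq ?ler01// => k /andP[_ ks]; case: eqVneq => // k1.
by rewrite -k1 ks in s1.
Qed.

Lemma l2_coord_le (x : H) k : `|val x k : C| <= `|x|.
Proof.
rewrite -(@ler_pXn2r _ 2)// ?nnegrE// -add_Re2_Im2 -l2inner_norm l2inner_sq lecR.
exact: l2sq_coord.
Qed.

Lemma unitary_rep_norm (K : hilbertType R) (pi : G -> {linear K -> K}) g x :
  unitary_rep pi -> `|pi g x| = `|x|.
Proof.
move=> [_ _ /(_ g x x)]; rewrite !inner_norm => /eqP.
by rewrite eqrXn2// => /eqP.
Qed.

(** Unitaries preserve norms, so every value in the supremum is at most the sum of the [|c g|];
    boundedness makes [sup] a genuine upper bound. *)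
Lemma universal_norm_ge (K : hilbertType R) (pi : G -> {linear K -> K}) (x : K)
    (c : G -> C) s : unitary_rep pi -> `|x| <= 1 ->
  `|\sum_(g <- s) c g *: pi g x| <= (universal_norm c s)%:C.
Proof.
move=> piU x1.
have ReE (V : normedModType C) (z : V) : (complex.Re `|z|)%:C = `|z|.
  by apply: RRe_real; exact: ger0_real.
rewrite -[leLHS]ReE lecR; apply: ub_le_sup; last first.
  by exists K, pi, x; split => //; rewrite ReE.
exists (\sum_(g <- s) complex.Re `|c g|) => r [K' [pi' [x' [piU' x'1 rE]]]].
rewrite -lecR rE rmorph_sum; apply: le_trans (ler_norm_sum _ _ _) _.
apply: ler_sum => g _; rewrite normrZ unitary_rep_norm//.
by rewrite [leRHS](ReE C^o) ler_piMr.
Qed.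

(** The regular representation sends δ_1 to the family of collected coefficients, whose coordinate
    at 1 is [coef1 w]. *)
Lemma coef1_le (A : cstarAlgType R) (u : G -> A) w :
  full_group_cstar u -> `|coef1 w| <= (cnorm (lcomb u w))%:C.
Proof.
move=> [_ _ _ _ uN]; have [c [s [us wE]]] := lcomb_collect w.
rewrite wE uN; apply: le_trans (universal_norm_ge c s (@regular_rep_unitary R G) delta_l2_norm).
apply: le_trans (l2_coord_le _ 1%g).
have -> // : coef1 w = val (\sum_(g <- s) c g *: regular_rep R g delta_l2) 1%g.
rewrite -[LHS]/(lcomb (fun g => (g == 1%g)%:R : C^o) w) wE.
have vD (x y : H) : val (x + y) 1%g = val x 1%g + val y 1%g by rewrite raddfD.
have v0 : val (0 : H) 1%g = 0 by rewrite raddf0.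
rewrite (big_morph (fun x : H => val x 1%g) vD v0); apply: eq_bigr => g _.
rewrite (_ : val (c g *: _) 1%g = c g *: val (regular_rep R g delta_l2) 1%g).
  by congr (_ *: _); rewrite /= mulg1 -(inj_eq invg_inj) invg1.
by rewrite linearZ.
Qed.

End CoefficientBound.

(** * Continuous extension from the group algebra to its completion *)

Section CStarNorm.
Variables (R : realType) (A : cstarAlgType R).
Local Notation C := (R[i]).
Implicit Types a b : A.

Lemma cnorm0 : cnorm (0 : A) = 0.
Proof. by apply: complexI; rewrite -(scale0r (0 : A)) cnormZ normr0 mul0r. Qed.

Lemma cnormN a : cnorm (- a) = cnorm a.
Proof. by apply: complexI; rewrite -scaleN1r cnormZ normrN normr1 mul1r. Qed.

Lemma cnorm_ge0 a : 0 <= cnorm a.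
Proof. by have := cnormD_le a (- a); rewrite subrr cnorm0 cnormN; lra. Qed.

Lemma cnormB a b : cnorm (a - b) = cnorm (b - a).
Proof. by rewrite -cnormN opprB. Qed.

Lemma cnorm_star a : cnorm (star a) = cnorm a.
Proof.
have le b : cnorm b <= cnorm (star b).
  have := cnormM_le (star b) b; rewrite cnorm_star_mul expr2.
  have := cnorm_ge0 b; rewrite le_eqVlt => /predU1P[<- _|b0].
    exact: cnorm_ge0.
  by rewrite ler_pM2r.
by apply/eqP; rewrite eq_le le andbT -[X in _ <= cnorm X]starK le.
Qed.

End CStarNorm.

Section Density.
Variables (R : realType) (G : groupType) (A : cstarAlgType R) (u : G -> A).
Local Notation C := (R[i]).
Hypothesis uF : full_group_cstar u.

Lemma lcomb_dense (a : A) (e : R) : 0 < e -> exists w, cnorm (a - lcomb u w) < e.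
Proof.
move=> e0; have [_ _ _ /(_ a e e0)[c [s h]] _] := uF.
by exists [seq (c g, g) | g <- s]; rewrite /lcomb big_map.
Qed.

Lemma normc_small_eq0 (z : C) (K : R) : 0 <= K ->
  (forall e : R, 0 < e -> `|z| <= (K * e)%:C) -> z = 0.
Proof.
move=> K0 zle; apply/eqP; rewrite -normr_eq0 normc_def.
have {}zle e : 0 < e -> Num.sqrt (complex.Re z ^+ 2 + complex.Im z ^+ 2) <= K * e.
  by move=> e0; have := zle e e0; rewrite normc_def lecR.
set s := Num.sqrt _ in zle *.
suff -> : s = 0 by [].
apply/eqP; rewrite eq_le sqrtr_ge0 andbT; apply/ler_addgt0Pl => e e0; rewrite addr0.
have K1 : 0 < K + 1 by lra.
apply: le_trans (zle (e / (K + 1)) _) _; first exact: divr_gt0.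
by rewrite mulrA ler_pdivrMr// mulrC; nra.
Qed.

(** Density of the combinations; scalars are absorbed into the elements [z *: u g], so additivity
    and a norm bound suffice. *)
Lemma bounded_additive_eq0 (f : A -> C) (K : R) : 0 <= K ->
  (forall a b, f (a + b) = f a + f b) ->
  (forall a, `|f a| <= (K * cnorm a)%:C) ->
  (forall z g, f (z *: u g) = 0) -> forall a, f a = 0.
Proof.
move=> K0 fD fK fu a.
have f0 : f 0 = 0.
  by have := fD 0 0; rewrite addr0 => /eqP; rewrite addrC -subr_eq subrr => /eqP <-.
have fw w : f (lcomb u w) = 0.
  by rewrite /lcomb (big_morph f fD f0) big1.
apply: (normc_small_eq0 K0) => e e0.
have [w aw] := lcomb_dense a e0.
rewrite -[a](subrK (lcomb u w)) fD fw addr0; apply: le_trans (fK _) _.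
by rewrite lecR ler_wpM2l// ltW.
Qed.

Lemma lcomb_cat (V : lmodType C) (f : G -> V) w w' :
  lcomb f (w ++ w') = lcomb f w + lcomb f w'.
Proof. by rewrite /lcomb big_cat. Qed.

Definition cscale (c : C) (w : seq (C * G)) := [seq (c * p.1, p.2) | p <- w].

Lemma lcomb_scale (V : lmodType C) (f : G -> V) c w :
  lcomb f (cscale c w) = c *: lcomb f w.
Proof.
by rewrite /lcomb big_map scaler_sumr; apply: eq_bigr => p _; rewrite scalerA.
Qed.

Lemma coef1_cat (w w' : seq (C * G)) : coef1 (w ++ w') = coef1 w + coef1 w' :> C.
Proof. by rewrite /coef1 big_cat. Qed.

Lemma coef1_scale c (w : seq (C * G)) : coef1 (cscale c w) = c * coef1 w :> C.
Proof.
by rewrite /coef1 big_map mulr_sumr; apply: eq_bigr => p _; rewrite -mulrA.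
Qed.

Lemma coef1_sub_le w w' :
  `|coef1 w - coef1 w'| <= (cnorm (lcomb u w - lcomb u w'))%:C.
Proof.
have := coef1_le (w ++ cscale (-1) w') uF.
by rewrite lcomb_cat lcomb_scale coef1_cat coef1_scale scaleN1r mulN1r.
Qed.

(* McShane extension of a 1-Lipschitz function of lcomb u w. *)
Definition mcshane (phi : seq (C * G) -> R) (a : A) : R :=
  inf [set phi w + cnorm (a - lcomb u w) | w in setT].

Lemma mcshaneP (phi : seq (C * G) -> R) :
  (forall w w', phi w - phi w' <= cnorm (lcomb u w - lcomb u w')) ->
  forall a w, `|mcshane phi a - phi w| <= cnorm (a - lcomb u w).
Proof.
move=> lip a w.
have lb w' : phi w - cnorm (a - lcomb u w) <= phi w' + cnorm (a - lcomb u w').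
  have := lip w w'; have := cnormD_le (lcomb u w - a) (a - lcomb u w').
  by rewrite addrA subrK (cnormB (lcomb u w) a); lra.
rewrite ler_distl; apply/andP; split.
  apply: lb_le_inf; first by exists (phi w + cnorm (a - lcomb u w)), w.
  by move=> _ [w' _ <-]; exact: lb.
apply: ge_inf; last by exists w.
by exists (phi w - cnorm (a - lcomb u w)) => _ [w' _ <-]; exact: lb.
Qed.

(** Defined by a formula on all of [A] before any linearity is known; the algebraic properties
    follow by approximation with combinations. *)
Definition can_trace (a : A) : C :=
  mcshane (fun w => complex.Re (coef1 w)) a
  +i* mcshane (fun w => complex.Im (coef1 w)) a.

Lemma normc_ge_Im (z : C) : (`|complex.Im z|)%:C <= `|z|.
Proof.
rewrite normc_def lecR -sqrtr_sqr ler_wsqrtr// lerDr sqr_ge0//.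
Qed.

(** The factor 2 adds the errors of the real and imaginary parts. *)
Lemma can_trace_near a w :
  `|can_trace a - coef1 w| <= (2 * cnorm (a - lcomb u w))%:C.
Proof.
have lipr w1 w2 : complex.Re (coef1 w1) - complex.Re (coef1 w2) <=
    cnorm (lcomb u w1 - lcomb u w2) :> R.
  rewrite -lecR; apply: le_trans (coef1_sub_le w1 w2).
  apply: le_trans (normc_ge_Re _); rewrite lecR; apply: le_trans _ (ler_norm _).
  by case: (coef1 w1) (coef1 w2) => ? ? [].
have lipi w1 w2 : complex.Im (coef1 w1) - complex.Im (coef1 w2) <=
    cnorm (lcomb u w1 - lcomb u w2) :> R.
  rewrite -lecR; apply: le_trans (coef1_sub_le w1 w2).
  apply: le_trans (normc_ge_Im _); rewrite lecR; apply: le_trans _ (ler_norm _).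
  by case: (coef1 w1) (coef1 w2) => ? ? [].
have := mcshaneP lipr a w; have := mcshaneP lipi a w.
rewrite /can_trace; move: (mcshane _ a) (mcshane _ a) (cnorm _) => p q d.
case: (coef1 w) => x y /= hi hr.
rewrite [X in `|X|](_ : _ = (p - x)%:C + 'i%C * (q - y)%:C); last first.
  by apply/eqP; rewrite eq_complex /=; apply/andP; split; apply/eqP; ring.
apply: le_trans (ler_normD _ _) _; rewrite normrM.
have nR (r : R) : `|r%:C| = (`|r|)%:C :> C.
  by rewrite normc_def /= expr0n /= addr0 sqrtr_sqr.
have -> : `|'i%C : C| = 1.
  by rewrite normc_def /= expr0n /= add0r expr1n sqrtr1.
by rewrite mul1r !nR -rmorphD lecR; lra.
Qed.

Lemma can_trace_lcomb w : can_trace (lcomb u w) = coef1 w.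
Proof.
apply/eqP; rewrite -subr_eq0 -normr_le0.
by have := can_trace_near (lcomb u w) w; rewrite subrr cnorm0 mulr0.
Qed.

Lemma can_trace_linear : scalar can_trace.
Proof.
move=> c a b; apply/eqP; rewrite -subr_eq0; apply/eqP.
pose n : R := complex.Re `|c|.
have nE : n%:C = `|c| by apply: RRe_real; exact: ger0_real.
have n0 : 0 <= n by rewrite -lecR nE normr_ge0.
(* The three errors are [2 (n e + e)] for the combination, [2 n e] for [a] and [2 e] for [b]. *)
have K0 : 0 <= 4 * n + 4 by lra.
apply: (normc_small_eq0 K0) => e e0.
have [w aw] := lcomb_dense a e0; have [w' bw'] := lcomb_dense b e0.
have h1 := can_trace_near a w; have h2 := can_trace_near b w'.
have := can_trace_near (c *: a + b) (cscale c w ++ w').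
rewrite lcomb_cat lcomb_scale coef1_cat coef1_scale.
have -> : c *: a + b - (c *: lcomb u w + lcomb u w') =
    c *: (a - lcomb u w) + (b - lcomb u w').
  by rewrite scalerBr opprD addrACA.
move=> h3.
have dle : cnorm (c *: (a - lcomb u w) + (b - lcomb u w')) <= n * e + e.
  apply: le_trans (cnormD_le _ _) _; apply: lerD; last exact: ltW.
  rewrite -lecR cnormZ -nE -rmorphM lecR ler_wpM2l// ltW//.
have -> : can_trace (c *: a + b) - (c * can_trace a + can_trace b) =
   (can_trace (c *: a + b) - (c * coef1 w + coef1 w'))
   - c * (can_trace a - coef1 w) - (can_trace b - coef1 w') by ring.
apply: le_trans (ler_normB _ _) _; apply: le_trans (lerD (ler_normB _ _) (lexx _)) _.
rewrite normrM -nE.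
apply: le_trans (lerD (lerD h3 (ler_wpM2l _ h1)) h2) _; first by rewrite ler0c.
rewrite -rmorphM -!rmorphD lecR.
have := cnorm_ge0 (a - lcomb u w); nra.
Qed.

HB.instance Definition _ :=
  GRing.isLinear.Build C A C *%R can_trace can_trace_linear.

Lemma can_traceE g : can_trace (u g) = (g == 1%g)%:R.
Proof.
have := can_trace_lcomb [:: (1, g)].
by rewrite /lcomb /coef1 !big_seq1 /= scale1r mul1r.
Qed.

Lemma can_traceZE z g : can_trace (z *: u g) = z * (g == 1%g)%:R.
Proof.
have ct0 : can_trace 0 = 0 by exact: linear0.
by rewrite -[z *: u g]addr0 can_trace_linear can_traceE ct0 addr0.
Qed.

Lemma can_trace_le a : `|can_trace a| <= (cnorm a)%:C.
Proof.
have ReE (z : C) : (complex.Re `|z|)%:C = `|z|.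
  by apply: RRe_real; exact: ger0_real.
rewrite -ReE lecR; apply/ler_addgt0Pl => e e0.
have e3 : 0 < e / 3 by lra.
have [w aw] := lcomb_dense a e3.
rewrite -lecR ReE -[can_trace a](subrK (coef1 w)).
apply: le_trans (ler_normD _ _) _.
apply: le_trans (lerD (can_trace_near a w) (coef1_le w uF)) _.
rewrite -rmorphD lecR.
have := cnormD_le (lcomb u w - a) a; rewrite subrK (cnormB (lcomb u w) a); lra.
Qed.

(** Density is used once per factor: first against a multiple of a group element, where the claim
    reduces to [g' g = 1] iff [g g' = 1], then in general. *)
Lemma can_traceC a b : can_trace (a * b) = can_trace (b * a).
Proof.
have [u1 uM uV _ _] := uF.
have comm_le x y : `|can_trace (x * y) - can_trace (y * x)| <=
    (2 * cnorm y * cnorm x)%:C.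
  apply: le_trans (ler_normB _ _) _.
  apply: le_trans (lerD (can_trace_le _) (can_trace_le _)) _.
  rewrite -rmorphD lecR.
  by have := cnormM_le x y; have := cnormM_le y x; lra.
have step1 z g x : can_trace (x * (z *: u g)) = can_trace (z *: u g * x).
  apply/eqP; rewrite -subr_eq0; apply/eqP; move: x.
  apply: (@bounded_additive_eq0 (fun x => _ - _) (2 * cnorm (z *: u g))).
  - by rewrite mulr_ge0 ?cnorm_ge0.
  - by move=> x y; rewrite mulrDl mulrDr !linearD /=; ring.
  - by move=> x; exact: comm_le.
  - move=> z' g'; rewrite -!scalerAl -!scalerAr -!uM !scalerA !can_traceZE.
    rewrite (mulrC z') -mulrBr (_ : (g' * g == 1)%g = (g * g' == 1)%g).
      by rewrite subrr mulr0.
    by rewrite !mulg_eq1 -(inj_eq invg_inj) invgK eq_sym.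
apply/eqP; rewrite -subr_eq0; apply/eqP; move: b.
apply: (@bounded_additive_eq0 (fun b => _ - _) (2 * cnorm a)).
- by rewrite mulr_ge0 ?cnorm_ge0.
- by move=> x y; rewrite mulrDl mulrDr !linearD /=; ring.
- move=> x; rewrite distrC; exact: comm_le.
- by move=> z g; rewrite step1 subrr.
Qed.

Lemma can_trace_pos a : 0 <= can_trace (star a * a).
Proof.
have [u1 uM uV _ _] := uF.
have wpos w : 0 <= can_trace (star (lcomb u w) * lcomb u w).
  have [c [s [us wE]]] := lcomb_collect w; rewrite wE star_sum mulr_suml linear_sum.
  rewrite big_seq; apply: sumr_ge0 => g gs.
  rewrite mulr_sumr linear_sum (bigD1_seq g)//= big1 ?addr0.
    rewrite starZ -scalerAl -scalerAr scalerA uV -uM mulVg can_traceZE eqxx mulr1.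
    by rewrite mulrC -normCK exprn_ge0.
  move=> h hg; rewrite starZ -scalerAl -scalerAr scalerA uV -uM can_traceZE.
  by rewrite mulg_eq1 (inj_eq invg_inj) eq_sym (negPf hg) mulr0.
(* Replacing [a] by an approximation in [star a * a] costs at most [|a| e + e (|a| + e)], which is
   below [K e] when [e <= 1]. *)
pose K := 2 * cnorm a + 1.
have K0 : 0 <= K by rewrite /K; have := cnorm_ge0 a; lra.
have near e : 0 < e -> e <= 1 -> exists2 r : R, 0 <= r &
    `|can_trace (star a * a) - r%:C| <= (K * e)%:C.
  move=> e0 e1; have [w aw] := lcomb_dense a e0; have := wpos w.
  set x := lcomb u w in aw * => x0; exists (complex.Re (can_trace (star x * x))).
    by move: x0; rewrite lecE /= => /andP[].
  rewrite (RRe_real (ger0_real x0)) -linearB /=.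
  have -> : star a * a - star x * x = star a * (a - x) + star (a - x) * x.
    have -> : star (a - x) = star a - star x.
      by rewrite starD -scaleN1r starZ rmorphN rmorph1 scaleN1r.
    by rewrite mulrBr mulrBl addrA subrK.
  apply: le_trans (can_trace_le _) _; rewrite lecR.
  apply: le_trans (cnormD_le _ _) _.
  apply: le_trans (lerD (cnormM_le _ _) (cnormM_le _ _)) _; rewrite !cnorm_star.
  have xle : cnorm x <= cnorm a + e.
    by have := cnormD_le (x - a) a; rewrite subrK (cnormB x a); lra.
  have := cnorm_ge0 a; have := cnorm_ge0 (a - x); have := cnorm_ge0 x.
  rewrite /K; move: (cnorm a) (cnorm x) (cnorm (a - x)) aw xle => p q d dlt qle *.
  apply: (@le_trans _ _ (p * e + e * (p + e))); first by apply: lerD; nra.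
  nra.
move: near; case: (can_trace (star a * a)) => x y near.
have small (z : R) : (forall e, 0 < e -> e <= 1 -> z <= K * e) -> z <= 0.
  move=> zle; apply/ler_addgt0Pl => e e0; rewrite addr0.
  have K1 : 0 < K + 1 by lra.
  pose d := Num.min 1 (e / (K + 1)).
  have d0 : 0 < d by rewrite lt_min ltr01 divr_gt0.
  have d1 : d <= 1 by rewrite ge_min lexx.
  apply: le_trans (zle d d0 d1) _.
  have : d <= e / (K + 1) by rewrite ge_min lexx orbT.
  rewrite ler_pdivlMr// => h; apply: le_trans h; rewrite mulrC; nra.
rewrite lecE /=; apply/andP; split.
  rewrite -normr_eq0 eq_le normr_ge0 andbT; apply: small => e e0 e1.
  have [r r0 h] := near e e0 e1; rewrite -lecR; apply: le_trans h.
  by apply: le_trans (normc_ge_Im _); rewrite /= subr0.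
rewrite -oppr_le0; apply: small => e e0 e1.
have [r r0 h] := near e e0 e1; rewrite -lecR; apply: le_trans h.
apply: le_trans (normc_ge_Re _); rewrite lecR /=.
by have := ler_norm (r - x); rewrite distrC; lra.
Qed.

Lemma can_trace_canonical : canonical_trace u can_trace.
Proof.
split; last exact: can_traceE.
have [u1 uM uV _ _] := uF; split.
- exact: can_trace_pos.
- exact: can_trace_le.
- by have := can_traceE 1%g; rewrite u1 eqxx.
- exact: can_traceC.
Qed.

Lemma canonical_trace_exists : exists tau : {scalar A}, canonical_trace u tau.
Proof. by exists can_trace; exact: can_trace_canonical. Qed.

Lemma contractive_additive_eq (f f' : A -> C) :
  (forall a b, f (a + b) = f a + f b) -> (forall a, `|f a| <= (cnorm a)%:C) ->
  (forall a b, f' (a + b) = f' a + f' b) -> (forall a, `|f' a| <= (cnorm a)%:C) ->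
  (forall z g, f (z *: u g) = f' (z *: u g)) -> f =1 f'.
Proof.
move=> fD fle fD' fle' h a.
apply/eqP; rewrite -subr_eq0; apply/eqP; move: a.
apply: (@bounded_additive_eq0 (fun a => f a - f' a) 2) => //.
- by move=> x y; rewrite fD fD'; ring.
- move=> x; apply: le_trans (ler_normB _ _) _.
  by apply: le_trans (lerD (fle _) (fle' _)) _; rewrite -rmorphD lecR; lra.
- by move=> z g; rewrite h subrr.
Qed.

End Density.

(** * Support of a trace and uniqueness of the tracial extension *)

Section Support.
Variables (R : realType) (Gamma : groupType) (S : {pred Gamma})
  (Lambda : subGroupType S) (CG CL : cstarAlgType R)
  (u : Gamma -> CG) (v : Lambda -> CL) (j : {lrmorphism CL -> CG}).
Hypothesis uF : full_group_cstar u.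
Hypothesis jI : canonical_inclusion u v j.
Hypothesis coam : coamenable R [set g | g \in S].

Lemma trace_support (Rad : set Gamma) (tau0 : {scalar CL}) (tau : {scalar CG}) :
  amenable_radical R Rad -> canonical_trace v tau0 -> tracial_state tau ->
  extends j tau tau0 -> forall g, ~ Rad g -> tau (u g) = 0.
Proof.
move=> RadP [_ tau0v] tauT tau_ext g nRg.
have [u1 uM uV _ _] := uF; have [_ _ jv] := jI.
pose t := trace_square tau u.
have t1 : t 1%g = 1 by exact: trace_square1.
have tV x : t (x^-1)%g = t x by exact: trace_squareV.
have tC x y : t (x * y)%g = t (y * x)%g by exact: trace_squareC.
have tpsd : psd (fun x y => t (x^-1 * y)%g) by exact: trace_square_psd.
have S1 : 1%g \in S by rewrite -(val1 Lambda); exact: valP.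
have SM x y : x \in S -> y \in S -> (x * y)%g \in S.
  move=> xS yS; rewrite -[x](SubK Lambda xS) -[y](SubK Lambda yS) -valM.
  exact: valP.
have SV x : x \in S -> (x^-1)%g \in S.
  by move=> xS; rewrite -[x](SubK Lambda xS) -gmulfV; exact: valP.
have tS x : x \in S -> t x = (x == 1%g)%:R.
  move=> xS; apply: complexI; rewrite trace_squareE.
  rewrite -[x](SubK Lambda xS) -jv tau_ext tau0v -(val1 Lambda) (inj_eq val_inj).
  by case: (_ == _); rewrite /= ?rmorph1 ?rmorph0 ?mul1r ?mul0r.
have [T TK Teq] := coamenable_equivariant_map tC coam
  (equivariant_map_subgroup S1 SM SV t1 tV tC tS tpsd).
have X0 : equivariant_maps t !=set0 by exists T.
apply/eqP; rewrite -trace_square_eq0; apply/negPn/negP => tg.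
exact: nRg (support_in_radical t1 tC X0 RadP tg).
Qed.

End Support.

Theorem theorem7p10 (R : realType) (Gamma : groupType) (S : {pred Gamma})
    (Lambda : subGroupType S) (CG CL : cstarAlgType R)
    (u : Gamma -> CG) (v : Lambda -> CL) (j : {lrmorphism CL -> CG}) :
  countable [set: Gamma] ->
  full_group_cstar u -> full_group_cstar v -> canonical_inclusion u v j ->
  coamenable R [set g | g \in S] ->
  (forall (Rad : set Gamma) (tau0 : {scalar CL}) (tau : {scalar CG}),
     amenable_radical R Rad ->
     canonical_trace v tau0 -> tracial_state tau -> extends j tau tau0 ->
     forall g, ~ Rad g -> tau (u g) = 0) /\
  (amenable_radical R [set 1%g : Gamma] -> tracial_rigid u v j).
Proof.
move=> _ uF vF jI coam; have supp := trace_support uF jI coam.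
split => [//|Rad1].
have [_ jN jv] := jI.
have [tauG [tauGT tauGu]] := canonical_trace_exists uF.
have [tauL [tauLT tauLv]] := canonical_trace_exists vF.
have [_ tauGle _ _] := tauGT; have [_ tauLle _ _] := tauLT.
have tauGL : extends j tauG tauL.
  apply: (contractive_additive_eq vF).
  - by move=> a b; rewrite !linearD.
  - by move=> a; rewrite -jN.
  - by move=> a b; rewrite linearD.
  - exact: tauLle.
  move=> z l; rewrite !linearZ /= jv tauGu tauLv; congr (_ * _%:R).
  by rewrite -(val1 Lambda) (inj_eq val_inj).
exists tauG, tauL; split => // tau tauT tau_ext.
have [_ taule tau1 _] := tauT.
apply: (contractive_additive_eq uF) => //.
- by move=> a b; rewrite linearD.
- by move=> a b; rewrite linearD.
move=> z g; rewrite !linearZ /= tauGu; congr (_ * _).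
have [->|g1] := eqVneq g 1%g; first by have [-> _ _ _ _] := uF.
(* For [g] other than 1 the support statement with trivial radical gives [tau (u g) = 0], the value
   of the canonical trace. *)
apply: (supp _ _ _ Rad1 (conj tauLT tauLv) tauT tau_ext) => g1'.
by rewrite g1' eqxx in g1.
Qed.
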